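(* Let $r\ge 1$ be an integer and let $\{X_{ij}: i,j\in\mathbb{N}\}$ be i.i.d. complex random variables with $\mathbb{E}X_{ij}=0$ and $\mathbb{E}|X_{ij}|^2=1$. For $N\ge 1$ let $\lambda^{(N)}=N\cdot(r,r-1,\dots,2,1)$ be the $N$-fold dilation of the staircase partition of length $r$, let $X_N$ be the associated $\lambda^{(N)}$-shaped $rN\times rN$ random matrix, let $W_N=\frac1N X_NX_N^*$, and let $F_N$ be the empirical distribution function of the eigenvalues of $W_N$. Then, with probability $1$, the sequence $(F_N)_{N\ge1}$ converges in distribution (weakly) to the deterministic probability distribution $F_{\langle r\rangle}$ on $\mathbb{R}$ with moments $$\int_{\mathbb{R}} x^k\,dF_{\langle r\rangle}(x)=\frac{1}{k+1}\binom{(r+1)k}{k},\qquad k=0,1,2,\dots$$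
   Context: For a partition $\lambda=(\lambda_1\ge\lambda_2\ge\cdots)$ and $N\in\mathbb{N}$, the dilation $N\lambda$ is the partition $(N\lambda_1,\dots,N\lambda_1,N\lambda_2,\dots,N\lambda_2,\dots)$ in which each $N\lambda_j$ is repeated $N$ times. We write $(i,j)\in\lambda$ if $1\le j\le\lambda_i$. For $\lambda^{(N)}=N\cdot(r,r-1,\dots,1)$ the number of parts is $\ell_N=rN$, and for $1\le i,j\le rN$ one has $(i,j)\in\lambda^{(N)}$ if and only if $\lceil i/N\rceil+\lceil j/N\rceil\le r+1$. The $\lambda^{(N)}$-shaped random matrix $X_N$ is the $rN\times rN$ matrix whose $(i,j)$ entry is $X_{ij}$ if $(i,j)\in\lambda^{(N)}$ and $0$ otherwise (the same array $\{X_{ij}\}$ is used for all $N$). With $x^{(N)}_1\le\cdots\le x^{(N)}_{rN}$ the eigenvalues of the Hermitian matrix $W_N=\frac1N X_NX_N^*$, the empirical distribution function is $F_N(x)=\frac{1}{rN}\#\{j\le rN: x^{(N)}_j\le x\}$. *)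

(* Defs.v *)
From HB Require Import structures.
From mathcomp Require Import all_boot all_order all_algebra.
From mathcomp Require Import all_classical all_reals all_analysis.
From mathcomp Require Import spectral sesquilinear complex finmap.

Set Implicit Arguments.
Unset Strict Implicit.
Unset Printing Implicit Defensive.
Import Order.TTheory GRing.Theory Num.Theory.
Import numFieldNormedType.Exports.

Local Open Scope classical_set_scope.
Local Open Scope ring_scope.
Local Open Scope complex_scope.
Local Open Scope sesquilinear_scope.

(* Partitions are weakly decreasing sequences of positive integers. *)
Definition staircase (r : nat) : seq nat := rev (iota 1 r).

Definition dilation (N : nat) (lam : seq nat) : seq nat :=
  flatten [seq nseq N (N * l)%N | l <- lam].

(* Rows and columns are numbered from 0: (i, j) stands for the cell
   (i + 1, j + 1), which belongs to lam iff j + 1 <= lam_(i + 1). *)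
Definition in_shape (lam : seq nat) (i j : nat) : bool := (j < nth 0 lam i)%N.

Definition shaped_mx (C : nzRingType) (lam : seq nat) (n : nat)
    (A : nat -> nat -> C) : 'M[C]_n :=
  \matrix_(i < n, j < n) (if in_shape lam i j then A i j else 0).

Section Complex.
Variable R : realType.

Definition ReIm (z : R[i]) : R * R := (complex.Re z, complex.Im z).

HB.instance Definition _ := isPointed.Build R[i] 0.

(* The Borel sigma-algebra of the complex plane identified with R x R. *)
HB.instance Definition _ :=
  Measurable.copy R[i] (g_sigma_algebra_preimageType ReIm).

End Complex.

Section Probability.
Context {d d' : measure_display} {T : measurableType d}
  {T' : measurableType d'} {R : realType} (P : probability T R).

(* Mutual independence: the product rule over every finite subfamily. *)
Definition independent {I : choiceType} (X : I -> {RV P >-> T'}) : Prop :=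
  forall (J : {fset I}) (A : I -> set T'),
    (forall i, i \in J -> measurable (A i)) ->
    P (\bigcap_(i in [set` J]) X i @^-1` A i) =
    (\prod_(i <- J) P (X i @^-1` A i))%E.

Definition identically_distributed {I : Type} (X : I -> {RV P >-> T'}) : Prop :=
  forall i j (A : set T'), measurable A ->
    distribution P (X i) A = distribution P (X j) A.

End Probability.

Arguments independent {d d' T T' R} P {I} X.
Arguments identically_distributed {d d' T T' R} P {I} X.

Section Spectrum.
Variable R : realType.

(* W_N = (1 / N) X_N X_N^*, with A the infinite array of entries. The case
   N = 0 is an empty matrix, irrelevant to limits in N. *)
Definition staircase_gram (r N : nat) (A : nat -> nat -> R[i]) :
    'M[R[i]]_(r * N) :=
  let X := shaped_mx (dilation N (staircase r)) (r * N) A in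
  N%:R^-1 *: (X *m X^t*).

(* For a Hermitian (hence normal) matrix W, spectral_diag W lists the
   eigenvalues with multiplicity; they are real, and the order of R[i] compares
   numbers with equal imaginary parts by their real parts. *)
Definition empirical_df (n : nat) (W : 'M[R[i]]_n) (x : R) : R :=
  #|[pred j | spectral_diag W 0 j <= x%:C]|%:R / n%:R.

Definition distribution_function
    (mu : probability (measurableTypeR R) R) (x : R) : R :=
  fine (mu (`]-oo, x]%classic : set R)).

Definition cvg_in_distribution (F_ : nat -> R -> R) (F : R -> R) : Prop :=
  forall x, {for x, continuous F} -> F_ N x @[N --> \oo] --> F x.

Definition fuss_catalan (r k : nat) : R := k.+1%:R^-1 * 'C((r.+1 * k)%N, k)%:R.

Definition fuss_catalan_moments (r : nat)
    (mu : probability (measurableTypeR R) R) : Prop :=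
  forall k : nat,
    mu.-integrable setT (fun x : measurableTypeR R => ((x : R) ^+ k)%:E) /\
    (\int[mu]_x ((x : R) ^+ k)%:E = (fuss_catalan r k)%:E)%E.

End Spectrum.

(* Main.v *)
(* The trace of W_N^k is a sum over closed walks in the bipartite graph whose
   edges are the cells of the shape. For finitely valued entries, only the
   walks with the largest possible number of vertices matter: these traverse
   a plane tree, they are counted by the Raney numbers, and a sum over the r
   block rows gives the Fuss-Catalan number. The same count bounds the
   second moment of the deviation of (1/rN) tr W_N^k by O(1/N^2), so the
   moments converge almost surely by Chebyshev and Borel-Cantelli.

   General entries are approximated in L^2 by finitely valued ones Y_m, again
   centred and normalised. A strong law of large numbers along N = 2^k, using
   truncation at 4^k, bounds |X - Y_m|^2 summed over the rN x rN box by
   C N^2 / m. The traces of powers of the resolvent (1 + W)^-1 are Lipschitz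
   for this Frobenius distance, so they converge. Polynomials in (1 + x)^-1
   then determine the limit of the distribution functions.

   The limit law is the law of u h(a), with u uniform on [0, 1], a uniform on
   [0, pi / (r + 1)] and h(a) = U_r(a)^(r+1) / U_(r-1)(a)^r, where U_n(a) is
   sin((n + 1) a) / sin a. It is the only law with these moments because it
   has compact support. *)

(* Only second moments are assumed, so the expected trace of W_N^k may be infinite, and the
   comparison with finitely valued entries has to go through bounded functions of W_N. Powers of the
   resolvent at the single point -1 suffice: as W_N >= 0, the map x -> 1 / (1 + x) is injective on
   the spectrum with values in [0, 1], where polynomials are dense.

   Finitely valued entries turn each expectation over the rN x rN field into a finite sum over
   configurations of labels; independence enters there only as the product rule for single
   configurations.

   The truncation level 4^k is, up to the factor r^2, the number of cells of the box of side r 2^k.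
   At this level both error series of the law of large numbers are bounded by multiples of the mean.
   Powers of 2 are enough because box sums of nonnegative terms increase with N and only an upper
   bound is wanted.

   In the limit law, h(a) comes from writing C((r+1)k, k) as the coefficient of z^k in (1 +
   z)^((r+1)k), a Cauchy integral along a curve on which (1 + z)^(r+1) / z is real; the uniform
   factor u supplies 1 / (k + 1). *)
From HB Require Import structures.
Require Import Defs.
From mathcomp Require Import all_boot all_order all_algebra.
From mathcomp Require Import all_classical all_reals all_analysis.
From mathcomp Require Import complex.
From mathcomp Require Import zify ring lra.
From mathcomp Require Import measurable_realfun.
From mathcomp Require Import spectral sesquilinear finmap.
Set Implicit Arguments.
Unset Strict Implicit.
Unset Printing Implicit Defensive.
Import Order.TTheory GRing.Theory Num.Theory.
Import numFieldNormedType.Exports.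
Local Open Scope ring_scope.

(** * Mixed moments along walks *)

(* mu a b stands for E(x^a conj(x)^b), and the letter (c, b) for the entry at
   the cell c, conjugated when b holds. *)
Section MixedMoments.
Variables (F : numDomainType) (I : finType) (mu : nat -> nat -> F).
Hypotheses (mu00 : mu 0 0 = 1) (mu10 : mu 1 0 = 0) (mu01 : mu 0 1 = 0)
  (mu11 : mu 1 1 = 1).

Definition mixed_moment (l : seq (I * bool)) : F :=
  \prod_(c : I) mu (count_mem (c, false) l) (count_mem (c, true) l).

Lemma mixed_moment_perm l1 l2 :
  perm_eq l1 l2 -> mixed_moment l1 = mixed_moment l2.
Proof. by move=> /permP e; apply: eq_bigr => c _; rewrite !e. Qed.

Lemma count_cell (c : I) l :
  count (fun e : I * bool => e.1 == c) l =
  (count_mem (c, false) l + count_mem (c, true) l)%N.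
Proof.
elim: l => //= -[d b] l ->; rewrite !xpair_eqE /=.
by case: (d == c); case: b => /=; lia.
Qed.

(** A cell seen once contributes the factor [mu 1 0] or [mu 0 1], which is zero because the entries
    are centred. *)
Lemma mixed_moment_once c l :
  count (fun e : I * bool => e.1 == c) l = 1%N -> mixed_moment l = 0.
Proof.
rewrite count_cell => e; rewrite /mixed_moment (bigD1 c) //=.
case: (count_mem (c, false) l) e => [|[|m]]; case: (count_mem _ l) => [|[|k]] //;
  by rewrite ?mu10 ?mu01 mul0r.
Qed.

(** Each cell occurs in at most one of the two words, so its factor for the other word is
    [mu 0 0 = 1]. *)
Lemma mixed_moment_cat l1 l2 :
  (forall e1 e2, e1 \in l1 -> e2 \in l2 -> e1.1 != e2.1) ->
  mixed_moment (l1 ++ l2) = mixed_moment l1 * mixed_moment l2.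
Proof.
move=> dis; rewrite /mixed_moment -big_split /=; apply: eq_bigr => c _.
rewrite !count_cat.
have [/hasP[e1 e1l /eqP ec]|/hasPn n1] := boolP (has (fun e => e.1 == c) l1).
  have n2 b : count_mem (c, b) l2 = 0%N.
    apply/count_memPn/negP => /(dis _ _ e1l) /=; by rewrite ec eqxx.
  by rewrite !n2 !addn0 mu00 mulr1.
have n2 b : count_mem (c, b) l1 = 0%N.
  by apply/count_memPn/negP => /n1 /=; rewrite eqxx.
by rewrite !n2 !add0n mu00 mul1r.
Qed.

Lemma mixed_moment_pair c b : mixed_moment [:: (c, b); (c, ~~ b)] = 1.
Proof.
rewrite /mixed_moment big1 // => d _ /=; rewrite !xpair_eqE.
by case: (c == d); case: b => /=.
Qed.

Lemma mixed_moment_nil : mixed_moment [::] = 1.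
Proof. by rewrite /mixed_moment big1. Qed.

Lemma norm_mixed_moment (K : F) l : 1 <= K ->
  (forall a b, `|mu a b| <= K ^+ (a + b)) -> `|mixed_moment l| <= K ^+ size l.
Proof.
move=> K1 muK; rewrite normr_prod.
have -> : size l = (\sum_(c : I) count (fun e : I * bool => e.1 == c) l)%N.
  elim: l => [|[c b] l IH] /=; first by rewrite big1.
  rewrite big_split /= -IH (bigD1 c) //= eqxx big1 ?addn0 // => d /negPf.
  by rewrite eq_sym => ->.
rewrite expr_sum; apply: ler_prod => c _.
by rewrite normr_ge0 /= count_cell muK.
Qed.

Section Walks.
Variables (V : finType) (adj : rel V) (cell : V -> V -> I) (flag : V -> V -> bool).
Hypotheses
  (cellC : forall x y, adj x y -> cell y x = cell x y)
  (flagC : forall x y, adj x y -> flag y x = ~~ flag x y)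
  (cell_inj : forall x y x' y', adj x y -> adj x' y' -> cell x y = cell x' y' ->
     (x = x' /\ y = y') \/ (x = y' /\ y = x')).

Fixpoint word (x : V) (s : seq V) : seq (I * bool) :=
  if s is y :: s' then (cell x y, flag x y) :: word y s' else [::].

Lemma size_word x s : size (word x s) = size s.
Proof. by elim: s x => //= y s IH x; rewrite IH. Qed.

Lemma word_cat x s1 s2 : word x (s1 ++ s2) = word x s1 ++ word (last x s1) s2.
Proof. by elim: s1 x => //= y s1 IH x; rewrite IH. Qed.

Lemma mem_word x s e : path adj x s -> e \in word x s ->
  exists u v, [/\ adj u v, e.1 = cell u v, u \in x :: s & v \in x :: s].
Proof.
elim: s x => //= y s IH x /andP[xy ps]; rewrite inE => /orP[/eqP ->|/IH].
  by exists x, y; split; rewrite ?inE ?eqxx ?orbT.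
move=> /(_ ps)[u [v [uv -> us vs]]]; exists u, v.
by split=> //; rewrite inE ?us ?vs orbT.
Qed.

Lemma leaf_cell_notin y u x s e : adj u y -> path adj x s -> y \notin x :: s ->
  e \in word x s -> e.1 != cell u y.
Proof.
move=> uy ps ys /(mem_word ps)[a [b [ab -> ai bi]]]; apply/eqP => ce.
case: (cell_inj ab uy ce) => -[? ?]; subst; by rewrite ?ai ?bi in ys.
Qed.

(* Inserting a step to a fresh vertex y and back leaves the mixed moment
   unchanged, while leaving y by another edge makes it vanish. *)
Lemma mixed_moment_leaf x s1 y z s2 x' s' :
  path adj x (s1 ++ y :: z :: s2) -> path adj x' s' ->
  y \notin x :: s1 ++ z :: s2 -> y \notin x' :: s' ->
  mixed_moment (word x (s1 ++ y :: z :: s2) ++ word x' s') =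
  (z == last x s1)%:R * mixed_moment (word x (s1 ++ s2) ++ word x' s').
Proof.
rewrite cat_path /= => /and4P[p1 ly yz p2] p' yn yn'.
have yn1 : y \notin x :: s1.
  by apply: contra yn; rewrite -cat_cons mem_cat => ->.
have yn2 : y \notin z :: s2.
  by apply: contra yn; rewrite -cat_cons mem_cat => ->; rewrite orbT.
set l := last x s1 in ly *.
rewrite word_cat /= -/l.
have n1 e : e \in word x s1 -> e.1 != cell l y by apply: leaf_cell_notin.
have n2 e : e \in word z s2 -> e.1 != cell l y by apply: leaf_cell_notin.
have n3 e : e \in word x' s' -> e.1 != cell l y by apply: leaf_cell_notin.
have [zl|zl] := eqVneq z l; last first.
  (* As z differs from l, the edge between l and y is traversed only on the way in. *)
  rewrite mul0r; apply: (@mixed_moment_once (cell l y)).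
  have nn w : (forall e, e \in w -> e.1 != cell l y) ->
      count (fun e : I * bool => e.1 == cell l y) w = 0%N.
    by move=> h; apply/eqP; rewrite -leqn0 leqNgt -has_count; apply/hasPn.
  rewrite !count_cat /= nn // nn // nn // eqxx.
  case: eqP => // /(cell_inj yz ly) [[yl _]|[_ zl']]; last by rewrite zl' eqxx in zl.
  by move: yn1; rewrite yl /l mem_last.
subst z; rewrite mul1r word_cat -/l.
rewrite (@mixed_moment_perm _ ([:: (cell l y, flag l y); (cell y l, flag y l)]
     ++ ((word x s1 ++ word l s2) ++ word x' s'))); last first.
  rewrite -catA -[X in perm_eq _ X]/(_ :: _ :: _) -!catA /=.
  by rewrite perm_catC /= perm_cons perm_cons -!catA perm_sym perm_catC -catA.
rewrite mixed_moment_cat; last first.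
  move=> e1 e2; rewrite !inE => /orP[]/eqP -> /=; rewrite ?(cellC ly) !mem_cat
    => /orP[/orP[]|] h; rewrite eq_sym; by [apply: n1|apply: n2|apply: n3].
by rewrite (cellC ly) (flagC ly) mixed_moment_pair mul1r.
Qed.

Lemma card_mem_sum (t : seq V) : #|t| = (\sum_(y : V) (y \in t : nat))%N.
Proof. by rewrite -sum1_card big_mkcond /=; apply: eq_bigr => y _; case: (y \in t). Qed.

Lemma size_sum_count (t : seq V) : size t = (\sum_(y : V) count_mem y t)%N.
Proof.
elim: t => [|x t IH] /=; first by rewrite big1.
by rewrite big_split /= -IH (bigD1 x) //= eqxx big1 ?addn0 // => d /negPf; rewrite eq_sym => ->.
Qed.

(** Pigeonhole: if every vertex of t other than a were visited at least twice, and a at least once,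
    then [2 * #|t| <= size t + 1], one short of the hypothesis. *)
Lemma exists_leaf (a : V) (t : seq V) : a \in t -> (size t + 2 <= 2 * #|a :: t|)%N ->
  exists2 y, y != a & count_mem y t = 1%N.
Proof.
move=> at_ sz.
have e : #|a :: t| = #|t|.
  by apply: eq_card => y; rewrite inE; case: eqP => // ->; rewrite at_.
have [/existsP[y /andP[ya /eqP ct]]|/existsPn h] :=
  boolP [exists y, (y != a) && (count_mem y t == 1%N)]; first by exists y.
have : (2 * #|t| <= size t + 1)%N.
  rewrite card_mem_sum size_sum_count big_distrr /=.
  have s1 : (\sum_(y : V) (y == a) = 1)%N.
    by rewrite (bigD1 a) //= eqxx big1 ?addn0 // => y /negPf ->.
  rewrite -[X in (_ <= _ + X)%N]s1 -big_split /=; apply: leq_sum => y _; have := h y.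
  have [->|ya] /= := eqVneq y a.
    have : (0 < count_mem a t)%N by rewrite -has_count has_pred1.
    by move=> c0 _; rewrite at_ addn1 ltnS.
  by rewrite -has_pred1 has_count; case: (count_mem y t) => [|[|k]].
by move: sz; rewrite e; lia.
Qed.

Lemma split_leaf (a y : V) (t : seq V) : last a t = a -> y != a -> count_mem y t = 1%N ->
  exists s1 z s2, t = s1 ++ y :: z :: s2 /\ y \notin a :: s1 ++ z :: s2.
Proof.
move=> lt ya c1.
have yt : y \in t by rewrite -has_pred1 has_count c1.
case/splitPr: yt lt c1 => s1 [|z s2].
  by rewrite last_cat /= => e; rewrite e eqxx in ya.
move=> _ c1; exists s1, z, s2; split => //.
rewrite inE negb_or ya /=; apply/count_memPn.
by move: c1; rewrite !count_cat /= eqxx; lia.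
Qed.

(** The vertex z deleted together with y survives as the end of s1, so only y is lost. The walk
    becomes shorter by two and loses exactly one vertex, which preserves the inequality
    [size + 2 <= 2 * #|_|] that drives the inductions below. *)
Lemma card_leaf (a : V) s1 y z s2 (t : seq V) : last a s1 = z ->
  y \notin a :: s1 ++ z :: s2 -> y \notin t ->
  #|a :: (s1 ++ y :: z :: s2) ++ t| = #|a :: (s1 ++ s2) ++ t|.+1.
Proof.
move=> lz yn yt.
have -> : #|a :: (s1 ++ y :: z :: s2) ++ t| = #|[predU1 y & (a :: (s1 ++ s2) ++ t)]|.
  apply: eq_card => u; rewrite !inE !mem_cat !inE -lz.
  have : (u == last a s1) -> (u == a) || (u \in s1).
    by move=> /eqP ->; rewrite -in_cons mem_last.
  case: (u == last a s1) => [/(_ isT)|_]; by case: (u == y); case: (u == a);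
    case: (u \in s1); case: (u \in s2); case: (u \in t).
rewrite cardU1; suff -> : y \notin a :: (s1 ++ s2) ++ t by [].
move: yn; rewrite !inE !mem_cat inE !negb_or => /and4P[-> -> _ ->] /=.
by rewrite yt.
Qed.

Lemma card_leaf' (a : V) s1 y z s2 (t : seq V) : last a s1 = z ->
  y \notin a :: s1 ++ z :: s2 -> y \notin t ->
  #|a :: t ++ (s1 ++ y :: z :: s2)| = #|a :: t ++ (s1 ++ s2)|.+1.
Proof.
have catC u v : #|a :: u ++ v| = #|a :: v ++ u|.
  by apply: eq_card => w; rewrite !inE !mem_cat (orbC (w \in u)).
by move=> lz yn yt; rewrite catC (card_leaf lz yn yt) catC.
Qed.

Lemma path_leaf x s1 y s2 :
  path adj x (s1 ++ y :: last x s1 :: s2) -> path adj x (s1 ++ s2).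
Proof. by rewrite !cat_path /= => /and4P[-> _ _ ->]. Qed.

(** Two closed walks from a common root whose union has as many vertices as possible are
    uncorrelated. A vertex visited once in total lies on just one of the walks, and removing it
    changes both sides in the same way; the induction is on the total length. *)
Lemma mixed_moment_cat_closed a t1 t2 : path adj a t1 -> path adj a t2 ->
  last a t1 = a -> last a t2 = a ->
  (size (t1 ++ t2) + 2 <= 2 * #|a :: t1 ++ t2|)%N ->
  mixed_moment (word a t1 ++ word a t2) =
  mixed_moment (word a t1) * mixed_moment (word a t2).
Proof.
have [n] := ubnP (size (t1 ++ t2)); elim: n t1 t2 => // n IH t1 t2 szn p1 p2 l1 l2 sz.
have [tn|tn] := eqVneq (t1 ++ t2) [::].
  by case: t1 t2 tn {p1 p2 l1 l2 sz szn} => [|//] [|//] _; rewrite mixed_moment_nil mul1r.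
have at_ : a \in t1 ++ t2.
  case: t1 l1 tn {p1 sz szn} => [|x t1] /= l1 tn.
    by case: t2 l2 tn {p2} => //= x t2 <- _; rewrite mem_last.
  by rewrite -cat_cons mem_cat -[in X in X || _]l1 mem_last.
have [y ya cy] := exists_leaf at_ sz.
have yaux t : count_mem y t = 0%N -> y \notin a :: t.
  by move=> c0; rewrite inE negb_or ya; apply/count_memPn.
have c12 : (count_mem y t1 = 1 /\ count_mem y t2 = 0)%N \/
           (count_mem y t1 = 0 /\ count_mem y t2 = 1)%N.
  move: cy; rewrite count_cat; lia.
have lst s1 z s2 : last a (s1 ++ y :: z :: s2) = a -> z = last a s1 ->
    last a (s1 ++ s2) = a.
  by rewrite !last_cat /= => + <-.
case: c12 => -[c1 c2].
- have [s1 [z [s2 [e yn]]]] := split_leaf l1 ya c1; subst t1.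
  have yn2 := yaux _ c2.
  rewrite mixed_moment_leaf //.
  have := mixed_moment_leaf p1 (isT : path adj a [::]) yn _.
  rewrite /= !cats0 inE => -> //.
  have [zl|] := eqVneq; last by rewrite !mul0r.
  rewrite !mul1r; subst z; apply: IH => //.
  + by move: szn; rewrite !size_cat /=; lia.
  + exact: path_leaf p1.
  + exact: lst l1 erefl.
  + move: sz; rewrite card_leaf //; first by rewrite !size_cat /=; lia.
    by move: yn2; rewrite inE negb_or => /andP[].
- have [s1 [z [s2 [e yn]]]] := split_leaf l2 ya c2; subst t2.
  have yn1 := yaux _ c1.
  rewrite (@mixed_moment_perm _ (word a (s1 ++ y :: z :: s2) ++ word a t1));
    last by rewrite perm_catC.
  rewrite mixed_moment_leaf //.
  have := mixed_moment_leaf p2 (isT : path adj a [::]) yn _.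
  rewrite /= !cats0 inE => -> //.
  have [zl|] := eqVneq; last by rewrite !mul0r mulr0.
  rewrite !mul1r; subst z.
  rewrite (@mixed_moment_perm _ (word a t1 ++ word a (s1 ++ s2)));
    last by rewrite perm_catC.
  apply: IH => //.
  + by move: szn; rewrite !size_cat /=; lia.
  + exact: path_leaf p2.
  + exact: lst l2 erefl.
  + move: sz; rewrite card_leaf' //; first by rewrite !size_cat /=; lia.
    by move: yn1; rewrite inE negb_or => /andP[].
Qed.

(* Number of ways to read s as a walk in which every step either pushes a
   vertex on the stack of ancestors x :: st or pops back to its second entry,
   ending on a stack of height one. *)
Fixpoint stack_walks (x : V) (st s : seq V) : nat :=
  if s is y :: s' then
    if adj x y then
      (stack_walks y (x :: st) s' +
       if st is z :: st' then if z == y then stack_walks y st' s' else 0 else 0)%N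
    else 0%N
  else st == [::].

Lemma stack_walks_cons x st y s : stack_walks x st (y :: s) =
  if adj x y then
    (stack_walks y (x :: st) s +
     if st is z :: st' then if z == y then stack_walks y st' s else 0 else 0)%N
  else 0%N.
Proof. by []. Qed.

(** An ancestor leaves the stack only when the walk pops back to it, and the reading must end with
    no ancestor left. So an ancestor that never occurs in s blocks every reading. *)
Lemma stack_walks_buried y x st1 st2 s : y \notin s ->
  stack_walks x (st1 ++ y :: st2) s = 0%N.
Proof.
elim: s x st1 => [|u s IH] x st1 /=; first by case: st1.
rewrite inE negb_or => /andP[yu ys]; case: ifP => // _.
have := IH u (x :: st1) ys; rewrite cat_cons => ->.
case: st1 => [|w st1] /=; first by rewrite (negPf yu).
by case: ifP => // _; rewrite IH.
Qed.

(** This is the counterpart of [mixed_moment_leaf]. The step to the fresh vertex y can only be a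
    push, and since y does not occur again, the next step must pop it: a second push would bury
    y. *)
Lemma stack_walks_leaf x st s1 y z s2 : path adj x (s1 ++ y :: z :: s2) ->
  y \notin x :: st ++ s1 ++ z :: s2 ->
  stack_walks x st (s1 ++ y :: z :: s2) =
  ((z == last x s1) * stack_walks x st (s1 ++ s2))%N.
Proof.
elim: s1 x st => [|u s1 IH] x st.
  rewrite !cat0s /last => /and3P[xy yz' _]; rewrite stack_walks_cons xy.
  rewrite !inE mem_cat !inE !negb_or.
  move=> /and4P[yx yst yz ys2].
  have -> : (if st is z0 :: st' then
      if z0 == y then stack_walks y st' (z :: s2) else 0 else 0)%N = 0%N.
    case: st yst => // z0 st'; rewrite inE negb_or eq_sym => /andP[/negPf -> //].
  rewrite addn0 stack_walks_cons yz'.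
  have -> := @stack_walks_buried y z [::] (x :: st) s2 ys2.
  by rewrite add0n eq_sym; case: eqP => [->|_]; rewrite ?mul1n.
move=> /andP[xu p]; rewrite !cat_cons !stack_walks_cons xu => yn.
rewrite [last _ _]/=.
rewrite IH //; last first.
  by apply: contra yn; rewrite !inE !mem_cat !inE !mem_cat !inE;
     case: (y == u); case: (y == x); case: (y \in st); rewrite ?orbT.
rewrite mulnDr; congr addn; case: st yn => [|w st yn]; first by rewrite muln0.
case: eqP => [wu|]; last by rewrite muln0.
rewrite IH //.
by apply: contra yn; rewrite !inE !mem_cat !inE !mem_cat !inE;
   case: (y == u); case: (y == x); case: (y == w); case: (y \in st); rewrite ?orbT.
Qed.

(** Both sides obey the same recursion under removal of a leaf and equal 1 on the empty walk. *)
Lemma mixed_moment_tree x s : path adj x s -> last x s = x ->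
  (size s + 2 <= 2 * #|x :: s|)%N ->
  mixed_moment (word x s) = (stack_walks x [::] s)%:R.
Proof.
have [n] := ubnP (size s); elim: n s => // n IH s szn p l sz.
have [->|s0] := eqVneq s [::]; first by rewrite mixed_moment_nil.
have xs : x \in s by case: s l s0 {p sz szn} => //= u s <- _; rewrite mem_last.
have [y yx cy] := exists_leaf xs sz.
have [s1 [z [s2 [e yn]]]] := split_leaf l yx cy; subst s.
have := mixed_moment_leaf p (isT : path adj x [::]) yn _.
rewrite /= !cats0 inE => -> //.
rewrite stack_walks_leaf // natrM.
have [zl|] := eqVneq; last by rewrite !mul0r.
rewrite !mul1r; subst z; apply: IH.
- by move: szn; rewrite !size_cat /=; lia.
- exact: path_leaf p.
- by move: l; rewrite !last_cat.
- have := card_leaf erefl yn (isT : y \notin [::]); rewrite !cats0.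
  by move: sz => /[swap] ->; rewrite !size_cat /=; lia.
Qed.

Lemma stack_walks_path x st s : stack_walks x st s != 0%N -> path adj x s.
Proof.
elim: s x st => //= y s IH x st; case: ifP => // _ /=.
have [->|/IH //] := eqVneq (stack_walks y (x :: st) s) 0%N.
by case: st => [//|z st]; rewrite add0n; case: ifP => // _ /IH.
Qed.

Lemma stack_walks_last x st s : stack_walks x st s != 0%N -> last x s = last x st.
Proof.
elim: s x st => [|y s IH] x st /=; first by case: st.
case: ifP => // _.
have [->|/IH e _] := eqVneq (stack_walks y (x :: st) s) 0%N; last by rewrite e.
by case: st => [//|z st]; rewrite add0n; case: (z =P y) => // -> /IH.
Qed.

Lemma stack_walks_le x st s : (stack_walks x st s <= 2 ^ size s)%N.
Proof.
elim: s x st => [|y s IH] x st /=; first by case: (st == _).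
case: ifP => // _; rewrite expnS mul2n -addnn leq_add //.
by case: st => // z st; case: ifP.
Qed.

End Walks.
End MixedMoments.

Local Close Scope ring_scope.

(** * Raney numbers and walks in the staircase graph *)

Section Raney.
Variable r : nat.

(** The Raney number: the coefficient of z^q in B(z)^P, where B = 1 + z B^(r+1). The recursion is
    B^(P+1) = B^P + z B^(P+1+r). The inner fixpoint is needed because P grows when q decreases. *)
Fixpoint raney (q : nat) : nat -> nat :=
  if q is q'.+1 then
    fix raneyS (P : nat) :=
      if P is P'.+1 then (raneyS P' + raney q' (P + r))%N else 0
  else fun=> 1%N.

Lemma raney_recS q P : raney q.+1 P.+1 = (raney q.+1 P + raney q (P.+1 + r))%N.
Proof. by []. Qed.

(** The closed form P / ((r+1)q + P) * C((r+1)q + P, q), with the denominator cleared to stay within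
    [nat]. *)
Lemma raneyE q P : ((r.+1 * q + P) * raney q P = P * 'C(r.+1 * q + P, q))%N.
Proof.
elim: q P => [|q IHq] P; first by rewrite muln0 add0n bin0.
elim: P => [|P IHP]; first by rewrite muln0.
rewrite raney_recS; move: (raney q.+1 P) (raney q _) IHP (IHq (P.+1 + r)) => A B.
set M := (r.+1 * q.+1 + P)%N.
have -> : (r.+1 * q + (P.+1 + r) = M)%N by rewrite /M; lia.
have -> : (r.+1 * q.+1 + P.+1 = M.+1)%N by rewrite /M; lia.
move=> eA eB.
have M0 : (0 < M)%N by rewrite /M; lia.
have e1 := mul_bin_diag M.+1 q; have e2 := mul_bin_left M q.
have qM : (q <= M)%N by rewrite /M; lia.
apply/eqP; rewrite -(eqn_pmul2l M0) -(eqn_pmul2l (ltn0Sn q)); apply/eqP.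
move: ('C(M, q.+1)) ('C(M, q)) ('C(M.+1, q.+1)) eA eB e1 e2 => c1 c0 c2 eA eB e1 e2.
have -> : (q.+1 * (M * (M.+1 * (A + B))) =
   M.+1 * (q.+1 * (M * A)) + M.+1 * (q.+1 * (M * B)))%N by ring.
have -> : (q.+1 * (M * (P.+1 * c2)) = P.+1 * (M * (q.+1 * c2)))%N by ring.
rewrite eA eB -e1 /=.
have -> : (q.+1 * (P * c1) = P * (q.+1 * c1))%N by ring.
rewrite e2.
(* Writing M as q + d removes the truncated subtraction before the polynomial identity [e3]. *)
have [d Md] : exists d, M = (q + d)%N by exists (M - q)%N; lia.
have -> : (M - q = d)%N by lia.
have e3 : (P * d + (P.+1 + r) * q.+1 = P.+1 * M)%N.
  have := Md; rewrite /M; nia.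
have -> : (M.+1 * (P * (d * c0)) + M.+1 * (q.+1 * ((P.+1 + r) * c0)) =
   M.+1 * c0 * (P * d + (P.+1 + r) * q.+1))%N by ring.
by rewrite e3; ring.
Qed.

(** The second summand is a closed form for the missing terms of the sum, up to the factor k + 1.
    Allowing m < r makes the induction telescope; the term vanishes at m = r. *)
Lemma sum_raney_aux k m : (m <= r)%N ->
  (k.+1 * (\sum_(p < m) raney k p.+1) + (r - m) * 'C(r.+1 * k + m, k) =
   r * 'C(r.+1 * k, k))%N.
Proof.
elim: m => [|m IH] mr; first by rewrite big_ord0 muln0 add0n subn0 addn0.
rewrite -(IH (ltnW mr)) big_ord_recr /= mulnDr -addnA; congr addn.
have := raneyE k m.+1; move: (raney k m.+1) => A.
rewrite !addnS; set M := (r.+1 * k + m)%N.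
have e := mul_bin_down M.+1 k.
move: ('C(M, k)) ('C(M.+1, k)) e => c0 c1 e eA.
have [d rd] : exists d, r = (m + d.+1)%N by exists (r - m.+1)%N; lia.
have -> : (r - m.+1 = d)%N by lia.
have -> : (r - m = d.+1)%N by lia.
apply/eqP; rewrite -(eqn_pmul2l (ltn0Sn M)); apply/eqP.
have [f Mf] : exists f, M = (k + f)%N.
  by exists (r * k + m)%N; rewrite /M; lia.
have Sk : (M.+1 - k = f.+1)%N by lia.
rewrite Sk in e.
have -> : (M.+1 * (k.+1 * A + d * c1) = k.+1 * (M.+1 * A) + M.+1 * d * c1)%N by ring.
have -> : (M.+1 * (d.+1 * c0) = d.+1 * (M.+1 * c0))%N by ring.
rewrite eA e.
have e3 : (k.+1 * m.+1 + M.+1 * d = d.+1 * f.+1)%N.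
  have : f = (r * k + m)%N by move: Mf; rewrite /M; lia.
  move=> ->; rewrite /M rd; ring.
by transitivity ((k.+1 * m.+1 + M.+1 * d) * c1)%N; [ring | rewrite e3; ring].
Qed.

Lemma sum_raney k :
  (k.+1 * (\sum_(p < r) raney k p.+1) = r * 'C(r.+1 * k, k))%N.
Proof. by rewrite -(sum_raney_aux k (leqnn r)) subnn addn0. Qed.

End Raney.

Section TupleSums.
Variable V : finType.

Lemma big_tuple_cons (M : nmodType) m (f : seq V -> M) :
  (\sum_(s : m.+1.-tuple V) f s = \sum_y \sum_(s : m.-tuple V) f (y :: s))%R.
Proof.
rewrite pair_big /=.
rewrite (reindex (fun p : V * m.-tuple V => cons_tuple p.1 p.2)) /=.
  exact: eq_bigr.
exists (fun t : m.+1.-tuple V => (thead t, behead_tuple t)).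
  by move=> [y s] _; congr pair; apply: val_inj.
by move=> t _ /=; rewrite [RHS]tuple_eta; apply: val_inj.
Qed.

(** A tuple with at most d distinct values is determined by a list of d values and by the position
    of each coordinate in that list. The default [x0] pads a list of values that is too short. *)
Lemma card_tuples_le_range (x0 : V) m d :
  (#|[set s : m.-tuple V | #|(s : seq V)| <= d]| <= d ^ m * #|V| ^ d)%N.
Proof.
pose h (p : {ffun 'I_m -> 'I_d} * {ffun 'I_d -> V}) : m.-tuple V :=
  [tuple p.2 (p.1 i) | i < m].
have sub : [set s : m.-tuple V | #|(s : seq V)| <= d]%N \subset h @: [set: _].
  apply/fintype.subsetP => s; rewrite inE => sd; apply/imsetP.
  have lt i : (index (tnth s i) (undup s) < d)%N.
    apply: (leq_trans _ sd).
    have <- : size (undup s) = #|(s : seq V)|.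
      by rewrite -(card_uniqP (undup_uniq s)); apply: eq_card => u; rewrite mem_undup.
    by rewrite index_mem mem_undup mem_tnth.
  exists ([ffun i => Ordinal (lt i)], [ffun j : 'I_d => nth x0 (undup s) j]) => //.
  apply: eq_from_tnth => i; rewrite tnth_mktuple !ffunE /=.
  by rewrite nth_index // mem_undup mem_tnth.
apply: (leq_trans (subset_leq_card sub)); apply: (leq_trans (leq_imset_card _ _)).
by rewrite cardsT card_prod !card_ffun !card_ord.
Qed.
End TupleSums.

(** * The bipartite graph of the staircase shape and its tree walks *)

Section StairGraph.
Variables (r N : nat).
Let V := (bool * 'I_(r * N))%type.

(** Vertices are rows ([false]) and columns ([true]). With blocks numbered from 0, a row of block a
    meets a column of block b inside the shape iff a + b < r, a condition symmetric in rows and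
    columns. *)
Definition stair_adj (x y : V) : bool :=
  (x.1 != y.1) && (x.2 %/ N + y.2 %/ N < r)%N.

Definition stair_cell (x y : V) : 'I_(r * N) * 'I_(r * N) :=
  if x.1 then (y.2, x.2) else (x.2, y.2).

Definition stair_flag (x _ : V) : bool := x.1.

Lemma stair_adjC : symmetric stair_adj.
Proof. by move=> x y; rewrite /stair_adj eq_sym addnC. Qed.

Lemma stair_cellC x y : stair_adj x y -> stair_cell y x = stair_cell x y.
Proof. by case: x y => [[] i] [[] j]. Qed.

Lemma stair_flagC x y : stair_adj x y -> stair_flag y x = ~~ stair_flag x y.
Proof. by case: x y => [[] i] [[] j]. Qed.

Lemma stair_cell_inj x y x' y' : stair_adj x y -> stair_adj x' y' ->
  stair_cell x y = stair_cell x' y' -> (x = x' /\ y = y') \/ (x = y' /\ y = x').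
Proof.
by case: x y x' y' => [[] i] [[] j] [[] i'] [[] j'] //= _ _ [-> ->]; auto.
Qed.

(** The degree of x in units of N: a vertex of block a has neighbours in the first r - a blocks of
    the other side. *)
Definition stair_weight (x : V) : nat := (r - x.2 %/ N)%N.

Lemma sum_blocks (f : nat -> nat) :
  (\sum_(i < r * N) f (i %/ N) = N * \sum_(j < r) f j)%N.
Proof.
have [->|N0] := posnP N; first by rewrite mul0n muln0 big_ord0.
rewrite -(big_mkord xpredT (fun i => f (i %/ N))%N).
elim: r => [|n IH]; first by rewrite mul0n big_geq // big_ord0 muln0.
rewrite mulSnr (big_cat_nat (leq0n _) (leq_addr _ _)) /= IH big_ord_recr /= mulnDr.
congr addn; rewrite -{1}[(n * N)%N]add0n big_addn addKn.
rewrite (eq_big_nat _ _ (F2 := fun=> f n)) ?sum_nat_const_nat ?subn0 // => i /andP[_ iN].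
by rewrite addnC divnMDl // divn_small // addn0.
Qed.

Lemma sum_stair_adj (x : V) (f : nat -> nat) :
  (\sum_(y | stair_adj x y) f (y.2 %/ N) = N * \sum_(j < stair_weight x) f j)%N.
Proof.
transitivity (\sum_(i < r * N | (x.2 %/ N + i %/ N < r)%N) f (i %/ N))%N.
  rewrite (reindex_onto (fun i : 'I_(r * N) => (~~ x.1, i)) snd) /=; last first.
    by move=> [b i] /andP[/= + _]; case: (x.1) b => [] [].
  by apply: eq_bigl => i; rewrite /stair_adj /= eqxx andbT; case: x.1.
rewrite big_mkcond /=.
rewrite (sum_blocks (fun j => if (x.2 %/ N + j < r)%N then f j else 0)%N).
congr muln; rewrite -big_mkcond /= (big_ord_widen_cond r xpredT f); last exact: leq_subr.
by apply: eq_bigl => j; rewrite /stair_weight; lia.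
Qed.

Let walks := stack_walks stair_adj.

(** The Raney parameter is the total weight of the stack. A pop removes the weight p of the top x. A
    push to one of the N vertices of block j, for j < p, adds the weight r - j and uses up one unit
    of q. Summing over j unrolls the Raney recursion p times. With m = [size st + q.*2] there are
    exactly q pushes; fewer than [size st] steps cannot empty the stack. *)
Lemma sum_stack_walks m x st : path stair_adj x st ->
  ((m < size st)%N -> (\sum_(s : m.-tuple V) walks x st s = 0)%N) /\
  forall q, m = (size st + q.*2)%N ->
    (\sum_(s : m.-tuple V) walks x st s =
     N ^ q * raney r q (\sum_(v <- x :: st) stair_weight v))%N.
Proof.
elim: m x st => [|m IH] x st pst.
  have -> : (\sum_(s : 0.-tuple V) walks x st s = (st == [::]))%N.
    by rewrite (big_pred1 [tuple]) // => t; rewrite (tuple0 t); apply/esym/eqP.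
  case: st pst => [|z st] pst //=; split=> // -[|q] //.
have rec : (\sum_(s : m.+1.-tuple V) walks x st s =
    \sum_(y | stair_adj x y) \sum_(s : m.-tuple V) walks y (x :: st) s +
    if st is z :: st' then \sum_(s : m.-tuple V) walks z st' s else 0)%N.
  transitivity (\sum_y \sum_(s : m.-tuple V) walks x st (y :: s))%N.
    exact: (big_tuple_cons (M := nat) m (walks x st)).
  rewrite [X in (X + _)%N]big_mkcond /=.
  case: st pst => [|z st] pst.
    rewrite addn0; apply: eq_bigr => y _; rewrite /walks.
    under eq_bigr do rewrite addn0.
    by case: ifP => // _; rewrite big1.
  have -> : (\sum_(s : m.-tuple V) walks z st s = \sum_y
      if z == y then \sum_(s : m.-tuple V) walks y st s else 0)%N.
    by rewrite -big_mkcond (big_pred1 z) // => y; rewrite eq_sym.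
  rewrite -big_split /=; apply: eq_bigr => y _; rewrite /walks.
  case: ifP => xy; last first.
    rewrite big1 // add0n; case: eqP => // zy; subst z.
    by move: pst; rewrite /= xy.
  by rewrite big_split /=; congr addn; case: ifP => // _; rewrite big1.
split.
  move=> lt; rewrite rec big1 ?add0n; last first.
    move=> y xy; apply: (IH y (x :: st) _).1; first by rewrite /= stair_adjC xy.
    by rewrite /=; lia.
  case: st lt pst {rec} => // z st /= lt /andP[_ pst].
  by apply: (IH z st pst).1.
move=> q eq_m; rewrite rec.
have pop : (if st is z :: st' then \sum_(s : m.-tuple V) walks z st' s else 0)%N =
   (if st is z :: st' then N ^ q * raney r q (\sum_(v <- st) stair_weight v) else 0)%N.
  case: st eq_m pst {rec} => // z st /= eq_m /andP[_ pst].
  by apply: (IH z st pst).2; lia.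
rewrite pop; case: q eq_m {pop} => [|q] eq_m.
  rewrite big1 ?add0n; first by case: st eq_m {pst rec} => //=; lia.
  move=> y xy; apply: (IH y (x :: st) _).1; first by rewrite /= stair_adjC xy.
  by rewrite /=; lia.
have push y : stair_adj x y -> (\sum_(s : m.-tuple V) walks y (x :: st) s =
   N ^ q * raney r q (\sum_(v <- x :: st) stair_weight v + (r - y.2 %/ N)))%N.
  move=> xy; rewrite [RHS]/= addnC.
  have := (IH y (x :: st) _).2 q _; rewrite big_cons; apply.
    by rewrite /= stair_adjC xy.
  by rewrite /=; lia.
rewrite (eq_bigr _ push).
rewrite (sum_stair_adj x (fun j => N ^ q * raney r q (\sum_(v <- x :: st) stair_weight v + (r - j))))%N.
rewrite -big_distrr /= mulnA -expnS.
have -> : (if st is z :: st' then N ^ q.+1 * raney r q.+1 (\sum_(v <- st) stair_weight v) else 0)%N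
   = (N ^ q.+1 * raney r q.+1 (\sum_(v <- st) stair_weight v))%N.
  by case: st {pst rec eq_m push} => //; rewrite big_nil muln0.
rewrite -mulnDr; congr muln; rewrite big_cons.
move: (\sum_(v <- st) _)%N => Q.
have : (stair_weight x <= r)%N by rewrite leq_subr.
move: (stair_weight x) => p pr.
rewrite [in RHS]addnC; transitivity (\sum_(j < p) raney r q (Q + j.+1 + r) + raney r q.+1 Q)%N.
  congr addn; rewrite (reindex_inj rev_ord_inj) /=; apply: eq_bigr => j _.
  by congr (raney r q); have := ltn_ord j; lia.
elim: p {pr} => [|p IHp]; first by rewrite big_ord0 add0n addn0.
by rewrite big_ord_recr /= addnAC IHp !addnS.
Qed.

End StairGraph.

Local Open Scope ring_scope.

Lemma big_tuple_cat (V : finType) (M : nmodType) m1 m2 (f : seq V -> M) :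
  \sum_(t : (m1 + m2).-tuple V) f t =
  \sum_(s : m1.-tuple V) \sum_(s' : m2.-tuple V) f (s ++ s').
Proof.
elim: m1 f => [|m1 IH] f.
  rewrite [RHS](big_pred1 [tuple]) => [|t]; last by rewrite (tuple0 t); apply/esym/eqP.
  by [].
rewrite (big_tuple_cons (m1 + m2) f).
rewrite (big_tuple_cons m1 (fun s => \sum_(s' : m2.-tuple V) f (s ++ s'))).
by apply: eq_bigr => y _; rewrite (IH (fun s => f (y :: s))).
Qed.

Lemma card_set_sum (T : finType) (P : pred T) :
  #|[set s | P s]| = (\sum_s (P s : nat))%N.
Proof.
by rewrite -sum1_card big_mkcond; apply: eq_bigr => s _; rewrite inE; case: (P s).
Qed.

(** * Traces for finitely valued entries *)

Section FiniteModel.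
Variables (C : numClosedFieldType) (U : finType) (p val : U -> C) (K : C).
Hypotheses (p_ge0 : forall u, 0 <= p u) (p_sum1 : \sum_u p u = 1)
  (val_mean : \sum_u p u * val u = 0)
  (val_var : \sum_u p u * (val u * (val u)^*) = 1)
  (K_ge1 : 1 <= K) (val_le : forall u, `|val u| <= K).

Definition letter_moment (a b : nat) : C :=
  \sum_u p u * (val u ^+ a * (val u)^* ^+ b).

Lemma letter_moment00 : letter_moment 0 0 = 1.
Proof. by rewrite -p_sum1; apply: eq_bigr => u _; rewrite !expr0 !mulr1. Qed.

Lemma letter_moment10 : letter_moment 1 0 = 0.
Proof. by rewrite -val_mean; apply: eq_bigr => u _; rewrite expr0 expr1 mulr1. Qed.

Lemma letter_moment01 : letter_moment 0 1 = 0.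
Proof.
rewrite -(rmorph0 Num.conj) -val_mean rmorph_sum; apply: eq_bigr => u _ /=.
by rewrite expr0 expr1 mul1r rmorphM /= (CrealP (ger0_real (p_ge0 u))).
Qed.

Lemma letter_moment11 : letter_moment 1 1 = 1.
Proof. by rewrite -val_var; apply: eq_bigr => u _; rewrite !expr1. Qed.

Lemma norm_letter_moment a b : `|letter_moment a b| <= K ^+ (a + b).
Proof.
apply: (le_trans (ler_norm_sum _ _ _)).
rewrite -[leRHS]mul1r -p_sum1 mulr_suml; apply: ler_sum => u _.
rewrite normrM (ger0_norm (p_ge0 u)) ler_wpM2l //.
rewrite normrM !normrX norm_conjC -exprD lerXn2r ?nnegrE //.
exact: le_trans ler01 K_ge1.
Qed.

Section Cells.
Variable I : finType.
Implicit Type l : {ffun I -> U}.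

Definition expect (Phi : {ffun I -> U} -> C) : C :=
  \sum_(l : {ffun I -> U}) (\prod_(c : I) p (l c)) * Phi l.

Lemma expect_sum (J : finType) (Q : pred J) (Phi : J -> {ffun I -> U} -> C) :
  expect (fun l => \sum_(j | Q j) Phi j l) = \sum_(j | Q j) expect (Phi j).
Proof.
by rewrite exchange_big /=; apply: eq_bigr => l _; rewrite mulr_sumr.
Qed.

Lemma expectZ a (Phi : {ffun I -> U} -> C) :
  expect (fun l => a * Phi l) = a * expect Phi.
Proof. by rewrite mulr_sumr; apply: eq_bigr => l _; rewrite mulrCA. Qed.

Lemma eq_expect (f g : {ffun I -> U} -> C) : f =1 g -> expect f = expect g.
Proof. by move=> fg; apply: eq_bigr => l _; rewrite fg. Qed.

Lemma expectD (f g : {ffun I -> U} -> C) :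
  expect (fun l => f l + g l) = expect f + expect g.
Proof. by rewrite -big_split; apply: eq_bigr => l _; rewrite mulrDr. Qed.

Lemma expect_prod (f : I -> U -> C) :
  expect (fun l => \prod_c f c (l c)) = \prod_c \sum_u p u * f c u.
Proof.
by rewrite bigA_distr_bigA; apply: eq_bigr => l _; rewrite -big_split.
Qed.

Lemma expect1 : expect (fun=> 1) = 1.
Proof.
transitivity (\prod_(c : I) \sum_u p u * 1).
  by rewrite -expect_prod; apply: eq_expect => l; rewrite big1.
by rewrite big1 // => c _; rewrite -mulr_suml p_sum1 mulr1.
Qed.

Definition letter l (e : I * bool) : C :=
  if e.2 then (val (l e.1))^* else val (l e.1).

Lemma expect_letters (w : seq (I * bool)) :
  expect (fun l => \prod_(e <- w) letter l e) = mixed_moment letter_moment w.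
Proof.
rewrite -[RHS](expect_prod (fun c u => val u ^+ count_mem (c, false) w *
   (val u)^* ^+ count_mem (c, true) w)); apply: eq_expect => l.
elim: w => [|[c b] w IH].
  by rewrite big_nil big1 // => c _; rewrite !expr0 mulr1.
rewrite big_cons IH (bigD1 c) //= [RHS](bigD1 c) //= !xpair_eqE eqxx /= mulrA.
congr (_ * _).
  case: b; rewrite /letter /=; rewrite ?add1n ?add0n exprS; ring.
apply: eq_bigr => d dc; rewrite !xpair_eqE.
by rewrite [c == d]eq_sym (negPf dc).
Qed.
End Cells.

Section Stair.
Variables (r N : nat).
Let V := (bool * 'I_(r * N))%type.
Let Cell := ('I_(r * N) * 'I_(r * N))%type.
Let adj := @stair_adj r N.
Let stair_word := word (@stair_cell r N) (@stair_flag r N).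
Let mm := mixed_moment (I := Cell) letter_moment.

Definition stair_mx (l : {ffun Cell -> U}) : 'M[C]_(r * N) :=
  \matrix_(i, j) (if (i %/ N + j %/ N < r)%N then val (l (i, j)) else 0).

Definition stair_entry (l : {ffun Cell -> U}) (x y : V) : C :=
  if adj x y then letter l (stair_cell x y, stair_flag x y) else 0.

Fixpoint walk_prod (l : {ffun Cell -> U}) (x : V) (s : seq V) : C :=
  if s is y :: s' then stair_entry l x y * walk_prod l y s' else 1.

Lemma walk_prodE l x s : walk_prod l x s =
  if path adj x s then \prod_(e <- stair_word x s) letter l e else 0.
Proof.
elim: s x => [|y s IH] x /=; first by rewrite big_nil.
rewrite /stair_entry; case: ifP => [_|]; last by rewrite mul0r.
by rewrite IH big_cons; case: ifP; rewrite ?mulr0.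
Qed.

Definition walk_sum l m (x z : V) : C :=
  \sum_(s : m.-tuple V | last x s == z) walk_prod l x s.

Lemma walk_sumS l m x z :
  walk_sum l m.+1 x z = \sum_y stair_entry l x y * walk_sum l m y z.
Proof.
rewrite /walk_sum big_mkcond; transitivity (\sum_y \sum_(s : m.-tuple V)
   if last x (y :: s) == z then walk_prod l x (y :: s) else 0).
  exact: (big_tuple_cons m (fun s => if last x s == z then walk_prod l x s else 0)).
apply: eq_bigr => y _; rewrite mulr_sumr [RHS]big_mkcond.
by apply: eq_bigr => s _.
Qed.

Local Open Scope sesquilinear_scope.

(** Each factor X X^* is two steps, from a row to a column and back with the conjugate entry, whence
    the length [k.*2]. Steps that stay on one side of the graph have entry 0. *)
Lemma trace_stair l k : \tr ((stair_mx l *m (stair_mx l)^t*) ^+ k) =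
  \sum_(i < r * N) \sum_(s : (k.*2).-tuple V | last (false, i) s == (false, i))
    walk_prod l (false, i) s.
Proof.
suff H i z : ((stair_mx l *m (stair_mx l)^t*) ^+ k) i z =
  walk_sum l k.*2 (false, i) (false, z).
  by apply: eq_bigr => i _; rewrite H.
elim: k i => [|k IH] i.
  rewrite /walk_sum big_mkcond (big_pred1 [tuple]) /=; last first.
    by move=> t; rewrite (tuple0 t); apply/esym/eqP.
  by rewrite expr0 mxE xpair_eqE /=; case: eqP.
rewrite exprS -[GRing.mul]/(mulmx) mxE.
under eq_bigr do rewrite IH.
rewrite doubleS walk_sumS; under [RHS]eq_bigr do rewrite walk_sumS.
have pairb (f : V -> C) : \sum_y f y = \sum_j f (false, j) + \sum_j f (true, j).
  transitivity (\sum_b \sum_j f (b, j)).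
    by rewrite pair_bigA; apply: eq_bigr => -[].
  rewrite (bigD1 false) //=; congr (_ + _).
  by rewrite (big_pred1 true) // => -[].
rewrite pairb [X in _ = X + _]big1 ?add0r; last first.
  by move=> j _; rewrite /stair_entry /adj /stair_adj /= !mul0r.
under [RHS]eq_bigr do rewrite pairb mulrDr.
rewrite big_split /= [X in _ = _ + X]big1 ?addr0; last first.
  move=> j _; rewrite big1 ?mulr0 // => j' _.
  by rewrite /stair_entry /adj /stair_adj /= mul0r.
under [RHS]eq_bigr do rewrite mulr_sumr.
rewrite exchange_big /=; apply: eq_bigr => j' _; rewrite mxE mulr_suml.
apply: eq_bigr => j _; rewrite mulrA; congr (_ * _).
rewrite /stair_entry /adj /stair_adj /= !mxE.
rewrite /letter /stair_cell /stair_flag /= (addnC (j %/ N)%N); congr (_ * _).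
by case: ifP; rewrite ?rmorph0.
Qed.

Let closed_word (x : V) (s : seq V) : bool := (last x s == x) && path adj x s.

Lemma expect_trace k :
  expect (fun l => \tr ((stair_mx l *m (stair_mx l)^t*) ^+ k)) =
  \sum_(i < r * N) \sum_(s : (k.*2).-tuple V | closed_word (false, i) s)
    mm (stair_word (false, i) s).
Proof.
under eq_expect do rewrite trace_stair.
rewrite expect_sum; apply: eq_bigr => i _; rewrite expect_sum /closed_word [RHS]big_mkcondr /=.
apply: eq_bigr => s _.
under eq_expect do rewrite walk_prodE.
case: ifP => _; first by rewrite expect_letters.
by rewrite /expect big1 // => l _; rewrite mulr0.
Qed.

Lemma expect_trace2 k :
  expect (fun l => \tr ((stair_mx l *m (stair_mx l)^t*) ^+ k) ^+ 2) =
  \sum_(i < r * N) \sum_(s : (k.*2).-tuple V | closed_word (false, i) s)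
  \sum_(j < r * N) \sum_(s' : (k.*2).-tuple V | closed_word (false, j) s')
    mm (stair_word (false, i) s ++ stair_word (false, j) s').
Proof.
have e l : \tr ((stair_mx l *m (stair_mx l)^t*) ^+ k) ^+ 2 =
  \sum_(i < r * N) \sum_(s : (k.*2).-tuple V | last (false, i) s == (false, i))
  \sum_(j < r * N) \sum_(s' : (k.*2).-tuple V | last (false, j) s' == (false, j))
    walk_prod l (false, i) s * walk_prod l (false, j) s'.
  rewrite trace_stair expr2 mulr_suml; apply: eq_bigr => i _.
  rewrite mulr_suml; apply: eq_bigr => s _.
  rewrite mulr_sumr; apply: eq_bigr => j _.
  by rewrite mulr_sumr.
under eq_expect do rewrite e.
rewrite expect_sum; apply: eq_bigr => i _; rewrite expect_sum /closed_word [RHS]big_mkcondr /=.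
apply: eq_bigr => s _.
rewrite expect_sum; case: ifP => ps; last first.
  rewrite big1 // => j _; rewrite /expect big1 // => l _.
  by rewrite [X in _ * X]big1 ?mulr0 // => s' _; rewrite walk_prodE ps mul0r.
apply: eq_bigr => j _; rewrite expect_sum [RHS]big_mkcondr /=; apply: eq_bigr => s' _.
under eq_expect do rewrite !walk_prodE ps.
case: ifP => ps'; last by rewrite /expect big1 // => l _; rewrite !mulr0.
by under eq_expect do rewrite -big_cat; rewrite expect_letters.
Qed.

(** Mixed moments depend on the word only up to permutation, so a closed walk may be restarted at
    any of its vertices. This gives two intersecting walks a common root. *)
Lemma closed_word_rotate a x (s : seq V) : closed_word x s -> a \in x :: s ->
  exists t, [/\ closed_word a t, perm_eq (stair_word a t) (stair_word x s),
    size t = size s & a :: t =i x :: s].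
Proof.
move=> cs; case/andP: (cs) => /eqP ls ps; rewrite inE => /predU1P[->|as_].
  by exists s; split.
case/splitPr: as_ ls ps cs => u v ls ps _.
exists (v ++ rcons u a); split.
- move: ls ps; rewrite last_cat /= /closed_word last_cat last_rcons eqxx /= => lv.
  rewrite !cat_path rcons_path /= => /and3P[pu ua pv].
  by rewrite pv lv pu.
- move: ls; rewrite last_cat /= => lv.
  rewrite /stair_word -cats1 !word_cat /= -/(word _ _ _ _) lv.
  by rewrite perm_catC -catA.
- by rewrite !size_cat size_rcons /=; lia.
- move: ls; rewrite last_cat /= => lv w.
  have : (w == x) -> (w == a) || (w \in v).
    by move=> /eqP ->; rewrite -in_cons -{1}lv mem_last.
  rewrite !inE !mem_cat mem_rcons !inE.
  case: (w == x) => [/(_ isT)/orP[->|->]|_]; rewrite ?orbT //.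
  by case: (w == a); case: (w \in u); case: (w \in v).
Qed.

Let mm10 := letter_moment10.
Let mm_perm := @mixed_moment_perm C Cell letter_moment.

(** Walks without a common vertex share no cell, and the moment factorises at once. Otherwise both
    are rotated to a common vertex and leaf removal applies to their union. *)
Lemma mixed_moment_closed_pair x x' (s s' : seq V) :
  closed_word x s -> closed_word x' s' ->
  (size s + size s' + 2 <= 2 * #|(x :: s) ++ (x' :: s')|)%N ->
  mm (stair_word x s ++ stair_word x' s') =
  mm (stair_word x s) * mm (stair_word x' s').
Proof.
move=> cs cs' sz.
have [/hasP[a as_ as']|/hasPn dis] := boolP (has (mem (x' :: s')) (x :: s)); last first.
  apply: mixed_moment_cat; first exact: letter_moment00.
  move=> e1 e2; case/andP: cs => _ p1; case/andP: cs' => _ p2.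
  move=> /(mem_word p1)[u [v [uv -> us vs]]] /(mem_word p2)[u' [v' [uv' -> us' vs']]].
  apply/eqP => /(stair_cell_inj uv uv') [[e _]|[e _]].
    by have := dis u us; rewrite e /= us'.
  by have := dis u us; rewrite e /= vs'.
have [t [ct pt zt mt]] := closed_word_rotate cs as_.
have [t' [ct' pt' zt' mt']] := closed_word_rotate cs' as'.
have pp : perm_eq (stair_word x s ++ stair_word x' s') (stair_word a t ++ stair_word a t').
  by rewrite perm_sym; apply: perm_cat.
rewrite /mm (mm_perm pp) -(mm_perm pt) -(mm_perm pt').
case/andP: ct => /eqP lt p1; case/andP: ct' => /eqP lt' p2.
apply: (mixed_moment_cat_closed letter_moment00 letter_moment10
   letter_moment01 letter_moment11 (@stair_cellC r N) (@stair_flagC r N)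
   (@stair_cell_inj r N)) => //.
rewrite size_cat zt zt'; apply: (leq_trans sz); rewrite leq_mul2l /=.
apply: subset_leq_card; apply/fintype.subsetP => w.
suff : w \in (x :: s) ++ (x' :: s') -> w \in a :: t ++ t' by [].
rewrite mem_cat -mt -mt' !inE mem_cat.
by case: (w == a); case: (w \in t).
Qed.

Lemma mixed_moment_closed x (s : seq V) : closed_word x s ->
  (size s + 2 <= 2 * #|x :: s|)%N ->
  mm (stair_word x s) = (stack_walks adj x [::] s)%:R.
Proof.
move=> /andP[/eqP ls ps] sz.
exact: (mixed_moment_tree letter_moment00 letter_moment10
   letter_moment01 letter_moment11 (@stair_cellC r N) (@stair_flagC r N)
   (@stair_cell_inj r N)).
Qed.

Hypothesis rN_gt0 : (0 < r * N)%N.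

Lemma count_few_vertices m d :
  (\sum_(x : V) \sum_(s : m.-tuple V) (#|x :: s| <= d) <=
   d ^ m.+1 * #|{: V}| ^ d)%N.
Proof.
have x0 : V := (false, Ordinal rN_gt0).
apply: leq_trans (card_tuples_le_range x0 m.+1 d).
rewrite card_set_sum leq_eqVlt; apply/orP; left; apply/eqP/esym.
exact: (big_tuple_cons (M := nat) m (fun s : seq V => (#|s| <= d)%N : nat)).
Qed.

Lemma count_few_vertices2 m d :
  (\sum_(x : V) \sum_(s : m.-tuple V) \sum_(x' : V) \sum_(s' : m.-tuple V)
     (#|(x :: s) ++ (x' :: s')| <= d) <=
   d ^ (m.+1 + m.+1) * #|{: V}| ^ d)%N.
Proof.
have x0 : V := (false, Ordinal rN_gt0).
apply: leq_trans (card_tuples_le_range x0 (m.+1 + m.+1) d).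
rewrite card_set_sum leq_eqVlt; apply/orP; left; apply/eqP/esym.
etransitivity; first exact: (big_tuple_cat (M := nat) m.+1 m.+1
  (fun s : seq V => (#|s| <= d)%N : nat)).
etransitivity; first exact: (big_tuple_cons (M := nat) m
  (fun s : seq V => \sum_(s' : m.+1.-tuple V) ((#|s ++ s'| <= d)%N : nat))).
apply: eq_bigr => x _; apply: eq_bigr => s _.
exact: (big_tuple_cons (M := nat) m
  (fun s' : seq V => ((#|(x :: s) ++ s'| <= d)%N : nat))).
Qed.

Let sumL (f : V -> C) : (forall x, 0 <= f x) ->
  \sum_(i < r * N) f (false, i) <= \sum_x f x.
Proof.
move=> f0; rewrite (bigID (fun x : V => ~~ x.1)) /= -[leLHS]addr0 lerD ?sumr_ge0 //.
rewrite le_eqVlt; apply/orP; left; apply/eqP/esym.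
rewrite (reindex_onto (fun i : 'I_(r * N) => (false, i)) snd) /=; last first.
  by move=> [[] i].
by apply: eq_bigl => i; rewrite eqxx.
Qed.

Let K_ge0 : 0 <= K. Proof. exact: le_trans ler01 K_ge1. Qed.

Lemma norm_mm w : `|mm w| <= K ^+ size w.
Proof. exact: norm_mixed_moment K_ge1 norm_letter_moment. Qed.

Lemma sum_stack_walks_rows k :
  (\sum_(i < r * N) \sum_(s : (k.*2).-tuple V) stack_walks adj (false, i) [::] s =
   N ^ k.+1 * \sum_(p < r) raney r k p.+1)%N.
Proof.
have e (i : 'I_(r * N)) : (\sum_(s : (k.*2).-tuple V) stack_walks adj (false, i) [::] s =
    N ^ k * raney r k (r - i %/ N))%N.
  have [_ /(_ k erefl)] := @sum_stack_walks r N k.*2 (false, i) [::] isT.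
  by rewrite big_seq1.
under eq_bigr do rewrite e.
rewrite -big_distrr /= (sum_blocks r N (fun j => raney r k (r - j))) mulnA -expnSr.
congr muln; rewrite (reindex_inj rev_ord_inj) /=; apply: eq_bigr => j _.
by congr raney; have := ltn_ord j; lia.
Qed.

(** A closed walk of length 2k with more than k vertices contributes exactly its number of stack
    readings. The bias therefore comes from walks with at most k vertices; there are O(N^k) of them,
    one factor N below the main term. *)
Lemma expect_trace_bias k :
  `|expect (fun l => \tr ((stair_mx l *m (stair_mx l)^t*) ^+ k)) -
    (N ^ k.+1 * \sum_(p < r) raney r k p.+1)%:R| <=
  (K ^+ k.*2 + 2 ^+ k.*2) * (k ^ (k.*2).+1 * #|{: V}| ^ k)%:R.
Proof.
rewrite expect_trace -sum_stack_walks_rows natr_sum -sumrB.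
apply: (@le_trans _ _ (\sum_(i < r * N) \sum_(s : (k.*2).-tuple V)
   (K ^+ k.*2 + 2 ^+ k.*2) * (#|(false, i) :: s| <= k)%:R)).
  apply: (le_trans (ler_norm_sum _ _ _)); apply: ler_sum => i _.
  rewrite natr_sum big_mkcond -sumrB.
  apply: (le_trans (ler_norm_sum _ _ _)); apply: ler_sum => s _.
  set x := (false, i); have [cs|ncs] := boolP (closed_word x s); last first.
    suff -> : stack_walks adj x [::] s = 0%N.
      by rewrite subrr normr0 mulr_ge0 // addr_ge0 // exprn_ge0.
    apply/eqP/negPn/negP => h; case/negP: ncs.
    by rewrite /closed_word (stack_walks_last h) /= eqxx (stack_walks_path h).
  have [small|big] := leqP #|x :: s| k; last first.
    rewrite mixed_moment_closed ?subrr ?normr0 ?mulr0 //.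
    rewrite size_tuple; apply: (@leq_trans (2 * k.+1)); first by lia.
    by rewrite leq_mul2l.
  rewrite mulr1; apply: (le_trans (ler_normB _ _)); apply: lerD.
    by apply: (le_trans (norm_mm _)); rewrite size_word size_tuple.
  rewrite normr_nat -natrX ler_nat; apply: leq_trans (stack_walks_le _ _ _ _) _.
  by rewrite size_tuple.
have := sumL (f := fun x => \sum_(s : (k.*2).-tuple V)
   (K ^+ k.*2 + 2 ^+ k.*2) * (#|x :: s| <= k)%:R).
move=> /(_ _)/le_trans; apply.
  by move=> x; apply: sumr_ge0 => s _; rewrite mulr_ge0 // addr_ge0 // exprn_ge0.
under eq_bigr do rewrite -mulr_sumr -natr_sum.
rewrite -mulr_sumr -natr_sum ler_wpM2l ?ler_nat ?count_few_vertices //.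
by rewrite addr_ge0 // exprn_ge0.
Qed.

(** A pair of closed walks of total length 4k with more than 2k vertices has covariance zero. The
    O(N^(2k)) remaining pairs are a factor N^2 below the square of the mean trace. *)
Lemma expect_trace_variance k :
  `|expect (fun l => \tr ((stair_mx l *m (stair_mx l)^t*) ^+ k) ^+ 2) -
    expect (fun l => \tr ((stair_mx l *m (stair_mx l)^t*) ^+ k)) ^+ 2| <=
  2 * K ^+ (k.*2 + k.*2) *
    (k.*2 ^ ((k.*2).+1 + (k.*2).+1) * #|{: V}| ^ k.*2)%:R.
Proof.
rewrite expect_trace expect_trace2; set S := \sum_(i < _) _; set B := 2 * _.
have B0 : 0 <= B by rewrite mulr_ge0 // exprn_ge0.
have -> : (\sum_(i < r * N) \sum_(s : (k.*2).-tuple V | closed_word (false, i) s)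
    mm (stair_word (false, i) s)) ^+ 2 =
  \sum_(i < r * N) \sum_(s : (k.*2).-tuple V | closed_word (false, i) s)
  \sum_(j < r * N) \sum_(s' : (k.*2).-tuple V | closed_word (false, j) s')
    mm (stair_word (false, i) s) * mm (stair_word (false, j) s').
  rewrite expr2 mulr_suml; apply: eq_bigr => i _.
  rewrite mulr_suml; apply: eq_bigr => s _.
  by rewrite mulr_sumr; apply: eq_bigr => j _; rewrite mulr_sumr.
apply: (@le_trans _ _ (\sum_(i < r * N) \sum_(s : (k.*2).-tuple V)
  \sum_(j < r * N) \sum_(s' : (k.*2).-tuple V)
   B * (#|((false, i) :: s) ++ ((false, j) :: s')| <= k.*2)%:R)).
  rewrite /S -sumrB; apply: (le_trans (ler_norm_sum _ _ _)); apply: ler_sum => i _.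
  rewrite -sumrB big_mkcond; apply: (le_trans (ler_norm_sum _ _ _)); apply: ler_sum => s _.
  case: ifP => cs; last first.
    by rewrite normr0; do 2!apply: sumr_ge0 => ? _; rewrite mulr_ge0.
  rewrite -sumrB; apply: (le_trans (ler_norm_sum _ _ _)); apply: ler_sum => j _.
  rewrite -sumrB big_mkcond; apply: (le_trans (ler_norm_sum _ _ _)); apply: ler_sum => s' _.
  case: ifP => cs'; last by rewrite normr0 mulr_ge0.
  set x := (false, i); set x' := (false, j).
  have [small|big] := leqP #|(x :: s) ++ (x' :: s')| k.*2; last first.
    rewrite mixed_moment_closed_pair ?subrr ?normr0 ?mulr0 //.
    rewrite !size_tuple; apply: (@leq_trans (2 * (k.*2).+1)); first by lia.
    by rewrite leq_mul2l.
  rewrite mulr1; apply: (le_trans (ler_normB _ _)).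
  rewrite /B mulr_natl mulr2n lerD //.
    by apply: (le_trans (norm_mm _)); rewrite size_cat !size_word !size_tuple.
  rewrite normrM exprD ler_pM //;
  by apply: (le_trans (norm_mm _)); rewrite size_word size_tuple.
pose f (x : V) (s : seq V) (x' : V) (s' : seq V) : C :=
  B * (#|(x :: s) ++ (x' :: s')| <= k.*2)%:R.
have f0 x s x' s' : 0 <= f x s x' s' by rewrite mulr_ge0.
apply: (@le_trans _ _ (\sum_(x : V) \sum_(s : (k.*2).-tuple V)
  \sum_(x' : V) \sum_(s' : (k.*2).-tuple V) f x s x' s')).
  apply: (@le_trans _ _ (\sum_(i < r * N) \sum_(s : (k.*2).-tuple V)
    \sum_(x' : V) \sum_(s' : (k.*2).-tuple V) f (false, i) s x' s')).
    apply: ler_sum => i _; apply: ler_sum => s _.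
    apply: (sumL (f := fun x' => \sum_(s' : (k.*2).-tuple V) f (false, i) s x' s')).
    by move=> x'; apply: sumr_ge0.
  apply: (sumL (f := fun x => \sum_(s : (k.*2).-tuple V) \sum_(x' : V)
    \sum_(s' : (k.*2).-tuple V) f x s x' s')).
  by move=> x; do 3!apply: sumr_ge0 => ? _.
rewrite /f.
under eq_bigr do under eq_bigr do under eq_bigr do rewrite -mulr_sumr -natr_sum.
under eq_bigr do under eq_bigr do rewrite -mulr_sumr -natr_sum.
under eq_bigr do rewrite -mulr_sumr -natr_sum.
by rewrite -mulr_sumr -natr_sum ler_wpM2l ?ler_nat ?count_few_vertices2.
Qed.

(** The first summand bounds the variance and the second the squared bias, both divided by N^(2k);
    2r comes from the 2rN vertices of the graph. *)
Definition deviation_bound k : C :=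
  2 * K ^+ (k.*2 + k.*2) *
    (k.*2 ^ ((k.*2).+1 + (k.*2).+1) * (2 * r) ^ k.*2)%:R +
  ((K ^+ k.*2 + 2 ^+ k.*2) * (k ^ (k.*2).+1 * (2 * r) ^ k)%:R) ^+ 2.

Lemma expect_trace_deviation k :
  `|expect (fun l => (\tr ((stair_mx l *m (stair_mx l)^t*) ^+ k) -
      (N ^ k.+1 * \sum_(p < r) raney r k p.+1)%:R) ^+ 2)| <=
  deviation_bound k * (N ^ k.*2)%:R.
Proof.
have := expect_trace_bias k; have := expect_trace_variance k.
set c := (_ * \sum_(p < r) _)%:R : C; set T := fun l => \tr _.
have cV : #|{: V}| = (2 * r * N)%N by rewrite card_prod card_bool card_ord mulnA.
rewrite cV => var bias.
have -> : expect (fun l => (T l - c) ^+ 2) =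
    (expect (fun l => T l ^+ 2) - expect T ^+ 2) + (expect T - c) ^+ 2.
  have -> : expect (fun l => (T l - c) ^+ 2) =
      expect (fun l => T l ^+ 2 + ((- 2 * c) * T l + c ^+ 2 * 1)).
    by apply: eq_expect => l; ring.
  rewrite !expectD !expectZ expect1; ring.
apply: (le_trans (ler_normD _ _)); rewrite /deviation_bound mulrDl lerD //.
  by apply: (le_trans var); rewrite -[leRHS]mulrA -natrM [in leLHS]expnMn mulnA.
have -> : (N ^ k.*2)%:R = (N ^ k)%:R ^+ 2 :> C by rewrite -natrX -expnM muln2.
rewrite normrX -exprMn lerXn2r ?nnegrE //.
  by rewrite !mulr_ge0 // addr_ge0 // exprn_ge0.
by apply: (le_trans bias); rewrite -[leRHS]mulrA -natrM [in leLHS]expnMn mulnA.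
Qed.

End Stair.
End FiniteModel.

Local Open Scope sesquilinear_scope.

(** * Resolvents of Gram matrices *)

Section Spectral.
Variable C : numClosedFieldType.

Definition frob m n (A : 'M[C]_(m, n)) : C := \sum_i \sum_j `|A i j| ^+ 2.

Lemma frobE m n (A : 'M[C]_(m, n)) : frob A = \tr (A *m A^t*).
Proof.
apply: eq_bigr => i _; rewrite mxE; apply: eq_bigr => j _.
by rewrite !mxE normCK.
Qed.

Lemma adjmxM m n p (A : 'M[C]_(m, n)) (B : 'M[C]_(n, p)) :
  (A *m B)^t* = B^t* *m A^t*.
Proof. by rewrite trmx_mul map_mxM. Qed.

Lemma frob_adj m n (A : 'M[C]_(m, n)) : frob (A^t*) = frob A.
Proof. by rewrite !frobE trmxCK mxtrace_mulC. Qed.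

Lemma frob_unitary n p (P : 'M[C]_n) (A : 'M[C]_(n, p)) :
  P \is unitarymx -> frob (P *m A) = frob A.
Proof.
move=> Pu; rewrite !frobE adjmxM mulmxA mxtrace_mulC !mulmxA.
by rewrite -(invmx_unitary Pu) mulVmx ?unitarymx_unit // mul1mx.
Qed.

Lemma frob_diag_le n p (d : 'rV[C]_n) (A : 'M[C]_(n, p)) :
  (forall j, `|d 0 j| <= 1) -> frob (diag_mx d *m A) <= frob A.
Proof.
move=> d1; apply: ler_sum => i _; apply: ler_sum => j _.
rewrite mul_diag_mx mxE normrM exprMn -[leRHS]mul1r ler_wpM2r ?exprn_ge0 //.
by rewrite expr_le1 ?normr_ge0.
Qed.

(** A weighted arithmetic-geometric mean inequality, entry by entry. The free weight t replaces
    Cauchy-Schwarz and its square roots; it is chosen only at the end, according to the accuracy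
    wanted. *)
Lemma norm_trace_mul_le m n (A : 'M[C]_(m, n)) (B : 'M[C]_(n, m)) (t : C) :
  0 < t -> `|\tr (A *m B)| <= 2^-1 * (t^-1 * frob A + t * frob B).
Proof.
move=> t0; have -> : frob B = \sum_i \sum_j `|B j i| ^+ 2 by rewrite /frob exchange_big.
rewrite /frob !mulr_sumr -big_split mulr_sumr.
apply: (le_trans (ler_norm_sum _ _ _)); apply: ler_sum => i _.
rewrite !mulr_sumr -big_split mulr_sumr mxE.
apply: (le_trans (ler_norm_sum _ _ _)); apply: ler_sum => j _.
rewrite normrM; set a := `|_|; set b := `|_|.
have -> : 2^-1 * (t^-1 * a ^+ 2 + t * b ^+ 2) = a * b + 2^-1 * (t^-1 * (a - t * b) ^+ 2).
  by field; rewrite gt_eqF.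
rewrite lerDl; apply: mulr_ge0; first by rewrite invr_ge0.
apply: mulr_ge0; first by rewrite invr_ge0 ltW.
apply: real_exprn_even_ge0 => //.
by rewrite realB ?realM ?normr_real // gtr0_real.
Qed.

Definition resolvent_sum n (W : 'M[C]_n) k : C :=
  \sum_j (1 + spectral_diag W 0 j)^-1 ^+ k.

Section Gram.
Variables (n m : nat) (c : C).
Hypothesis c_ge0 : 0 <= c.
Implicit Type X : 'M[C]_(n, m).

Definition gram X : 'M[C]_n := c *: (X *m X^t*).

Lemma gram_adj X : (gram X)^t* = gram X.
Proof.
rewrite /gram linearZ /= map_mxZ adjmxM trmxCK.
by congr (_ *: _); apply: CrealP; apply: ger0_real.
Qed.

Lemma gram_normal X : gram X \is normalmx.
Proof. by apply/normalmxP; rewrite gram_adj. Qed.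

Lemma gram_spectral X :
  gram X = (spectralmx (gram X))^t* *m diag_mx (spectral_diag (gram X))
    *m spectralmx (gram X).
Proof.
rewrite -(invmx_unitary (spectral_unitarymx (gram X))).
exact/orthomx_spectralP/gram_normal.
Qed.

Let unitV X : spectralmx (gram X) *m (spectralmx (gram X))^t* = 1%:M.
Proof. exact/unitarymxP/spectral_unitarymx. Qed.

Let unitK X : (spectralmx (gram X))^t* *m spectralmx (gram X) = 1%:M.
Proof. exact/mulmx1C/unitV. Qed.

Lemma gram_spectral_ge0 X j : 0 <= spectral_diag (gram X) 0 j.
Proof.
set P := spectralmx (gram X).
have e : diag_mx (spectral_diag (gram X)) = P *m gram X *m P^t*.
  rewrite [in RHS]gram_spectral -/P !mulmxA unitV mul1mx -!mulmxA.
  by rewrite unitV mulmx1.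
have -> : spectral_diag (gram X) 0 j = diag_mx (spectral_diag (gram X)) j j.
  by rewrite mxE eqxx.
rewrite e /gram -scalemxAr -scalemxAl mxE mulr_ge0 //.
have -> : P *m (X *m X^t*) *m P^t* = (P *m X) *m (P *m X)^t* by rewrite adjmxM !mulmxA.
rewrite mxE; apply: sumr_ge0 => k _.
by rewrite [X in _ * X]mxE [X in _ * (X)^*]mxE mul_conjC_ge0.
Qed.

Lemma gram_conjX X (d : 'rV[C]_n) k :
  ((spectralmx (gram X))^t* *m diag_mx d *m spectralmx (gram X)) ^+ k =
  (spectralmx (gram X))^t* *m diag_mx (map_mx (fun x => x ^+ k) d)
    *m spectralmx (gram X).
Proof.
elim: k => [|k IH].
  have -> : map_mx (fun x : C => x ^+ 0) d = const_mx 1.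
    by apply/rowP => j; rewrite !mxE expr0.
  by rewrite diag_const_mx mulmx1 unitK.
rewrite exprS IH -[GRing.mul]/mulmx -!mulmxA (mulmxA (spectralmx _)) unitV mul1mx.
rewrite (mulmxA (diag_mx d)) mulmx_diag; congr (_ *m (diag_mx _ *m _)).
by apply/rowP => j; rewrite !mxE exprS.
Qed.

Lemma trace_conj X (d : 'rV[C]_n) :
  \tr ((spectralmx (gram X))^t* *m diag_mx d *m spectralmx (gram X)) = \sum_j d 0 j.
Proof. by rewrite mxtrace_mulC mulmxA unitV mul1mx mxtrace_diag. Qed.

Lemma trace_gramX X k : \tr (gram X ^+ k) = \sum_j spectral_diag (gram X) 0 j ^+ k.
Proof.
rewrite [in LHS]gram_spectral gram_conjX trace_conj.
by apply: eq_bigr => j _; rewrite mxE.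
Qed.

(** The inverse of 1 + [gram X], written in the eigenbasis so that traces of powers and the
    contraction property can be read off; [resolventK] shows that it is the inverse. *)
Definition resolvent X : 'M[C]_n :=
  (spectralmx (gram X))^t* *m
    diag_mx (map_mx (fun x => (1 + x)^-1) (spectral_diag (gram X)))
    *m spectralmx (gram X).

Lemma trace_resolventX X k :
  \tr (resolvent X ^+ k) = \sum_j (1 + spectral_diag (gram X) 0 j)^-1 ^+ k.
Proof.
by rewrite gram_conjX trace_conj; apply: eq_bigr => j _; rewrite !mxE.
Qed.

Let ev1_neq0 X j : 1 + spectral_diag (gram X) 0 j != 0.
Proof. by rewrite gt_eqF // ltr_pwDl // gram_spectral_ge0. Qed.

Let gram1 X : 1%:M + gram X = (spectralmx (gram X))^t* *m
    diag_mx (map_mx (fun x => 1 + x) (spectral_diag (gram X)))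
    *m spectralmx (gram X).
Proof.
have -> : map_mx (fun x => 1 + x) (spectral_diag (gram X)) =
   const_mx 1 + spectral_diag (gram X).
  by apply/rowP => j; rewrite !mxE.
by rewrite linearD /= mulmxDr mulmxDl -gram_spectral diag_const_mx mulmx1 unitK.
Qed.

Lemma resolventK X : resolvent X *m (1%:M + gram X) = 1%:M.
Proof.
rewrite gram1 /resolvent -!mulmxA (mulmxA (spectralmx _)) unitV mul1mx.
rewrite (mulmxA (diag_mx _)) mulmx_diag -[RHS](unitK X); congr (_ *m _).
rewrite -[RHS]mul1mx -diag_const_mx; congr (diag_mx _ *m _).
by apply/rowP => j; rewrite !mxE mulVf.
Qed.

Lemma resolventVK X : (1%:M + gram X) *m resolvent X = 1%:M.
Proof. exact/mulmx1C/resolventK. Qed.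

Lemma resolvent_adj X : (resolvent X)^t* = resolvent X.
Proof.
rewrite /resolvent !adjmxM trmxCK mulmxA; congr (_ *m _ *m _).
rewrite tr_diag_mx map_diag_mx; congr diag_mx; apply/rowP => j; rewrite !mxE.
apply: CrealP; apply: ger0_real; rewrite invr_ge0 addr_ge0 //.
exact: gram_spectral_ge0.
Qed.

(** Unitary factors preserve [frob], and the eigenvalues 1 / (1 + x) of the resolvent are at most 1
    because x >= 0. *)
Lemma frob_resolvent_le X p (A : 'M[C]_(n, p)) : frob (resolvent X *m A) <= frob A.
Proof.
rewrite /resolvent -!mulmxA frob_unitary ?trmxC_unitary ?spectral_unitarymx //.
apply: (@le_trans _ _ (frob (spectralmx (gram X) *m A))); last first.
  by rewrite frob_unitary ?spectral_unitarymx.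
apply: frob_diag_le => j; rewrite mxE.
have l0 := gram_spectral_ge0 X j.
rewrite ger0_norm ?invr_ge0 ?addr_ge0 //.
by rewrite invf_le1 ?ltr_pwDl // lerDl.
Qed.

Lemma frob_resolventX_le X p (A : 'M[C]_(n, p)) k :
  frob (resolvent X ^+ k *m A) <= frob A.
Proof.
elim: k => [|k IH]; first by rewrite expr0 mul1mx.
by rewrite exprS -mulmxA; apply: le_trans IH; apply: frob_resolvent_le.
Qed.

Lemma frob_resolventX_ler X p (A : 'M[C]_(p, n)) k :
  frob (A *m resolvent X ^+ k) <= frob A.
Proof.
rewrite -frob_adj adjmxM -[leRHS]frob_adj.
have -> : (resolvent X ^+ k)^t* = resolvent X ^+ k.
  elim: k => [|k IH]; first by rewrite expr0 trmx1 map_mx1.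
  by rewrite exprS -[GRing.mul]/mulmx adjmxM IH resolvent_adj; exact/esym/commrX/commr_refl.
exact: frob_resolventX_le.
Qed.

Lemma resolventB A B : resolvent A - resolvent B =
  resolvent A *m (gram B - gram A) *m resolvent B.
Proof.
have -> : gram B - gram A = (1%:M + gram B) - (1%:M + gram A).
  by rewrite opprD addrACA subrr add0r.
by rewrite mulmxBr mulmxBl -mulmxA resolventVK mulmx1 resolventK mul1mx.
Qed.

Lemma gramB A B : gram B - gram A = c *: ((B - A) *m B^t* + A *m (B - A)^t*).
Proof.
rewrite /gram -scalerBr; congr (_ *: _).
rewrite linearB /= map_mxB mulmxBl mulmxBr.
by rewrite addrA subrK.
Qed.

(** Telescoping A^(k+1) - B^(k+1) = A^k (A - B) + (A^k - B^k) B for the resolvents; the factor with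
    exponent l absorbs the trailing B in the induction. In each telescoped term the resolvent
    identity leaves two products that are linear in the difference of the matrices, and the
    surrounding resolvents are contractions. *)
Lemma trace_resolventX_diff_le A B (t : C) k l : 0 < t ->
  `|\tr ((resolvent A ^+ k - resolvent B ^+ k) *m resolvent B ^+ l)| <=
  k%:R * (c * 2^-1 * (2 * t^-1 * frob (A - B) + t * (frob A + frob B))).
Proof.
move=> t0; elim: k l => [|k IH] l.
  by rewrite !expr0 subrr mul0mx mxtrace0 normr0 mul0r.
have -> : (resolvent A ^+ k.+1 - resolvent B ^+ k.+1) *m resolvent B ^+ l =
  resolvent A ^+ k *m (resolvent A - resolvent B) *m resolvent B ^+ l +
  (resolvent A ^+ k - resolvent B ^+ k) *m resolvent B ^+ l.+1.
  rewrite !(exprSr _ k) (exprS _ l) -[GRing.mul]/mulmx.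
  by rewrite mulmxBr !mulmxBl !mulmxA addrA subrK.
rewrite mxtraceD -[k.+1 in leRHS]addn1 natrD mulrDl mul1r addrC.
apply: (le_trans (ler_normD _ _)); apply: lerD; first exact: IH.
rewrite resolventB gramB -scalemxAr -scalemxAl -scalemxAr -scalemxAl mxtraceZ.
rewrite normrM (ger0_norm c_ge0) -mulrA ler_wpM2l //.
rewrite mulmxDr mulmxDl mulmxDr mulmxDl mxtraceD.
apply: (le_trans (ler_normD _ _)).
have fl (Z : 'M[C]_(n, m)) : frob (resolvent A ^+ k *m resolvent A *m Z) <= frob Z.
  by rewrite -[_ *m resolvent A]/(_ * _) -exprSr frob_resolventX_le.
have fr (Z : 'M[C]_(m, n)) : frob (Z *m resolvent B *m resolvent B ^+ l) <= frob Z.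
  by rewrite -mulmxA -[resolvent B *m _]/(_ * _) -exprS frob_resolventX_ler.
move: (resolvent A) (resolvent B) fl fr => GA GB fl fr.
have b1 := norm_trace_mul_le (GA ^+ k *m (GA *m (B - A)))
   (B^t* *m GB *m GB ^+ l) t0.
(* The difference is now the second factor, so the inverse weight is used: the small factor again
   gets t^-1. *)
have b2 := norm_trace_mul_le (GA ^+ k *m (GA *m A))
   ((B - A)^t* *m GB *m GB ^+ l) (t := t^-1) _.
rewrite !mulmxA in b1 b2 *.
apply: (le_trans (lerD b1 (b2 _))); first by rewrite invr_gt0.
have fD : frob (B - A) = frob (A - B).
  by do 2!apply: eq_bigr => ? _; rewrite !mxE distrC.
rewrite -mulrDr ler_wpM2l ?invr_ge0 // invrK.
have -> : 2 * t^-1 * frob (A - B) + t * (frob A + frob B) =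
  (t^-1 * frob (A - B) + t * frob B) + (t * frob A + t^-1 * frob (A - B)) by ring.
have tV0 : 0 <= t^-1 by rewrite invr_ge0 ltW.
have t0' := ltW t0.
apply: lerD; apply: lerD; rewrite ler_wpM2l //.
- by rewrite -fD; exact: fl.
- by rewrite -[leRHS]frob_adj; exact: fr.
- by rewrite -fD -[leRHS]frob_adj; exact: fr.
Qed.

Lemma resolvent_trace_perturbation A B (t : C) k : 0 < t ->
  `|resolvent_sum (gram A) k - resolvent_sum (gram B) k| <=
  k%:R * (c * 2^-1 * (2 * t^-1 * frob (A - B) + t * (frob A + frob B))).
Proof.
move=> /trace_resolventX_diff_le -/(_ A B k 0%N).
by rewrite expr0 mulmx1 linearB /= !trace_resolventX.
Qed.

End Gram.
End Spectral.

Local Close Scope sesquilinear_scope.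

Local Open Scope classical_set_scope.
Local Open Scope ring_scope.

(** * Convergence of moments and of distribution functions *)

Section Bernstein.
Variable R : realType.
Implicit Types (f : nat -> R) (g h : R -> R).

(* The Bernstein polynomial sum_j C(n, j) X^j (1 - X)^(n - j) f j. *)
Fixpoint bernstein n f : {poly R} :=
  if n is n'.+1 then 'X * bernstein n' (f \o S) + (1 - 'X) * bernstein n' f
  else (f 0%N)%:P.

Lemma hornerB n f x : (bernstein n.+1 f).[x] =
  x * (bernstein n (f \o S)).[x] + (1 - x) * (bernstein n f).[x].
Proof. by rewrite /= !hornerE. Qed.

Lemma bernsteinN n f x : (bernstein n (\- f)).[x] = - (bernstein n f).[x].
Proof.
elim: n f => [|n IH] f; first by rewrite /= !hornerE.
rewrite !hornerB; have -> : (\- f) \o S = \- (f \o S) by [].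
rewrite !IH; ring.
Qed.

(** Bernstein averages are monotone, and their value on (j - c)^2 is the second moment about c of a
    binomial variable, of mean nx and variance nx(1 - x). The centre c is arbitrary because the
    shift [f \o S] moves it to c - 1. *)
Lemma bernstein_le_quadratic n f (a b c x : R) : 0 <= x <= 1 ->
  (forall j, (j <= n)%N -> f j <= a + b * (j%:R - c) ^+ 2) ->
  (bernstein n f).[x] <= a + b * (n%:R * x * (1 - x) + (n%:R * x - c) ^+ 2).
Proof.
move=> /andP[x0 x1]; elim: n f c => [|n IH] f c fb.
  by rewrite /= hornerE !mul0r add0r; exact: fb.
rewrite hornerB.
have h1 := IH (f \o S) (c - 1) _.
have {}h1 : x * (bernstein n (f \o S)).[x] <=
  x * (a + b * (n%:R * x * (1 - x) + (n%:R * x - (c - 1)) ^+ 2)).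
  rewrite ler_wpM2l //; apply: h1 => j jn /=.
  rewrite (_ : j%:R - (c - 1) = j.+1%:R - c); first exact: fb.
  by rewrite -natr1; ring.
have h2 : (1 - x) * (bernstein n f).[x] <=
  (1 - x) * (a + b * (n%:R * x * (1 - x) + (n%:R * x - c) ^+ 2)).
  rewrite ler_wpM2l ?subr_ge0 //; apply: IH => j jn; exact/fb/leqW.
apply: (le_trans (lerD h1 h2)); rewrite le_eqVlt; apply/orP; left; apply/eqP.
rewrite -[n.+1%:R]natr1; ring.
Qed.

(** Bernstein's argument, with the Lipschitz bound replaced by the quadratic L |t| <= L d + (L / d)
    t^2. The choice of d makes the constant term eta / 2; n is then so large that the variance term,
    at most L / (d n), is below eta / 2. *)
Lemma lipschitz_poly_approx g (L eta : R) : 0 < L -> 0 < eta ->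
  (forall a b, 0 <= a <= 1 -> 0 <= b <= 1 -> `|g a - g b| <= L * `|a - b|) ->
  exists q : {poly R}, forall x, 0 <= x <= 1 -> `|q.[x] - g x| <= eta.
Proof.
move=> L0 eta0 gL; set d := eta / (2 * L).
have d0 : 0 < d by apply: divr_gt0 => //; apply: mulr_gt0.
have etaE : eta / 2 = L * d by rewrite /d; field; rewrite gt_eqF.
clearbody d.
pose n := (Num.truncn (2 * L / (d * eta))).+1.
have n0 : 0 < n%:R :> R by rewrite ltr0n.
have nL : L / (d * n%:R) <= eta / 2.
  have : 2 * L / (d * eta) <= n%:R.
    by rewrite ltW // /n real_truncnS_gt // num_real.
  rewrite (ler_pdivrMr _ _ (mulr_gt0 d0 eta0)) (ler_pdivrMr _ _ (mulr_gt0 d0 n0)).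
  by lra.
exists (bernstein n (fun j => g (j%:R / n%:R))) => x x01.
have key j : (j <= n)%N -> `|g (j%:R / n%:R) - g x| <=
    eta / 2 + L / (d * n%:R ^+ 2) * (j%:R - n%:R * x) ^+ 2.
  move=> jn.
  have j01 : 0 <= (j%:R / n%:R : R) <= 1.
    by rewrite divr_ge0 //= ler_pdivrMr // mul1r ler_nat.
  apply: (le_trans (gL _ _ j01 x01)).
  have -> : L / (d * n%:R ^+ 2) * (j%:R - n%:R * x) ^+ 2 =
    L / d * (j%:R / n%:R - x) ^+ 2.
    by field; rewrite !gt_eqF.
  rewrite etaE.
  set t := _ - x; rewrite -[t ^+ 2]real_normK ?num_real //.
  rewrite -mulrA -mulrDr ler_pM2l // -subr_ge0.
  have -> : d + d^-1 * `|t| ^+ 2 - `|t| = d^-1 * ((`|t| - d / 2) ^+ 2 + 3 / 4 * d ^+ 2).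
    by field; rewrite gt_eqF.
  by rewrite mulr_ge0 ?invr_ge0 ?(ltW d0) // addr_ge0 ?sqr_ge0 // mulr_ge0 // sqr_ge0.
have fin : L / (d * n%:R ^+ 2) * (n%:R * x * (1 - x) + (n%:R * x - n%:R * x) ^+ 2)
    <= eta / 2.
  apply: le_trans nL; rewrite subrr expr0n addr0.
  have -> : L / (d * n%:R ^+ 2) * (n%:R * x * (1 - x)) = L / (d * n%:R) * (x * (1 - x)).
    by field; rewrite !gt_eqF.
  case/andP: x01 => x0 x1.
  rewrite -[leRHS]mulr1 ler_wpM2l //; first by rewrite divr_ge0 ?mulr_ge0 ?ltW.
  by nra.
have up : (bernstein n (fun j => g (j%:R / n%:R))).[x] <= (g x + eta / 2) + eta / 2.
  apply: le_trans (lerD (lexx _) fin).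
  apply: bernstein_le_quadratic => // j /key; rewrite ler_norml => /andP[_]; lra.
have lo : (bernstein n (\- (fun j => g (j%:R / n%:R)))).[x] <= (- g x + eta / 2) + eta / 2.
  apply: le_trans (lerD (lexx _) fin).
  apply: bernstein_le_quadratic => // j /key; rewrite ler_norml /= => /andP[+ _]; lra.
rewrite bernsteinN in lo; rewrite ler_norml; apply/andP; split; lra.
Qed.

Lemma lipschitz_poly_approx_itv h (L M eta : R) : 0 < L -> 0 < M -> 0 < eta ->
  (forall a b, `|h a - h b| <= L * `|a - b|) ->
  exists q : {poly R}, forall x, `|x| <= M -> `|h x - q.[x]| <= eta.
Proof.
move=> L0 M0 eta0 hL.
have M20 : 0 < 2 * M by rewrite mulr_gt0.
have [|q qP] := @lipschitz_poly_approx (fun t => h (2 * M * t - M)) (L * (2 * M)) eta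
  (mulr_gt0 L0 M20) eta0.
  move=> a b _ _; apply: (le_trans (hL _ _)).
  have -> : 2 * M * a - M - (2 * M * b - M) = 2 * M * (a - b) by ring.
  by rewrite normrM (gtr0_norm M20) !mulrA.
exists (q \Po ((2 * M)^-1 *: ('X + M%:P))) => x.
rewrite ler_norml => /andP[x1 x2].
rewrite horner_comp !hornerE /=.
have t01 : 0 <= (2 * M)^-1 * (x + M) <= 1.
  apply/andP; split; last by rewrite ler_pdivrMl //; lra.
  by apply: mulr_ge0; [rewrite invr_ge0 ltW | lra].
rewrite distrC; have := qP _ t01.
suff -> : 2 * M * ((2 * M)^-1 * (x + M)) - M = x by [].
by rewrite mulrA divff ?gt_eqF // mul1r addrK.
Qed.

End Bernstein.

(** * From convergence of moments to convergence of integrals *)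

Section MomentConvergence.
Variable R : realType.

Definition poly_moment (s : nat -> R) (q : {poly R}) : R :=
  \sum_(i < size q) q`_i * s i.

(* v behaves like the integral of h against a positive functional with moments s. *)
Definition moment_mean (h : R -> R) (s : nat -> R) (v : R) : Prop :=
  forall (q : {poly R}) (a b : R) (k : nat),
    (forall x, `|h x - q.[x]| <= a + b * x ^+ k.*2) ->
    `|v - poly_moment s q| <= a * s 0%N + b * s k.*2.

Lemma poly_growth (q : {poly R}) (M x : R) (d : nat) : 0 < M -> M <= `|x| ->
  (size q <= d)%N -> `|q.[x]| <= (\sum_(i < size q) `|q`_i| * M ^+ i) * (`|x| / M) ^+ d.
Proof.
move=> M0 Mx qd; rewrite horner_coef mulr_suml.
apply: (le_trans (ler_norm_sum _ _ _)); apply: ler_sum => i _.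
rewrite normrM normrX -mulrA ler_wpM2l //.
have -> : `|x| ^+ i = M ^+ i * (`|x| / M) ^+ i.
  by rewrite -exprMn mulrCA divff ?gt_eqF // mulr1.
rewrite ler_wpM2l ?exprn_ge0 ?(ltW M0) // ler_weXn2l //.
  by rewrite ler_pdivlMr // mul1r.
by apply: leq_trans qd; apply: ltnW.
Qed.

(** On [-M, M] with M = C + 1 the function h is close to a polynomial q. Outside, h - q is at most
    B' (|x| / M)^(2k) as soon as 2k bounds the size of q. The 2k-th moment is at most C^(2k), so
    this tail costs B' (C / M)^(2k), which tends to 0. *)
Lemma moment_sandwich (h : R -> R) (m : nat -> R) (L B C eps : R) :
  0 < L -> 0 < eps -> 0 <= C -> (forall k, `|m k| <= C ^+ k) ->
  (forall a b, `|h a - h b| <= L * `|a - b|) -> (forall x, `|h x| <= B) ->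
  exists (q : {poly R}) (a b : R) (k : nat),
    (forall x, `|h x - q.[x]| <= a + b * x ^+ k.*2) /\
    a * m 0%N + b * m k.*2 <= eps.
Proof.
move=> L0 eps0 C0 mC hL hB.
pose M := C + 1; have M0 : 0 < M by rewrite ltr_wpDl.
have e20 : 0 < eps / 2 by rewrite divr_gt0.
have [q qP] := lipschitz_poly_approx_itv L0 M0 e20 hL.
pose B' := B + \sum_(i < size q) `|q`_i| * M ^+ i.
have B0 : 0 <= B by apply: le_trans (hB 0); rewrite normr_ge0.
have S0 : 0 <= \sum_(i < size q) `|q`_i| * M ^+ i.
  by apply: sumr_ge0 => i _; rewrite mulr_ge0 // exprn_ge0 // ltW.
have B'0 : 0 <= B' by rewrite addr_ge0.
have cM : `|C / M| < 1.
  by rewrite ger0_norm ?divr_ge0 ?(ltW M0) // ltr_pdivrMr // mul1r ltrDl.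
have cv : B' * (C / M) ^+ n @[n --> \oo] --> 0.
  by rewrite -[X in _ --> X](mulr0 B'); apply: cvgMr; exact: cvg_expr.
have [k [ks kB]] : exists k, (size q <= k.*2)%N /\ B' * (C / M) ^+ k.*2 <= eps / 2.
  have /cvgrPdist_le /(_ _ e20)[n _ nP] := cv.
  exists (maxn n (size q)); split; first by lia.
  have := nP (maxn n (size q)).*2 _; rewrite /= sub0r normrN => /(_ _)/(le_trans (ler_norm _)).
  by apply; lia.
exists q, (eps / 2), (B' / M ^+ k.*2), k; split.
  move=> x; rewrite -mulrA -[x ^+ _]ger0_norm ?exprn_even_ge0 ?odd_double //.
  rewrite normrX [_^-1 * _]mulrC -exprVn -exprMn.
  have [xM|Mx] := leP `|x| M.
    apply: (le_trans (qP x xM)); rewrite lerDl mulr_ge0 // exprn_ge0 //.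
    by rewrite divr_ge0 // ltW.
  apply: (@le_trans _ _ (B' * (`|x| / M) ^+ k.*2)); last by rewrite lerDr ltW.
  apply: (le_trans (ler_normB _ _)); rewrite mulrDl lerD //.
    apply: (le_trans (hB x)); rewrite -[leLHS]mulr1 ler_wpM2l //.
    by rewrite exprn_ege1 // ler_pdivlMr // mul1r ltW.
  by apply: poly_growth => //; exact: ltW.
rewrite [leRHS](splitr eps); apply: lerD.
  rewrite -[leRHS]mulr1 ler_wpM2l ?(ltW e20) //.
  by have := mC 0%N; rewrite expr0; apply: le_trans; exact: ler_norm.
apply: le_trans kB; rewrite -mulrA ler_wpM2l // exprMn exprVn mulrC.
rewrite ler_wpM2r ?invr_ge0 ?exprn_ge0 ?(ltW M0) //.
by apply: le_trans (mC _); exact: ler_norm.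
Qed.

Lemma cvg_poly_moment (s : nat -> nat -> R) (m : nat -> R) (q : {poly R}) :
  (forall k, s N k @[N --> \oo] --> m k) ->
  poly_moment (s N) q @[N --> \oo] --> poly_moment m q.
Proof.
move=> sm; rewrite /poly_moment; apply: cvg_big => [|i _]; first exact: add_continuous.
by apply: cvgMr; exact: sm.
Qed.

(** The growth bound is needed only for the limit moments m: the sandwich is chosen for m, and [s N]
    then enters through the finitely many moments that occur in it. *)
Lemma moment_mean_cvg (h : R -> R) (s : nat -> nat -> R) (m : nat -> R)
  (v : nat -> R) (v0 L B C : R) :
  0 < L -> 0 <= C -> (forall k, `|m k| <= C ^+ k) ->
  (forall a b, `|h a - h b| <= L * `|a - b|) -> (forall x, `|h x| <= B) ->
  moment_mean h m v0 -> (\forall N \near \oo, moment_mean h (s N) (v N)) ->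
  (forall k, s N k @[N --> \oo] --> m k) ->
  v N @[N --> \oo] --> v0.
Proof.
move=> L0 C0 mC hL hB mv0 mv sm; apply/cvgrPdist_le => eps eps0.
have e40 : 0 < eps / 4 by rewrite divr_gt0.
have [q [a [b [k [hq he]]]]] := moment_sandwich L0 e40 C0 mC hL hB.
have c1 : a * s N 0%N + b * s N k.*2 @[N --> \oo] --> a * m 0%N + b * m k.*2.
  by apply: cvgD; apply: cvgMr; exact: sm.
have /cvgrPdist_le/(_ _ e40) n1 := c1.
have /cvgrPdist_le/(_ _ e40) n2 := cvg_poly_moment (q := q) sm.
near=> N.
have h0 := mv0 _ _ _ _ hq.
have h1 : `|v N - poly_moment (s N) q| <= a * s N 0%N + b * s N k.*2.
  by have : moment_mean h (s N) (v N) by [near: N]; apply.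
have h2 : `|a * m 0%N + b * m k.*2 - (a * s N 0%N + b * s N k.*2)| <= eps / 4 by near: N.
have h3 : `|poly_moment m q - poly_moment (s N) q| <= eps / 4 by near: N.
move: h0 h1 h2 h3; rewrite !ler_norml => /andP[? ?] /andP[? ?] /andP[? ?] /andP[? ?].
by apply/andP; split; lra.
Unshelve. all: by end_near. Qed.

End MomentConvergence.

Section RintegralBounded.
Context d (T : measurableType d) (R : realType) (P : probability T R).

Lemma bounded_integrable (h : T -> R) (B : R) : measurable_fun setT h ->
  (forall x, `|h x| <= B) -> P.-integrable setT (EFin \o h).
Proof.
move=> mh hB; apply: measurable_bounded_integrable => //.
  exact: fin_num_fun_lty.
exists B; split; first exact: num_real.
by move=> M BM x _; apply: (le_trans (hB x)); exact: ltW.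
Qed.

Lemma Rintegral_horner (f : T -> R) (q : {poly R}) :
  (forall k, P.-integrable setT (EFin \o (fun x => f x ^+ k))) ->
  P.-integrable setT (EFin \o (fun x => q.[f x])) /\
  \int[P]_x q.[f x] = \sum_(i < size q) q`_i * \int[P]_x (f x ^+ i).
Proof.
move=> intf; have -> : (fun x => q.[f x]) = fun x => \sum_(i < size q) q`_i * f x ^+ i.
  by apply/funext => x; rewrite horner_coef.
elim: (size q) => [|n [IH1 IH2]].
  have -> : (fun x => \sum_(i < 0) q`_i * f x ^+ i) = cst 0.
    by apply/funext => x; rewrite big_ord0.
  rewrite big_ord0 Rintegral_cst // mul0r; split => //.
  by apply: (@bounded_integrable (cst 0) 0) => // x; rewrite normr0.
have intn : P.-integrable setT (EFin \o (fun x => q`_n * f x ^+ n)).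
  by apply: (integrableZl _ _ (intf n)).
have -> : (fun x => \sum_(i < n.+1) q`_i * f x ^+ i) =
   fun x => \sum_(i < n) q`_i * f x ^+ i + q`_n * f x ^+ n.
  by apply/funext => x; rewrite big_ord_recr.
split.
  exact: (integrableD _ IH1 intn).
rewrite RintegralD // IH2 big_ord_recr /=; congr (_ + _).
by rewrite RintegralZl.
Qed.

Lemma Rintegral_indic (A : set T) : measurable A ->
  \int[P]_x (\1_A x : R) = fine (P A).
Proof. by move=> mA; rewrite /Rintegral integral_indic // setIT. Qed.

Lemma Rintegral_probability_ge (A : set T) (h : T -> R) : measurable A ->
  measurable_fun setT h -> (forall x, 0 <= h x <= 1) -> (forall x, A x -> h x = 1) ->
  fine (P A) <= \int[P]_x h x.
Proof.
move=> mA mh h01 hA; rewrite -Rintegral_indic //.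
apply: le_Rintegral => //.
- by apply: (@bounded_integrable _ 1) => // x; rewrite indicE ger0_norm // lern1 leq_b1.
- apply: (@bounded_integrable _ 1) => // x.
  by case/andP: (h01 x) => ? ?; rewrite ger0_norm.
- move=> x _; rewrite indicE; case: (boolP (x \in A)) => [/set_mem/hA ->//|_].
  by case/andP: (h01 x).
Qed.

Lemma Rintegral_probability_le (A : set T) (h : T -> R) : measurable A ->
  measurable_fun setT h -> (forall x, 0 <= h x <= 1) -> (forall x, ~ A x -> h x = 0) ->
  \int[P]_x h x <= fine (P A).
Proof.
move=> mA mh h01 hA; rewrite -Rintegral_indic //.
apply: le_Rintegral => //.
- apply: (@bounded_integrable _ 1) => // x.
  by case/andP: (h01 x) => ? ?; rewrite ger0_norm.
- by apply: (@bounded_integrable _ 1) => // x; rewrite indicE ger0_norm // lern1 leq_b1.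
- move=> x _; rewrite indicE; case: (boolP (x \in A)) => [_|].
    by case/andP: (h01 x).
  by rewrite notin_setE => /hA ->.
Qed.

End RintegralBounded.

Section Clamp.
Variable R : realType.

Definition clamp01 (t : R) : R := Num.max 0 (Num.min 1 t).

Lemma clamp01_ge0 t : 0 <= clamp01 t.
Proof. by rewrite /clamp01 le_max lexx. Qed.

Lemma clamp01_le1 t : clamp01 t <= 1.
Proof. by rewrite /clamp01 ge_max ler01 ge_min lexx. Qed.

Lemma clamp01_itv t : 0 <= clamp01 t <= 1.
Proof. by rewrite clamp01_ge0 clamp01_le1. Qed.

Lemma norm_clamp01_le1 t : `|clamp01 t| <= 1.
Proof. by rewrite ger0_norm ?clamp01_ge0 // clamp01_le1. Qed.

Lemma clamp01_eq1 t : 1 <= t -> clamp01 t = 1.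
Proof. by move=> t1; rewrite /clamp01 min_l // max_r. Qed.

Lemma clamp01_eq0 t : t <= 0 -> clamp01 t = 0.
Proof. by move=> t0; rewrite /clamp01 max_l // ge_min t0 orbT. Qed.

Lemma clamp01_lip s t : `|clamp01 s - clamp01 t| <= `|s - t|.
Proof.
have h1 := ler_norm (s - t); have h2 := ler_norm (t - s); rewrite distrC in h2.
rewrite ler_norml /clamp01 /Order.max /Order.min; apply/andP.
by case: (ltP 1 s) => ?; case: (ltP 1 t) => ?; case: ltP => ?; case: ltP => ?;
  split; lra.
Qed.

Lemma measurable_clamp01 d (T : measurableType d) (f : T -> R) :
  measurable_fun setT f -> measurable_fun setT (clamp01 \o f).
Proof.
move=> mf; apply: measurable_maxr => //; apply: measurable_minr => //.
Qed.

End Clamp.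

(** * Determinacy of the moment problem *)

Section MomentProblem.
Variable R : realType.
Local Notation TR := (measurableTypeR R).

Lemma prob_moment_mean (nu : probability TR R) (m : nat -> R) (h : R -> R) (B : R) :
  (forall k, nu.-integrable setT (fun x : TR => ((x : R) ^+ k)%:E)) ->
  (forall k, (\int[nu]_x ((x : R) ^+ k)%:E)%E = (m k)%:E) ->
  measurable_fun (setT : set TR) h -> (forall x, `|h x| <= B) ->
  moment_mean h m (\int[nu]_(x in setT) (h x)).
Proof.
move=> intX mE mh hB q a b k hq.
have ih := bounded_integrable nu mh hB.
have mom i : \int[nu]_x ((x : R) ^+ i) = m i by rewrite /Rintegral mE.
have [iq eq] := Rintegral_horner q intX.
have -> : poly_moment m q = \int[nu]_x q.[x].
  by rewrite eq; apply: eq_bigr => i _; rewrite mom.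
rewrite -RintegralB //.
have ib : nu.-integrable setT (EFin \o (fun x : TR => b * (x : R) ^+ k.*2)).
  exact: (integrableZl _ _ (intX k.*2)).
have ia : nu.-integrable setT (EFin \o (fun x : TR => a * (x : R) ^+ 0)).
  exact: (integrableZl _ _ (intX 0%N)).
have idiff : nu.-integrable setT (EFin \o (fun x => h x - q.[x])).
  exact: (integrableB _ ih iq).
apply: (le_trans (le_normr_Rintegral _ idiff)) => //.
rewrite -(mom 0%N) -(mom k.*2) -!RintegralZl //; try exact: intX.
rewrite -RintegralD //; apply: le_Rintegral => //.
- exact: (integrable_abse idiff).
- exact: (integrableD _ ia ib).
- by move=> x _; rewrite expr0 mulr1; exact: hq.
Qed.

Let idTR : TR -> R := idfun.

#[local] HB.instance Definition _ :=
  @isMeasurableFun.Build _ _ _ _ idTR (@measurable_id _ _ setT).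

Lemma measurable_ray (x : R) : measurable (`]-oo, x]%classic : set TR).
Proof. exact: measurable_itv. Qed.

(** Integrals of bounded Lipschitz functions are determined by the moments. Ramps from 1 at x down
    to 0 at x + e transfer this to distribution functions, and half-open intervals generate the
    Borel sets. *)
Lemma moment_determinate (nu1 nu2 : probability TR R) (m : nat -> R) (C : R) :
  0 <= C -> (forall k, `|m k| <= C ^+ k) ->
  (forall k, nu1.-integrable setT (fun x : TR => ((x : R) ^+ k)%:E)) ->
  (forall k, (\int[nu1]_x ((x : R) ^+ k)%:E)%E = (m k)%:E) ->
  (forall k, nu2.-integrable setT (fun x : TR => ((x : R) ^+ k)%:E)) ->
  (forall k, (\int[nu2]_x ((x : R) ^+ k)%:E)%E = (m k)%:E) ->
  forall A : set TR, measurable A -> nu1 A = nu2 A.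
Proof.
move=> C0 mC i1 e1 i2 e2.
pose h (x e y : R) := clamp01 ((x + e - y) / e).
have mh x e : measurable_fun (setT : set TR) (h x e).
  apply: (@measurable_clamp01 _ _ TR (fun y => (x + e - y) / e)).
  apply: measurable_funM => //; apply: measurable_funB => //.
have hlip x e : 0 < e -> forall a b, `|h x e a - h x e b| <= e^-1 * `|a - b|.
  move=> e0 a b; apply: (le_trans (clamp01_lip _ _)).
  rewrite -mulrBl normrM (gtr0_norm (_ : 0 < e^-1)) ?invr_gt0 // mulrC.
  by rewrite ler_pM2l ?invr_gt0 // distrC (_ : _ - _ = a - b) //; ring.
have hB x e y : `|h x e y| <= 1 by exact: norm_clamp01_le1.
have eqI x e : 0 < e -> \int[nu1]_(y in setT) h x e y = \int[nu2]_(y in setT) h x e y.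
  move=> e0; have L0 : 0 < e^-1 by rewrite invr_gt0.
  have p1 := prob_moment_mean i1 e1 (mh x e) (hB x e).
  have p2 := prob_moment_mean i2 e2 (mh x e) (hB x e).
  have cm k : (fun=> m k) n @[n --> \oo] --> m k by exact: cvg_cst.
  (* Applied to a constant sequence, convergence of integrals becomes equality by uniqueness of
     limits. *)
  have c1 := @moment_mean_cvg R (h x e) (fun=> m) m
    (fun=> \int[nu1]_(y in setT) h x e y) (\int[nu2]_(y in setT) h x e y) _ _ _
    L0 C0 mC (hlip x e e0) (hB x e) p2 (nearW _ (fun=> p1)) cm.
  have c2 : (fun=> \int[nu1]_(y in setT) h x e y) n @[n --> \oo] -->
    \int[nu1]_(y in setT) h x e y by exact: cvg_cst.
  exact: (cvg_unique (@norm_hausdorff _ _) c2 (c1 _)).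
have hlow x e y : 0 < e -> (`]-oo, x]%classic : set R) y -> h x e y = 1.
  rewrite /= in_itv /= => e0 yx; apply: clamp01_eq1.
  by rewrite ler_pdivlMr // mul1r; lra.
have hup x e y : 0 < e -> ~ (`]-oo, x + e]%classic : set R) y -> h x e y = 0.
  rewrite /= in_itv /= => e0 /negP; rewrite -ltNge => yx; apply: clamp01_eq0.
  by rewrite ler_pdivrMr // mul0r; lra.
have h01 x e y : 0 <= h x e y <= 1 by exact: clamp01_itv.
pose F (nu : probability TR R) := cdf (idTR : {RV nu >-> R}).
have FE nu x : F nu x = nu `]-oo, x]%classic by [].
have le12 (n1 n2 : probability TR R) : (forall x e, 0 < e ->
    \int[n1]_(y in setT) h x e y = \int[n2]_(y in setT) h x e y) ->
    forall x, (F n1 x <= F n2 x)%E.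
  move=> eqn x.
  (* The ramp lies between the indicators of the rays ending at x and at x + e; right continuity
     then lets e tend to 0. *)
  have step (e : R) : 0 < e -> (F n1 x <= F n2 (x + e)%R)%E.
    move=> e0; rewrite !FE -(@fineK _ (n1 _)) ?fin_num_measure //.
    rewrite -(@fineK _ (n2 _)) ?fin_num_measure // lee_fin.
    apply: (@le_trans _ _ (\int[n1]_(y in setT) h x e y)).
      by apply: Rintegral_probability_ge => // y; apply: hlow.
    by rewrite eqn //; apply: Rintegral_probability_le => // y; apply: hup.
  have rc := @cdf_right_continuous _ _ _ n2 (idTR : {RV n2 >-> R}) x.
  apply: (cvge_to_ge rc); near=> y.
  have -> : y = x + (y - x) by rewrite addrC subrK.
  by apply: step; rewrite subr_gt0.
have FF x : F nu1 x = F nu2 x.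
  by apply/eqP; rewrite eq_le !le12 // => y e e0; rewrite eqI.
have ray (nu : probability TR R) (a b : R) : a <= b ->
    (nu `]a, b]%classic = F nu b - F nu a)%E.
  move=> ab; rewrite !FE.
  have -> : `]a, b]%classic = `]-oo, b]%classic `\` `]-oo, a]%classic :> set TR.
    by rewrite -[RHS]setCK setCD setCitvl setUC -[LHS]setCK setCitv.
  rewrite measureD ?setIidr //; try exact: measurable_ray.
    exact: subset_itvl.
  by rewrite -ge0_fin_numE// fin_num_measure //; exact: measurable_ray.
move=> A mA.
refine (@measure_unique _ R TR (@ocitv R) (fun k => `](- k%:R), k%:R]%classic)
  erefl _ _ _ nu1 nu2 _ _ A mA).
- exact: ocitvI.
- by move=> k; exact: is_ocitv.
- exact: bigcup_itvT.
- move=> I [[a b] _ <-] /=; have [ab|ba] := leP a b.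
    by rewrite !ray // !FF.
  by rewrite set_itv_ge ?measure0 // bnd_simp -leNgt ltW.
- by move=> k; rewrite -ge0_fin_numE // fin_num_measure.
Unshelve. all: by end_near. Qed.

End MomentProblem.

(** * From resolvent traces to distribution functions *)

Section ResolventDistribution.
Variable R : realType.
Local Notation TR := (measurableTypeR R).

Lemma lipschitz_measurable (h : R -> R) (L : R) : 0 < L ->
  (forall a b, `|h a - h b| <= L * `|a - b|) -> measurable_fun (setT : set TR) h.
Proof.
move=> L0 hL; apply: continuous_measurable_fun => x.
apply/cvgrPdist_le => e e0; near=> y.
apply: (le_trans (hL _ _)); rewrite -ler_pdivlMl //.
near: y; apply: cvgr_dist_le => //; by rewrite mulr_gt0 // invr_gt0.
Unshelve. all: by end_near. Qed.

(** The maximum extends 1 / (1 + x) from [0, +oo[ to a bounded Lipschitz function on the whole line,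
    as the lemmas on integrals require. *)
Definition resolvent_at1 (x : R) : R := (1 + Num.max x 0)^-1.

Lemma resolvent_at1E x : 0 <= x -> resolvent_at1 x = (1 + x)^-1.
Proof. by move=> x0; rewrite /resolvent_at1 max_l. Qed.

Let den_gt0 (x : R) : 0 < 1 + Num.max x 0.
Proof. by rewrite ltr_pwDl // le_max lexx orbT. Qed.

Lemma resolvent_at1_gt0 x : 0 < resolvent_at1 x.
Proof. by rewrite invr_gt0. Qed.

Lemma resolvent_at1_le1 x : resolvent_at1 x <= 1.
Proof. by rewrite /resolvent_at1 invf_le1 // lerDl le_max lexx orbT. Qed.

Lemma resolvent_at1_itv x : 0 <= resolvent_at1 x <= 1.
Proof. by rewrite resolvent_at1_le1 ltW // resolvent_at1_gt0. Qed.

Lemma resolvent_at1_lip x y : `|resolvent_at1 x - resolvent_at1 y| <= 1 * `|x - y|.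
Proof.
have -> : resolvent_at1 x - resolvent_at1 y =
   (Num.max y 0 - Num.max x 0) * (resolvent_at1 x * resolvent_at1 y).
  rewrite /resolvent_at1; field.
  by rewrite !gt_eqF.
have [x0 x1] := andP (resolvent_at1_itv x); have [y0 y1] := andP (resolvent_at1_itv y).
rewrite normrM mul1r -[leRHS]mulr1; apply: ler_pM => //.
  have h1 := ler_norm (x - y); have h2 := ler_norm (y - x); rewrite distrC in h2.
  rewrite ler_norml /Order.max; apply/andP.
  by case: ltP => ?; case: ltP => ?; split; lra.
by rewrite ger0_norm ?mulr_ge0 // mulr_ile1.
Qed.

Lemma resolvent_at1_le x y : x <= y -> resolvent_at1 y <= resolvent_at1 x.
Proof.
move=> xy; rewrite /resolvent_at1 lef_pV2 ?posrE // lerD2l.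
by rewrite ge_max !le_max xy lexx !orbT.
Qed.

Lemma resolvent_at1_lt x y : 0 <= x -> x < y -> resolvent_at1 y < resolvent_at1 x.
Proof.
move=> x0 xy; rewrite !resolvent_at1E //; last by apply: le_trans (ltW xy).
by rewrite ltf_pV2 ?posrE ?ltrD2l // ltr_wpDr // (le_trans x0) // ltW.
Qed.

Lemma measurable_resolvent_at1 : measurable_fun (setT : set TR) resolvent_at1.
Proof. exact: (lipschitz_measurable ltr01 resolvent_at1_lip). Qed.

Variables (mu : probability TR R) (n_ : nat -> nat).
Variable lam : forall N, 'I_(n_ N) -> R.
Hypothesis mu_neg : forall x, x < 0 -> distribution_function mu x = 0.
Hypothesis lam_ge0 : forall N j, 0 <= @lam N j.
Hypothesis n_gt0 : \forall N \near \oo, (0 < n_ N)%N.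
Hypothesis cvg_resolvents : forall k : nat,
  (\sum_j (1 + @lam N j)^-1 ^+ k) / (n_ N)%:R @[N --> \oo] -->
  \int[mu]_(x in setT) (resolvent_at1 x ^+ k).

Let mean N (f : R -> R) : R := (\sum_j f (@lam N j)) / (n_ N)%:R.

(** A ramp from 1 at a down to 0 at b that is linear in [resolvent_at1 x] instead of x. It is thus a
    Lipschitz function of a variable in [0, 1], uniformly approximated by polynomials in
    [resolvent_at1], whose averages converge by hypothesis. *)
Let ramp (a b x : R) : R := clamp01 ((resolvent_at1 x - resolvent_at1 b) /
  (resolvent_at1 a - resolvent_at1 b)).

Let ramp1 a b x : 0 <= a -> a < b -> x <= a -> ramp a b x = 1.
Proof.
move=> a0 ab xa; apply: clamp01_eq1.
rewrite ler_pdivlMr ?subr_gt0 ?resolvent_at1_lt // mul1r lerD2r.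
exact: resolvent_at1_le.
Qed.

Let ramp0 a b x : 0 <= a -> a < b -> b <= x -> ramp a b x = 0.
Proof.
move=> a0 ab bx; apply: clamp01_eq0.
rewrite ler_pdivrMr ?subr_gt0 ?resolvent_at1_lt // mul0r subr_le0.
exact: resolvent_at1_le.
Qed.

Let measurable_ramp a b : measurable_fun (setT : set TR) (ramp a b).
Proof.
apply: (@measurable_clamp01 _ _ TR (fun x => (resolvent_at1 x - resolvent_at1 b) /
  (resolvent_at1 a - resolvent_at1 b))).
apply: measurable_funM => //; apply: measurable_funB => //.
exact: measurable_resolvent_at1.
Qed.

Let meanD_le N (f g : R -> R) : (forall x, 0 <= x -> f x <= g x) -> mean N f <= mean N g.
Proof.
move=> fg; rewrite /mean ler_wpM2r ?invr_ge0 //; apply: ler_sum => j _.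
exact/fg/lam_ge0.
Qed.

Let cvg_ramp a b : 0 <= a -> a < b ->
  mean N (ramp a b) @[N --> \oo] --> \int[mu]_(x in setT) ramp a b x.
Proof.
move=> a0 ab; apply/cvgrPdist_le => e e0.
have e30 : 0 < e / 3 by rewrite divr_gt0.
set c := resolvent_at1 a - resolvent_at1 b.
have c0 : 0 < c by rewrite subr_gt0 resolvent_at1_lt.
have cV0 : 0 < c^-1 by rewrite invr_gt0.
pose g (t : R) := clamp01 ((t - resolvent_at1 b) / c).
have [q qP] : exists q : {poly R}, forall x, 0 <= x <= 1 -> `|q.[x] - g x| <= e / 3.
  apply: (lipschitz_poly_approx cV0 e30) => x y _ _.
  apply: (le_trans (clamp01_lip _ _)).
  by rewrite -mulrBl normrM (gtr0_norm cV0) mulrC opprB addrA subrK.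
have intu k : mu.-integrable setT (EFin \o (fun x : TR => resolvent_at1 x ^+ k)).
  apply: (@bounded_integrable _ _ _ _ _ 1).
    by apply: measurable_funX; exact: measurable_resolvent_at1.
  move=> x; have /andP[u0 u1] := resolvent_at1_itv x.
  by rewrite normrX exprn_ile1 // ger0_norm.
have mq : mean N (fun x => q.[resolvent_at1 x]) @[N --> \oo] -->
    \int[mu]_(x in setT) q.[resolvent_at1 x].
  have [_ ->] := Rintegral_horner q intu.
  have -> : (fun N => mean N (fun x => q.[resolvent_at1 x])) = fun N =>
      \sum_(i < size q) q`_i * ((\sum_j (1 + @lam N j)^-1 ^+ i) / (n_ N)%:R).
    apply/funext => N; rewrite /mean.
    under eq_bigr do rewrite horner_coef.
    rewrite exchange_big /= mulr_suml; apply: eq_bigr => i _.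
    rewrite -mulr_sumr mulrA; congr (_ * _ * _); apply: eq_bigr => j _.
    by rewrite resolvent_at1E.
  apply: cvg_big => [|i _]; first exact: add_continuous.
  exact: cvgMr.
have iq : mu.-integrable setT (EFin \o (fun x : TR => q.[resolvent_at1 x])).
  exact: (Rintegral_horner q intu).1.
have ir : mu.-integrable setT (EFin \o (ramp a b : TR -> R)).
  by apply: (@bounded_integrable _ _ _ _ _ 1) => // x; exact: norm_clamp01_le1.
have close : `|\int[mu]_(x in setT) ramp a b x - \int[mu]_(x in setT) q.[resolvent_at1 x]| <= e / 3.
  rewrite -RintegralB //.
  have idf : mu.-integrable setT (EFin \o (fun x : TR => ramp a b x - q.[resolvent_at1 x])).
    exact: (integrableB _ ir iq).
  apply: (le_trans (le_normr_Rintegral _ idf)) => //.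
  have -> : e / 3 = \int[mu]_(x in (setT : set TR)) (e / 3).
    by rewrite Rintegral_cst // [X in fine X](probability_setT mu) mulr1.
  apply: le_Rintegral => //.
  - exact: (integrable_abse idf).
  - by apply: (@bounded_integrable _ _ _ _ _ (e / 3)) => // x; rewrite ger0_norm // ltW.
  - by move=> x _; rewrite distrC; apply: qP; exact: resolvent_at1_itv.
have /cvgrPdist_le/(_ _ e30) mq3 := mq.
near=> N.
have h2 : `|\int[mu]_(x in setT) q.[resolvent_at1 x] -
    mean N (fun x => q.[resolvent_at1 x])| <= e / 3 by near: N.
have nN : (0 < n_ N)%N by near: N.
have h3 : `|mean N (fun x => q.[resolvent_at1 x]) - mean N (ramp a b)| <= e / 3.
  rewrite /mean -mulrBl -sumrB normrM normfV normr_nat ler_pdivrMr ?ltr0n //.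
  apply: (le_trans (ler_norm_sum _ _ _)).
  apply: (@le_trans _ _ (\sum_(j < n_ N) (e / 3))).
    by apply: ler_sum => j _; apply: qP; exact: resolvent_at1_itv.
  by rewrite sumr_const card_ord mulr_natr.
move: close h2 h3; rewrite !ler_norml => /andP[? ?] /andP[? ?] /andP[? ?].
by apply/andP; split; lra.
Unshelve. all: by end_near. Qed.

Let edf N x : R := #|[pred j | @lam N j <= x]|%:R / (n_ N)%:R.

Let edfE N x : edf N x = mean N (fun y => (y <= x)%R%:R).
Proof.
rewrite /edf /mean; congr (_ / _).
rewrite -sum1_card natr_sum big_mkcond /=; apply: eq_bigr => j _.
by rewrite inE; case: ifP.
Qed.

Let edf_le N a b : 0 <= a -> a < b ->
  edf N a <= mean N (ramp a b) /\ mean N (ramp a b) <= edf N b.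
Proof.
move=> a0 ab; rewrite !edfE; split; apply: meanD_le => x x0.
  case: (leP x a) => xa; first by rewrite ramp1.
  exact: clamp01_ge0.
case: (leP x b) => xb; first exact: clamp01_le1.
by rewrite ramp0 // ltW.
Qed.

Let df_le a b : 0 <= a -> a < b ->
  distribution_function mu a <= \int[mu]_(x in setT) ramp a b x /\
  \int[mu]_(x in setT) ramp a b x <= distribution_function mu b.
Proof.
move=> a0 ab; split.
  apply: (@Rintegral_probability_ge _ _ _ mu (`]-oo, a]%classic : set TR)) => //.
  - by move=> x; exact: clamp01_itv.
  - by move=> x; rewrite /= in_itv /= => xa; exact: ramp1.
apply: (@Rintegral_probability_le _ _ _ mu (`]-oo, b]%classic : set TR)) => //.
- by move=> x; exact: clamp01_itv.
- move=> x; rewrite /= in_itv /= => /negP; rewrite -ltNge => bx.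
  by apply: ramp0 => //; exact: ltW.
Qed.

Let edf_neg N x : x < 0 -> edf N x = 0.
Proof.
move=> x0; rewrite /edf eq_card0 ?mul0r // => j.
by rewrite inE; apply/negP; rewrite leNgt (lt_le_trans x0).
Qed.

Lemma edf_cvg x : {for x, continuous (distribution_function mu)} ->
  #|[pred j | @lam N j <= x]|%:R / (n_ N)%:R @[N --> \oo] --> distribution_function mu x.
Proof.
move=> cF; change (edf N x @[N --> \oo] --> distribution_function mu x).
have [x0|x0] := ltP x 0.
  rewrite mu_neg //; have -> : edf^~ x = fun=> 0 by apply/funext => N; exact: edf_neg.
  exact: cvg_cst.
apply/cvgrPdist_le => e e0.
have e20 : 0 < e / 2 by rewrite divr_gt0.
have /cvgrPdist_le/(_ _ e20) := cF.
move=> /nbhs_ballP[dl /= dl0 dlP].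
pose b := x + dl / 2; pose a := x - dl / 2.
have bF : distribution_function mu b <= distribution_function mu x + e / 2.
  have := dlP b; rewrite /ball /= /b opprD addrA subrr add0r normrN.
  rewrite gtr0_norm ?divr_gt0 // => /(_ _).
  rewrite ler_norml => /(_ _)/andP[]; first by rewrite ltr_pdivrMr //; lra.
  lra.
have aF : distribution_function mu x - e / 2 <= distribution_function mu a.
  have := dlP a; rewrite /ball /= /a opprB addrC subrK.
  rewrite gtr0_norm ?divr_gt0 // => /(_ _).
  rewrite ler_norml => /(_ _)/andP[]; first by rewrite ltr_pdivrMr //; lra.
  lra.
have xb : x < b by rewrite ltrDl divr_gt0.
have ax : a < x by rewrite gtrBl divr_gt0.
have /cvgrPdist_le/(_ _ e20) up := cvg_ramp x0 xb.
(* Ramps need nonnegative endpoints. If a < 0, the distribution function vanishes at a and so is at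
   most e / 2 at x, and the lower estimate follows from 0 <= [edf N x]. *)
have [a0|a0] := ltP a 0.
  near=> N.
  have u : `|\int[mu]_(x0 in setT) ramp x b x0 - mean N (ramp x b)| <= e / 2 by near: N.
  have [h1 _] := edf_le N x0 xb; have [_ h2] := df_le x0 xb.
  have l0 : 0 <= edf N x by rewrite /edf divr_ge0.
  have aF0 := mu_neg a0.
  by move: u; rewrite !ler_norml => /andP[? ?]; apply/andP; split; lra.
have /cvgrPdist_le/(_ _ e20) lo := cvg_ramp a0 ax.
near=> N.
have u : `|\int[mu]_(x0 in setT) ramp x b x0 - mean N (ramp x b)| <= e / 2 by near: N.
have l : `|\int[mu]_(x0 in setT) ramp a x x0 - mean N (ramp a x)| <= e / 2 by near: N.
have [h1 _] := edf_le N x0 xb; have [_ h2] := df_le x0 xb.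
have [_ h3] := edf_le N a0 ax; have [h4 _] := df_le a0 ax.
by move: u l; rewrite !ler_norml => /andP[? ?] /andP[? ?]; apply/andP; split; lra.
Unshelve. all: by end_near. Qed.

End ResolventDistribution.

(** * The Fuss-Catalan law *)

Section Contour.
Variable R : realType.
Implicit Types a x t : R.

(* chebU n a is the Chebyshev polynomial of the second kind at cos a. *)
Fixpoint chebU n a : R :=
  if n is n'.+1 then cos a * chebU n' a + cos (n'.+1%:R * a) else 1.

Lemma chebU_sin n a : chebU n a * sin a = sin (n.+1%:R * a).
Proof.
elim: n => [|n IH]; first by rewrite /= !mul1r.
have -> : n.+2%:R * a = n.+1%:R * a + a by ring.
by rewrite sinD -IH /=; ring.
Qed.

Lemma chebU_cos n a : chebU n.+1 a * cos a = chebU n a + cos (n.+2%:R * a).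
Proof.
have s := chebU_sin n a; have cs := cos2Dsin2 a.
have -> : n.+2%:R * a = n.+1%:R * a + a by ring.
rewrite cosD -s /=.
transitivity (chebU n a * (cos a ^+ 2 + sin a ^+ 2) - chebU n a * sin a * sin a +
  cos (n.+1%:R * a) * cos a); first by ring.
by rewrite cs; ring.
Qed.

Section Staircase.
Variable s : nat.
Let r := s.+1.
Let A : R := pi / r.+1%:R.

Let A_gt0 : 0 < A. Proof. by rewrite divr_gt0 ?pi_gt0. Qed.

Let rA : r.+1%:R * A = pi.
Proof. by rewrite mulrCA divff ?mulr1. Qed.

Lemma chebU_gt0 a : 0 <= a <= A -> 0 < chebU s a.
Proof.
(* At a = 0 the quotient of sines degenerates, and positivity is read off the recursion. *)
move=> /andP[a0 aA]; have [->|an0] := eqVneq a 0.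
  elim: (s) => [|n IH] //=; by rewrite mulr0 cos0 mul1r addr_gt0.
have ap : 0 < a by rewrite lt_neqAle eq_sym an0.
have s1 : 0 < sin a.
  apply: sin_gt0_pi; rewrite ap /= (le_lt_trans aA) // /A ltr_pdivrMr //.
  by rewrite ltr_pMr ?pi_gt0 // ltr1n.
have s2 : 0 < sin (s.+1%:R * a).
  apply: sin_gt0_pi; rewrite mulr_gt0 //= -rA.
  apply: (@lt_le_trans _ _ (r.+1%:R * a)); first by rewrite ltr_pM2r // ltr_nat.
  by rewrite ler_pM2l.
by rewrite -(pmulr_lgt0 _ s1) chebU_sin.
Qed.

Lemma chebU_ge0 a : 0 <= a <= A -> 0 <= chebU r a.
Proof.
move=> a0A; have p := chebU_gt0 a0A.
have /andP[a0 aA] := a0A; have [->|an0] := eqVneq a 0.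
  elim: (r) => [|n IH] //=; by rewrite mulr0 cos0 mul1r addr_ge0.
have ap : 0 < a by rewrite lt_neqAle eq_sym an0.
have s1 : 0 < sin a.
  apply: sin_gt0_pi; rewrite ap /= (le_lt_trans aA) // /A ltr_pdivrMr //.
  by rewrite ltr_pMr ?pi_gt0 // ltr1n.
rewrite -(pmulr_lge0 _ s1) chebU_sin; apply: sin_ge0_pi.
by rewrite mulr_ge0 //= -rA ler_pM2l.
Qed.

(* The curve z = exp(i (r + 1) a) / U_(r-1)(a), with 1 + z =
   (U_r(a) / U_(r-1)(a)) exp(i a), on which (1 + z)^(r+1) / z is real. *)
Definition contour a : R := chebU r a ^+ r.+1 * (chebU s a)^-1 ^+ r.

Local Open Scope complex_scope.

Definition cis t : R[i] := cos t +i* sin t.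

Lemma cisD x y : cis (x + y) = cis x * cis y.
Proof. by rewrite /cis sinD cosD; simpc; congr (_ +i* _); ring. Qed.

Lemma cisX n x : cis x ^+ n = cis (n%:R * x).
Proof.
elim: n => [|n IH]; first by rewrite expr0 mul0r /cis cos0 sin0.
by rewrite exprS IH -cisD -natr1 mulrDl mul1r addrC.
Qed.

(** The binomial expansion of ((1 + z)^(r+1) / z)^k into powers z^(m - k), at the point z of the
    curve with parameter a. The right side is real, so the imaginary parts cancel; [contour_sin]
    records this. *)
Lemma contour_cis a k : 0 <= a <= A ->
  \sum_(m < (r.+1 * k).+1) ('C(r.+1 * k, m)%:R * chebU s a ^+ k * (chebU s a)^-1 ^+ m)%:C *
     cis ((m%:R - k%:R) * (r.+1%:R * a)) = (contour a ^+ k)%:C.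
Proof.
move=> a0A; have U0 := chebU_gt0 a0A.
set U := chebU s a in U0 *; set W := chebU r a; set th := r.+1%:R * a.
have e1 : 1 + (U^-1)%:C * cis th = (U^-1 * W)%:C * cis a.
  rewrite /cis /th; have e := chebU_cos s a; have e2 := chebU_sin r a.
  rewrite -/W -/U in e e2; simpc; rewrite -!mulrA e2 e.
  congr (_ +i* _); rewrite mulrDr mulVf ?gt_eqF //.
have e3 : (1 + (U^-1)%:C * cis th) ^+ (r.+1 * k) =
  \sum_(m < (r.+1 * k).+1) ('C(r.+1 * k, m)%:R * U^-1 ^+ m)%:C * cis (m%:R * th).
  rewrite exprDn; apply: eq_bigr => m _.
  rewrite expr1n mul1r exprMn cisX -mulr_natl mulrA rmorphM rmorphXn rmorph_nat //.
transitivity ((U ^+ k)%:C * cis (- k%:R * th) * (1 + (U^-1)%:C * cis th) ^+ (r.+1 * k)).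
  rewrite e3 mulr_sumr; apply: eq_bigr => m _.
  rewrite mulrBl -mulNr [_ + - _ * th]addrC cisD !rmorphM /=; ring.
rewrite e1 exprMn cisX -rmorphXn /= mulrACA -cisD -rmorphM.
have -> : - k%:R * th + (r.+1 * k)%:R * a = 0.
  by rewrite /th natrM; ring.
rewrite /cis cos0 sin0 -[X in _ * X]/(1%:C) mulr1; congr (_%:C).
have -> : contour a ^+ k = W ^+ (r.+1 * k) * U^-1 ^+ (r * k).
  by rewrite /contour -/U -/W [LHS]exprMn -!exprM.
rewrite [(U^-1 * W) ^+ _]exprMn mulrA [RHS]mulrC; congr (_ * _).
have -> : U^-1 ^+ (r.+1 * k) = U^-1 ^+ k * U^-1 ^+ (r * k) by rewrite -exprD.
rewrite mulrA -exprMn.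
by rewrite divff ?gt_eqF // expr1n mul1r.
Qed.

Lemma contour_cos a k : 0 <= a <= A ->
  contour a ^+ k = \sum_(m < (r.+1 * k).+1)
    'C(r.+1 * k, m)%:R * chebU s a ^+ k * (chebU s a)^-1 ^+ m *
     cos ((m%:R - k%:R) * (r.+1%:R * a)).
Proof.
move=> a0A; have /(congr1 (@complex.Re R)) := contour_cis k a0A.
rewrite (@raddf_sum _ _ (@complex.Re R)) /= => <-.
by apply: eq_bigr => m _; rewrite mul0r subr0.
Qed.

Lemma contour_sin a k : 0 <= a <= A ->
  0 = \sum_(m < (r.+1 * k).+1)
    'C(r.+1 * k, m)%:R * chebU s a ^+ k * (chebU s a)^-1 ^+ m *
     sin ((m%:R - k%:R) * (r.+1%:R * a)).
Proof.
move=> a0A; have /(congr1 (@complex.Im R)) := contour_cis k a0A.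
rewrite (@raddf_sum _ _ (@complex.Im R)) [RHS]/= => e; rewrite -[LHS]e.
by apply: eq_bigr => m _ /=; rewrite mul0r addr0.
Qed.

Local Close Scope complex_scope.

Lemma is_derive_mulr (f g : R -> R) x df dg :
  is_derive x 1 f df -> is_derive x 1 g dg ->
  is_derive x 1 (fun y => f y * g y) (df * g x + f x * dg).
Proof.
move=> hf hg; apply: (is_derive_eq (is_deriveM hf hg)).
by rewrite /GRing.scale /= addrC mulrC.
Qed.

Lemma is_derive_exp (f : R -> R) n x df :
  is_derive x 1 f df -> is_derive x 1 (fun y => f y ^+ n) (n%:R * f x ^+ n.-1 * df).
Proof.
move=> hf; have := is_deriveX n hf; rewrite /GRing.scale /=.
suff -> : (f ^+ n)%R = fun y => f y ^+ n by [].
by apply/funext => y; rewrite fctE.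
Qed.

Lemma is_derive_inv (f : R -> R) x df : f x != 0 ->
  is_derive x 1 f df -> is_derive x 1 (fun y => (f y)^-1) (- (f x)^-1 ^+ 2 * df).
Proof. by move=> f0 /(is_deriveV f0); rewrite /GRing.scale /= exprVn. Qed.

Lemma is_derive_lin (c x : R) : is_derive x 1 (fun y => c * y) c.
Proof.
have -> : (fun y => c * y) = c \*: (id : R -> R) by [].
by apply: is_derive_eq; rewrite /GRing.scale /= mulr1.
Qed.

Lemma is_derive_chebU n x : is_derive x 1 (chebU n) (derive1 (chebU n) x).
Proof.
suff [d dP] : exists d, is_derive x 1 (chebU n) d.
  by rewrite derive1E; apply: DeriveDef => //; case: dP.
elim: n => [|n [d dP]].
  by exists 0; have -> : chebU 0 = cst 1 by []; exact: is_derive_cst.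
exists ((- sin x * chebU n x + cos x * d) + - sin (n.+1%:R * x) * n.+1%:R).
have h1 := is_derive_mulr (is_derive_cos x) dP.
have h2 := is_derive1_comp (is_derive_cos (n.+1%:R * x)) (is_derive_lin n.+1%:R x).
exact: (is_deriveD h1 h2).
Qed.

(** The integral of z^(m - k) against dz / z is z^(m - k) / (m - k) for m != k. The primitive
    collects the imaginary parts of these, divided by r + 1; the term m = k yields the linear
    function of a. On the curve, dz / z = (i (r + 1) - U' / U) da with U = U_(r-1), and the radial
    part -U' / U multiplies a real function, so it drops out of the imaginary part: in the
    derivative it is killed by [contour_sin]. *)
Definition contour_primitive k a : R :=
  \sum_(m < (r.+1 * k).+1) (if m == k :> nat then 'C(r.+1 * k, k)%:R * a else
    'C(r.+1 * k, m)%:R * (chebU s a ^+ k * ((chebU s a)^-1 ^+ m *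
     sin ((m%:R - k%:R) * r.+1%:R * a))) / ((m%:R - k%:R) * r.+1%:R)).

Lemma is_derive_contour_primitive k a : 0 <= a <= A ->
  is_derive a 1 (contour_primitive k) (contour a ^+ k).
Proof.
move=> a0A; have U0 := chebU_gt0 a0A.
have dU := is_derive_chebU s a; set d := derive1 _ _ in dU.
set U := chebU s a in U0 *.
have Un0 : U != 0 by rewrite gt_eqF.
pose t (m : nat) := 'C(r.+1 * k, m)%:R * U ^+ k * U^-1 ^+ m.
have term (m : 'I_(r.+1 * k).+1) : is_derive a 1 (fun a =>
    if m == k :> nat then 'C(r.+1 * k, k)%:R * a else
    'C(r.+1 * k, m)%:R * (chebU s a ^+ k * ((chebU s a)^-1 ^+ m *
     sin ((m%:R - k%:R) * r.+1%:R * a))) / ((m%:R - k%:R) * r.+1%:R))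
   (t m * cos ((m%:R - k%:R) * (r.+1%:R * a)) -
    d / U / r.+1%:R * (t m * sin ((m%:R - k%:R) * (r.+1%:R * a)))).
  case: eqP => [mk|/eqP mk].
    rewrite mk subrr mul0r cos0 sin0 !mulr0 subr0 mulr1 /t.
    by rewrite -mulrA -exprMn divff // expr1n mulr1; exact: is_derive_lin.
  have mk0 : m%:R - k%:R != 0 :> R by rewrite subr_eq0 eqr_nat.
  set c := (m%:R - k%:R) * r.+1%:R.
  have c0 : c != 0 by rewrite mulf_neq0 // pnatr_eq0.
  have h := is_derive_mulr (is_derive_exp k dU) (is_derive_mulr
    (is_derive_exp m (is_derive_inv Un0 dU))
    (is_derive1_comp (is_derive_sin (c * a)) (is_derive_lin c a))).
  have h' := is_derive_mulr (is_derive_mulr (is_derive_cst ('C(r.+1 * k, m)%:R : R) a 1) h)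
    (is_derive_cst (c^-1) a 1).
  have ca : (m%:R - k%:R) * (r.+1%:R * a) = c * a by rewrite /c mulrA.
  apply: (is_derive_eq h'); rewrite ca /cst /= -/U mul0r add0r mulr0 addr0.
  have ek : k%:R * U ^+ k.-1 = k%:R * U ^+ k * U^-1.
    case: (k) => [|k']; first by rewrite !mul0r.
    by rewrite /= exprSr -!mulrA divff // mulr1.
  have em : m%:R * U^-1 ^+ m.-1 * (- U^-1 ^+ 2 * d) = - m%:R * U^-1 ^+ m * U^-1 * d.
    case: (nat_of_ord m) => [|m']; first by rewrite !(mul0r, oppr0).
    rewrite /= (exprS U^-1 m'); move: (U^-1 ^+ m') => w; ring.
  rewrite ek em /t; move: (sin (c * a)) (cos (c * a)) => S C; rewrite /c.
  have q0 : r.+1%:R != 0 :> R by rewrite pnatr_eq0.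
  move: (r.+1%:R : R) q0 => q q0; field.
  by rewrite Un0 mk0 q0.
have := is_derive_sum term.
have -> : \sum_(m < (r.+1 * k).+1) (fun a : R =>
    if m == k :> nat then 'C(r.+1 * k, k)%:R * a else
    'C(r.+1 * k, m)%:R * (chebU s a ^+ k * ((chebU s a)^-1 ^+ m *
     sin ((m%:R - k%:R) * r.+1%:R * a))) / ((m%:R - k%:R) * r.+1%:R)) =
   contour_primitive k.
  by apply/funext => x; rewrite fct_sumE.
by rewrite big_split /= -contour_cos // sumrN -mulr_sumr -contour_sin // mulr0 subr0.
Qed.

Lemma sin_natpi n : sin (n%:R * pi) = 0 :> R.
Proof.
elim: n => [|n IH]; first by rewrite mul0r sin0.
by rewrite -natr1 mulrDl mul1r sinDpi IH oppr0.
Qed.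

Lemma within_contour k : {within `[0%R, A], continuous (fun x => contour x ^+ k)}.
Proof.
apply: derivable_within_continuous => x; rewrite in_itv /= => x0A.
have Un0 : chebU s x != 0 by rewrite gt_eqF ?chebU_gt0.
have h := is_derive_exp k (is_derive_mulr (is_derive_exp r.+1 (is_derive_chebU r x))
  (is_derive_exp r (is_derive_inv Un0 (is_derive_chebU s x)))).
by case: h.
Qed.

(** At both endpoints (r + 1) a is a multiple of pi, so every sine in the primitive vanishes and
    only the linear term m = k remains. *)
Lemma integral_contour k :
  (\int[lebesgue_measure]_(x in `[0%R, A]) (contour x ^+ k)%:E =
   ('C(r.+1 * k, k)%:R * A)%:E)%E.
Proof.
have der x : 0 <= x <= A -> derivable (contour_primitive k) x 1.
  by move=> /(is_derive_contour_primitive k) [].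
have cont x : 0 <= x <= A -> {for x, continuous (contour_primitive k)}.
  by move=> /der d; apply: differentiable_continuous; apply/derivable1_diffP.
rewrite (@continuous_FTC2 _ _ (contour_primitive k)) //.
- rewrite -EFinB; congr EFin; rewrite /contour_primitive -sumrB.
  have kM : (k < (r.+1 * k).+1)%N by rewrite ltnS leq_pmull.
  rewrite (bigD1 (Ordinal kM)) //= eqxx mulr0 subr0 big1 ?addr0 // => m mk.
  have -> : (m == k :> nat) = false by apply: contraNF mk => /eqP mk; apply/eqP/val_inj.
  have -> : (m%:R - k%:R) * r.+1%:R * A = m%:R * pi - k%:R * pi.
    by rewrite -mulrA rA mulrBl.
  rewrite mulr0 sin0 sinB !sin_natpi !(mul0r, mulr0) subrr.
  by rewrite !(mulr0, mul0r) subrr.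
- exact: within_contour.
- split; first by move=> x /itvP xA; apply: der; rewrite !xA.
    by apply: cvg_at_right_filter; apply: cont; rewrite lexx ltW.
  by apply: cvg_at_left_filter; apply: cont; rewrite lexx ltW.
- move=> x /itvP xA; rewrite derive1E.
  have x0A : 0 <= x <= A by rewrite !xA.
  by have [_ ->] := is_derive_contour_primitive k x0A.
Qed.

Definition contour_mod : R -> R := contour \_ `[0%R, A].

Lemma contour_mod_ge0 x : 0 <= contour_mod x.
Proof.
rewrite /contour_mod patchE; case: ifPn => // /set_mem; rewrite /= in_itv /= => x0A.
rewrite mulr_ge0 // exprn_ge0 ?chebU_ge0 // invr_ge0.
by apply: ltW; apply: chebU_gt0.
Qed.

Lemma measurable_contour_mod : measurable_fun (setT : set (measurableTypeR R)) contour_mod.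
Proof.
apply/(measurable_restrictT _ _).1 => //.
apply: subspace_continuous_measurable_fun => //.
exact: (within_contour (k := 1)).
Qed.

Local Notation TR := (measurableTypeR R).

Let P1 : probability TR R := uniform_prob (@ltr01 R).
Let P2 : probability TR R := uniform_prob A_gt0.
Let P : probability (TR * TR)%type R := (P1 \x P2)%E.

(** The absolute value changes nothing on [0, 1] and makes the map nonnegative everywhere, as
    Tonelli and the support of the law require. *)
Let law_map (p : TR * TR) : TR := `|p.1| * contour_mod p.2.

Let measurable_law_map : measurable_fun setT law_map.
Proof.
apply: measurable_funM.
  by apply: measurableT_comp => //; exact: measurable_fst.
by apply: measurableT_comp; [exact: measurable_contour_mod | exact: measurable_snd].
Qed.

#[local] HB.instance Definition _ :=
  @isMeasurableFun.Build _ _ _ _ law_map measurable_law_map.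

Definition fuss_catalan_law : probability TR R :=
  distribution P (law_map : {RV P >-> TR}).

Lemma fuss_catalan_law_neg x : x < 0 -> distribution_function fuss_catalan_law x = 0.
Proof.
move=> x0; rewrite /distribution_function.
change (fine (P (law_map @^-1` `]-oo, x]%classic)) = 0).
rewrite (_ : _ @^-1` _ = set0) ?measure0 //.
apply/seteqP; split => // p /=; rewrite in_itv /= leNgt => /negP; apply.
by apply: (lt_le_trans x0); rewrite mulr_ge0 // contour_mod_ge0.
Qed.


Let integral_P1 k : (\int[P1]_x (`|x : R| ^+ k)%:E = (k.+1%:R^-1)%:E)%E.
Proof.
rewrite integral_uniform //; last first.
  by apply/measurable_EFinP; apply: measurable_funX; exact: normr_measurable.
rewrite subr0 invr1 mul1e.
rewrite (eq_integral (fun x : TR => ((x : R) ^+ k)%:E)); last first.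
  by move=> x /set_mem; rewrite /= in_itv /= => /andP[x0 _]; rewrite ger0_norm.
have d x : is_derive x 1 (fun y : R => k.+1%:R^-1 * y ^+ k.+1) (x ^+ k).
  have h := is_derive_mulr (is_derive_cst (k.+1%:R^-1 : R) x 1)
    (is_derive_exp k.+1 (is_derive_id x 1)).
  apply: (is_derive_eq h); rewrite /= mul0r add0r mulr1 mulrA mulVf ?mul1r //.
have c x : {for x, continuous (fun y : R => k.+1%:R^-1 * y ^+ k.+1)}.
  by apply: differentiable_continuous; apply/derivable1_diffP; case: (d x).
rewrite (@continuous_FTC2 _ _ (fun y : R => k.+1%:R^-1 * y ^+ k.+1)) //.
- by rewrite expr1n mulr1 expr0n mulr0 sube0.
- by apply: derivable_within_continuous => x _; apply: exprn_derivable.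
- split; first by move=> x _; case: (d x).
    by apply: cvg_at_right_filter; exact: c.
  by apply: cvg_at_left_filter; exact: c.
- by move=> x _; rewrite derive1E; case: (d x).
Qed.

Let measurable_modX k : measurable_fun (setT : set TR) (fun y => contour_mod y ^+ k).
Proof. by apply: measurable_funX; exact: measurable_contour_mod. Qed.

Let integral_P2 k : (\int[P2]_y (contour_mod y ^+ k)%:E = ('C(r.+1 * k, k)%:R)%:E)%E.
Proof.
rewrite integral_uniform //; last 2 first.
- exact/measurable_EFinP.
- by move=> x; rewrite lee_fin exprn_ge0 // contour_mod_ge0.
rewrite subr0 (eq_integral (fun x : TR => ((contour x : R) ^+ k)%:E)); last first.
  by move=> x xA; rewrite /contour_mod patchE xA.
by rewrite integral_contour -EFinM mulrCA mulVf ?mulr1 // gt_eqF.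
Qed.

Let integral_law_map k :
  (\int[P]_p ((law_map p : R) ^+ k)%:E = (fuss_catalan R r k)%:E)%E.
Proof.
rewrite /P fubini_tonelli1 //; last 2 first.
- by apply/measurable_EFinP; apply: measurable_funX; exact: measurable_law_map.
- by move=> p; rewrite lee_fin exprn_ge0 // mulr_ge0 // contour_mod_ge0.
rewrite /fubini_F.
rewrite (eq_integral (fun x : TR => (`|x : R| ^+ k)%:E * ('C(r.+1 * k, k)%:R)%:E)%E).
  rewrite ge0_integralZr //; last first.
    by apply/measurable_EFinP; apply: measurable_funX; exact: normr_measurable.
  by rewrite integral_P1 -EFinM.
move=> x _; rewrite -integral_P2 -ge0_integralZl //; last 2 first.
- exact/measurable_EFinP.
- by move=> y _; rewrite lee_fin exprn_ge0 // contour_mod_ge0.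
by apply: eq_integral => y _; rewrite -EFinM /law_map /= exprMn.
Qed.

Lemma fuss_catalan_law_moments : fuss_catalan_moments r fuss_catalan_law.
Proof.
move=> k.
have mX : measurable_fun (setT : set TR) (fun x : TR => ((x : R) ^+ k)%:E).
  by apply/measurable_EFinP; apply: measurable_funX.
have nn p : 0 <= (law_map p : R) ^+ k.
  by rewrite exprn_ge0 // mulr_ge0 // contour_mod_ge0.
have intP : P.-integrable setT (fun p => ((law_map p : R) ^+ k)%:E).
  apply/integrableP; split.
    by apply/measurable_EFinP; apply: measurable_funX; exact: measurable_law_map.
  under eq_integral do rewrite gee0_abs ?lee_fin //.
  by rewrite integral_law_map ltry.
split.
  apply/integrableP; split => //.
  rewrite (@ge0_integral_distribution _ _ _ _ _ P (law_map : {RV P >-> TR})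
    (fun x => `|((x : R) ^+ k)%:E|%E)) //; last exact: measurableT_comp.
  by have /integrableP[] := intP.
rewrite -integral_law_map.
exact: (@integral_distribution _ _ _ _ _ P (law_map : {RV P >-> TR})).
Qed.

End Staircase.
End Contour.

Lemma nth_dilation N lam i : (0 < N)%N ->
  nth 0%N (dilation N lam) i = (N * nth 0 lam (i %/ N))%N.
Proof.
move=> N0; rewrite /dilation; elim: lam i => [|l lam IH] i /=.
  by rewrite !nth_nil muln0.
rewrite nth_cat size_nseq nth_nseq; case: ltnP => iN.
  by rewrite divn_small.
rewrite IH; have [j ->] : exists j, i = (j + N)%N by exists (i - N)%N; rewrite subnK.
by rewrite addnK divnDr // divnn N0 addn1.
Qed.

Lemma nth_staircase r i : nth 0%N (staircase r) i = (r - i)%N.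
Proof.
rewrite /staircase; have [ir|ri] := ltnP i r.
  rewrite nth_rev size_iota // nth_iota; last by rewrite -subSn // subSS leq_subr.
  by rewrite add1n -subSn // subSS.
rewrite nth_default ?size_rev ?size_iota //; apply/esym/eqP; by rewrite subn_eq0.
Qed.

Lemma in_staircase r N i j : (0 < N)%N ->
  in_shape (dilation N (staircase r)) i j = (i %/ N + j %/ N < r)%N.
Proof.
move=> N0; rewrite /in_shape nth_dilation // nth_staircase.
by rewrite mulnC -ltn_divLR // ltn_subRL.
Qed.

(** The factor r cancels against the rN of the empirical mean. *)
Lemma sum_raney_fuss_catalan (R : realType) r k : (0 < r)%N ->
  (\sum_(p < r) raney r k p.+1)%:R = r%:R * fuss_catalan R r k.
Proof.
move=> r0; have := sum_raney r k; move: (\sum_(p < r) _)%N => S e.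
rewrite /fuss_catalan; apply: (@mulfI _ (k.+1%:R)); first by rewrite pnatr_eq0.
rewrite -natrM e natrM mulrCA; congr (_ * _).
by rewrite mulrA divff ?mul1r // pnatr_eq0.
Qed.

Lemma bin_le_exp2 n k : ('C(n, k) <= 2 ^ n)%N.
Proof.
elim: n k => [|n IH] [|k] //.
  by rewrite bin0 expn_gt0.
by rewrite binS expnS mul2n -addnn leq_add.
Qed.

Lemma fuss_catalan_ge0 (R : realType) r k : 0 <= fuss_catalan R r k.
Proof. by rewrite /fuss_catalan mulr_ge0. Qed.

Lemma fuss_catalan_le (R : realType) r k :
  `|fuss_catalan R r k| <= (2 ^+ r.+1) ^+ k.
Proof.
rewrite ger0_norm ?fuss_catalan_ge0 // /fuss_catalan.
apply: (@le_trans _ _ 'C((r.+1 * k)%N, k)%:R).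
  by rewrite -[leRHS]mul1r ler_wpM2r // invf_le1 // ler1n.
by rewrite -exprM -natrX ler_nat bin_le_exp2.
Qed.

(** * Deterministic reduction *)

Section Deterministic.
Variables (R : realType) (s : nat).
Let r := s.+1.
Local Notation C := (R[i]).
Implicit Types A B : nat -> nat -> C.

Definition sqmod (z : C) : R := complex.Re z ^+ 2 + complex.Im z ^+ 2.

Lemma sqmodE (z : C) : (sqmod z)%:C%C = `|z| ^+ 2.
Proof. exact: add_Re2_Im2. Qed.

Lemma sqmod_ge0 z : 0 <= sqmod z.
Proof. by rewrite addr_ge0 ?sqr_ge0. Qed.

Definition stairX N A : 'M[C]_(r * N) := shaped_mx (dilation N (staircase r)) (r * N) A.

Lemma staircase_gramE N A : staircase_gram r N A = gram N%:R^-1 (stairX N A).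
Proof. by []. Qed.

Let NV_ge0 N : (0 : C) <= N%:R^-1.
Proof. by rewrite invr_ge0. Qed.

Definition stair_eig N A (j : 'I_(r * N)) : R :=
  complex.Re (spectral_diag (staircase_gram r N A) 0 j).

Lemma stair_eigE N A j :
  spectral_diag (staircase_gram r N A) 0 j = (stair_eig A j)%:C%C.
Proof.
by rewrite /stair_eig RRe_real // ger0_real // staircase_gramE gram_spectral_ge0.
Qed.

Lemma stair_eig_ge0 N A (j : 'I_(r * N)) : 0 <= stair_eig A j.
Proof.
by rewrite -ler0c -stair_eigE staircase_gramE gram_spectral_ge0.
Qed.

Lemma empirical_dfE N A x : empirical_df (staircase_gram r N A) x =
  #|[pred j | @stair_eig N A j <= x]|%:R / (r * N)%:R.
Proof.
rewrite /empirical_df; congr (_%:R / _); apply: eq_card => j.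
by rewrite !inE stair_eigE lecR.
Qed.

Lemma trace_staircase_gram N A k :
  \tr (staircase_gram r N A ^+ k) = (\sum_j @stair_eig N A j ^+ k)%:C%C.
Proof.
rewrite staircase_gramE trace_gramX // rmorph_sum; apply: eq_bigr => j _.
by rewrite -staircase_gramE stair_eigE rmorphXn.
Qed.

Definition box_sum N (f : nat -> nat -> R) : R := \sum_(i < r * N) \sum_(j < r * N) f i j.

Lemma frob_stairX_le N A : frob (stairX N A) <= (box_sum N (fun i j => sqmod (A i j)))%:C%C.
Proof.
rewrite /box_sum rmorph_sum; apply: ler_sum => i _.
rewrite rmorph_sum; apply: ler_sum => j _; rewrite mxE /= sqmodE.
by case: ifP => // _; rewrite normr0 expr0n exprn_ge0.
Qed.

Lemma stairXB N A B : stairX N A - stairX N B = stairX N (fun i j => A i j - B i j).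
Proof.
by apply/matrixP => i j; rewrite !mxE; case: ifP => // _; rewrite subr0.
Qed.

Definition stair_res N A k : R := \sum_j (1 + @stair_eig N A j)^-1 ^+ k.

Lemma resolvent_sumE N A k :
  resolvent_sum (gram N%:R^-1 (stairX N A)) k = (stair_res N A k)%:C%C.
Proof.
rewrite rmorph_sum; apply: eq_bigr => j _.
by rewrite -staircase_gramE stair_eigE rmorphXn fmorphV rmorphD rmorph1.
Qed.

Lemma normCB_real (a b : R) : `|a%:C%C - b%:C%C : C| = `|a - b|%:C%C.
Proof.
have -> : a%:C%C - b%:C%C = (a - b)%:C%C :> C by rewrite rmorphB.
by rewrite normc_def /= expr0n addr0 sqrtr_sqr.
Qed.

Lemma stair_perturbation N A B (t : R) k : 0 < t ->
  `|stair_res N A k - stair_res N B k| <=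
  k%:R * (N%:R^-1 * 2^-1 * (2 * t^-1 * box_sum N (fun i j => sqmod (A i j - B i j)) +
     t * (box_sum N (fun i j => sqmod (A i j)) + box_sum N (fun i j => sqmod (B i j))))).
Proof.
move=> t0; rewrite -lecR -normCB_real.
rewrite -(resolvent_sumE N A k) -(resolvent_sumE N B k).
have tC : 0 < t%:C%C :> C by rewrite ltcR.
apply: (le_trans (resolvent_trace_perturbation (NV_ge0 N) (stairX N A) (stairX N B) k tC)).
rewrite !(rmorphM, rmorphD) /= !fmorphV !rmorph_nat.
rewrite ler_wpM2l // ler_wpM2l ?mulr_ge0 ?invr_ge0 //.
have t0C : 0 <= t%:C%C :> C by rewrite ler0c ltW.
apply: lerD; first by rewrite stairXB ler_wpM2l ?frob_stairX_le // mulr_ge0 ?invr_ge0.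
by rewrite ler_wpM2l // lerD // frob_stairX_le.
Qed.

Lemma box_sumD_le N A B : box_sum N (fun i j => sqmod (B i j)) <=
  2 * box_sum N (fun i j => sqmod (A i j)) + 2 * box_sum N (fun i j => sqmod (A i j - B i j)).
Proof.
rewrite /box_sum !mulr_sumr -big_split; apply: ler_sum => i _.
rewrite !mulr_sumr -big_split; apply: ler_sum => j _ /=.
rewrite /sqmod; case: (A i j) (B i j) => [a b] [c d] /=.
have := sqr_ge0 (2 * a - c); have := sqr_ge0 (2 * b - d); nra.
Qed.

(** The constant [k.+1], instead of k, stays positive for k = 0, as [moment_mean_cvg] demands. *)
Lemma resolvent_at1X_lip k (x y : R) :
  `|resolvent_at1 x ^+ k - resolvent_at1 y ^+ k| <= k.+1%:R * `|x - y|.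
Proof.
apply: (@le_trans _ _ (k%:R * `|x - y|)); last by rewrite ler_wpM2r // ler_nat.
elim: k => [|k IH]; first by rewrite subrr normr0 mul0r.
have /andP[x0 x1] := resolvent_at1_itv x; have /andP[y0 y1] := resolvent_at1_itv y.
have -> : resolvent_at1 x ^+ k.+1 - resolvent_at1 y ^+ k.+1 =
  resolvent_at1 x * (resolvent_at1 x ^+ k - resolvent_at1 y ^+ k) +
  (resolvent_at1 x - resolvent_at1 y) * resolvent_at1 y ^+ k.
  by rewrite !exprS; ring.
rewrite -natr1 [leRHS]mulrDl mul1r; apply: (le_trans (ler_normD _ _)); apply: lerD.
  by rewrite normrM; apply: le_trans IH; rewrite -[leRHS]mul1r ler_wpM2r // ger0_norm.
rewrite normrM -[leRHS]mulr1; apply: ler_pM => //.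
  by apply: (le_trans (resolvent_at1_lip _ _)); rewrite mul1r.
by rewrite ger0_norm ?exprn_ge0 // exprn_ile1.
Qed.

Variable mu : probability (measurableTypeR R) R.
Hypothesis mu_mom : fuss_catalan_moments r mu.
Hypothesis mu_neg : forall x, x < 0 -> distribution_function mu x = 0.

Lemma resolvent_cvg_of_moments A :
  (forall k, (\sum_j @stair_eig N A j ^+ k) / (r * N)%:R @[N --> \oo] --> fuss_catalan R r k) ->
  forall k, stair_res N A k / (r * N)%:R @[N --> \oo] -->
    \int[mu]_(x in setT) (resolvent_at1 x ^+ k).
Proof.
move=> mom k.
have hB x : `|resolvent_at1 x ^+ k| <= 1 :> R.
  have /andP[x0 x1] := resolvent_at1_itv x.
  by rewrite ger0_norm ?exprn_ge0 // exprn_ile1.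
have L0 : 0 < k.+1%:R :> R by rewrite ltr0n.
have C0 : 0 <= 2 ^+ r.+1 :> R by rewrite exprn_ge0.
apply: (moment_mean_cvg L0 C0 (fuss_catalan_le R r) (resolvent_at1X_lip k) hB _ _ mom).
  apply: (prob_moment_mean (fun k => (mu_mom k).1) (fun k => (mu_mom k).2) _ hB).
  by apply: measurable_funX; exact: measurable_resolvent_at1.
(* For N >= 1 the average over the eigenvalues is the positive functional with the given moments;
   the bound is summed eigenvalue by eigenvalue. *)
exists 1%N => // N /= N1 q a b l hq.
have n0 : (0 : R) < (r * N)%:R by rewrite ltr0n muln_gt0.
have -> : poly_moment (fun k => (\sum_j @stair_eig N A j ^+ k) / (r * N)%:R) q =
    (\sum_j q.[@stair_eig N A j]) / (r * N)%:R.
  under [in RHS]eq_bigr do rewrite horner_coef.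
  rewrite exchange_big /= mulr_suml; apply: eq_bigr => i _.
  by rewrite -mulr_sumr mulrA.
rewrite -mulrBl -sumrB normrM normfV (gtr0_norm n0) ler_pdivrMr //.
apply: (le_trans (ler_norm_sum _ _ _)).
have -> : (a * ((\sum_j @stair_eig N A j ^+ 0) / (r * N)%:R) +
  b * ((\sum_j @stair_eig N A j ^+ l.*2) / (r * N)%:R)) * (r * N)%:R =
  \sum_j (a * @stair_eig N A j ^+ 0 + b * @stair_eig N A j ^+ l.*2).
  by rewrite big_split /= -!mulr_sumr mulrDl -!mulrA mulVf ?lt0r_neq0 // !mulr1.
apply: ler_sum => j _; rewrite expr0 mulr1.
by have := hq (stair_eig A j); rewrite resolvent_at1E ?stair_eig_ge0.
Qed.

(** The choices are made in the order t, m, N. The weight t makes the term with the bounded box sums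
    small, m then makes t^-1 times the approximation error small, and N is taken large for this
    fixed m. *)
Lemma staircase_cvg_in_distribution A (Y : nat -> nat -> nat -> C) (K : R) (dl : nat -> R) :
  0 <= K -> dl m @[m --> \oo] --> 0 ->
  (\forall N \near \oo, box_sum N (fun i j => sqmod (A i j)) <= K * N%:R ^+ 2) ->
  (forall m, \forall N \near \oo,
     box_sum N (fun i j => sqmod (A i j - Y m i j)) <= dl m * N%:R ^+ 2) ->
  (forall m k, (\sum_j @stair_eig N (Y m) j ^+ k) / (r * N)%:R @[N --> \oo] -->
     fuss_catalan R r k) ->
  cvg_in_distribution (fun N => empirical_df (staircase_gram r N A))
    (distribution_function mu).
Proof.
move=> K0 dl0 bA bY mom x cF.
under eq_fun do rewrite empirical_dfE.
apply: (@edf_cvg R mu (fun N => (r * N)%N) (fun N => @stair_eig N A)) => //.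
- by move=> N j; exact: stair_eig_ge0.
- by exists 1%N => // N /=; rewrite muln_gt0.
move=> k; apply/cvgrPdist_le => e e0.
(* With dl m <= 1, the box sums of A and of Y m are at most K N^2 and (2K + 2) N^2, hence at most
   (3K + 3) N^2 together. The successor of k avoids a division by 0. *)
pose t : R := e / 4 / (k.+1%:R * (3 * K + 3)).
have den0 : 0 < k.+1%:R * (3 * K + 3) :> R by rewrite mulr_gt0 // ltr_wpDl // mulr_ge0.
have t0 : 0 < t by rewrite !divr_gt0.
have tE : k.+1%:R * (t * (3 * K + 3)) = e / 4.
  by rewrite mulrCA /t divfK // lt0r_neq0.
have q0 : 0 < e / 4 * t / k.+1%:R by rewrite !divr_gt0 // mulr_gt0 // divr_gt0.
have [m [dm1 dm2]] : exists m, dl m <= 1 /\ dl m <= e / 4 * t / k.+1%:R.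
  have /cvgrPdist_le/(_ _ ltr01)[n1 _ h1] := dl0.
  have /cvgrPdist_le/(_ _ q0)[n2 _ h2] := dl0.
  exists (maxn n1 n2); split.
    have := h1 (maxn n1 n2) (leq_maxl _ _); rewrite /= sub0r normrN.
    exact/le_trans/ler_norm.
  have := h2 (maxn n1 n2) (leq_maxr _ _); rewrite /= sub0r normrN.
  exact/le_trans/ler_norm.
have e20 : 0 < e / 2 by rewrite divr_gt0.
have /cvgrPdist_le/(_ _ e20) cY := resolvent_cvg_of_moments (k := k) (mom m).
near=> N.
have hY : `|\int[mu]_(x0 in setT) (resolvent_at1 x0 ^+ k) -
   stair_res N (Y m) k / (r * N)%:R| <= e / 2 by near: N.
have N0 : (0 < N)%N by near: N; exists 1%N.
have h1 : box_sum N (fun i j => sqmod (A i j)) <= K * N%:R ^+ 2 by near: N.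
have h2 : box_sum N (fun i j => sqmod (A i j - Y m i j)) <= dl m * N%:R ^+ 2.
  by near: N; exact: bY.
have h3 := box_sumD_le N A (Y m).
have p := @stair_perturbation N A (Y m) t k t0.
have NR0 : (0 : R) < N%:R by rewrite ltr0n.
have rN0 : (0 : R) < (r * N)%:R by rewrite ltr0n muln_gt0.
have p' : `|stair_res N A k / (r * N)%:R -
   stair_res N (Y m) k / (r * N)%:R| <= e / 2.
  rewrite -mulrBl normrM normfV (gtr0_norm rN0) ler_pdivrMr //.
  apply: (le_trans p).
  set a := box_sum _ _ in h1 h3 *; set b := box_sum _ _ in h2 h3 *.
  set c := box_sum _ _ in h3 *.
  have N20 : 0 <= N%:R ^+ 2 :> R by rewrite exprn_ge0.
  have dN : dl m * N%:R ^+ 2 <= N%:R ^+ 2 by rewrite -[leRHS]mul1r ler_wpM2r.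
  have hac : a + c <= (3 * K + 2) * N%:R ^+ 2 by lra.
  apply: (@le_trans _ _ (k.+1%:R * (N%:R^-1 * 2^-1 *
     (2 * t^-1 * (e / 4 * t / k.+1%:R * N%:R ^+ 2) + t * ((3 * K + 3) * N%:R ^+ 2))))).
    have i0 : 0 <= N%:R^-1 * 2^-1 :> R by rewrite mulr_ge0 ?invr_ge0.
    have tV0 : 0 <= 2 * t^-1 by rewrite mulr_ge0 // invr_ge0 ltW.
    have b0 : 0 <= b by do 2!apply: sumr_ge0 => ? _; exact: sqmod_ge0.
    have a0 : 0 <= a by do 2!apply: sumr_ge0 => ? _; exact: sqmod_ge0.
    have c0 : 0 <= c by do 2!apply: sumr_ge0 => ? _; exact: sqmod_ge0.
    apply: ler_pM => //; last 2 first.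
    - by rewrite ler_nat.
    - apply: ler_wpM2l => //; apply: lerD; apply: ler_wpM2l => //; try exact: ltW.
        by apply: (le_trans h2); rewrite ler_wpM2r.
      apply: (le_trans hac); rewrite ler_wpM2r //; lra.
    by rewrite mulr_ge0 // addr_ge0 // mulr_ge0 ?addr_ge0 // ltW.
  have -> : k.+1%:R * (N%:R^-1 * 2^-1 *
     (2 * t^-1 * (e / 4 * t / k.+1%:R * N%:R ^+ 2) + t * ((3 * K + 3) * N%:R ^+ 2))) =
     N%:R * (e / 4 + 2^-1 * (k.+1%:R * (t * (3 * K + 3)))).
    by field; rewrite !lt0r_neq0.
  rewrite tE natrM; have r1 : 1 <= r%:R :> R by rewrite ler1n.
  have : N%:R * e <= N%:R * (e * r%:R) by rewrite ler_pM2l // ler_peMr // ltW.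
  have : 0 <= N%:R * e by rewrite mulr_ge0 // ltW.
  lra.
apply: (le_trans (ler_distD (stair_res N (Y m) k / (r * N)%:R) _ _)).
rewrite [leRHS](splitr e); apply: lerD; first exact: hY.
by rewrite distrC; exact: p'.
Unshelve. all: by end_near. Qed.

End Deterministic.

(** * Almost sure convergence *)

Section BorelCantelli.
Context d (T : measurableType d) (R : realType) (P : probability T R).

Lemma nneseries_le (u : nat -> \bar R) (c : R) : (forall n, 0 <= u n)%E ->
  (forall K, \sum_(0 <= n < K) u n <= c%:E)%E -> (\sum_(n <oo) u n <= c%:E)%E.
Proof.
move=> u0 uc; apply: lime_le; first by apply: is_cvg_nneseries => n _ _; exact: u0.
by apply: nearW.
Qed.

Lemma borel_cantelli_ae (E : nat -> set T) (c : R) :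
  (forall n, measurable (E n)) -> (forall K, \sum_(0 <= n < K) P (E n) <= c%:E)%E ->
  {ae P, forall w, \forall n \near \oo, ~ E n w}.
Proof.
move=> mE sc; exists (lim_sup_set E); split.
- by apply: bigcap_measurable => // k _; apply: bigcup_measurable.
- apply: lim_sup_set_cvg0 => //.
  by apply: (le_lt_trans (nneseries_le _ sc)) => //; rewrite ltry.
move=> w nE n _ /=; apply: contrapT => h; apply: nE; exists n => // k /= nk Ek.
by apply: h; exists k.
Qed.

End BorelCantelli.

(** * Finitely valued functions of the entries *)

Section Labels.
Context d (T : measurableType d) (R : realType) (P : probability T R).
Variable X : nat -> nat -> {RV P >-> R[i]}.
Hypothesis X_indep : independent P (fun ij : nat * nat => X ij.1 ij.2).
Hypothesis X_iid : identically_distributed P (fun ij : nat * nat => X ij.1 ij.2).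

Lemma same_law i j (A : set R[i]) : measurable A ->
  P (X i j @^-1` A) = P (X 0%N 0%N @^-1` A).
Proof. by move=> mA; exact: (X_iid (i, j) (0, 0)%N mA). Qed.

Variables (U : finType) (lab : R[i] -> U).
Hypothesis mlab : forall u, measurable (lab @^-1` [set u]).

Definition label_prob (u : U) : R := fine (P (X 0%N 0%N @^-1` (lab @^-1` [set u]))).

Lemma label_prob_ge0 u : 0 <= label_prob u.
Proof. by rewrite fine_ge0. Qed.

Definition labels n (w : T) : {ffun 'I_n * 'I_n -> U} :=
  [ffun c : 'I_n * 'I_n => lab (X c.1 c.2 w)].

Lemma labels_eq_measurable n (l : {ffun 'I_n * 'I_n -> U}) :
  measurable [set w | labels n w = l].
Proof.
have -> : [set w | labels n w = l] =
  \bigcap_(c in [set: 'I_n * 'I_n]) (X c.1 c.2 @^-1` (lab @^-1` [set l c])).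
  apply/seteqP; split => w /=; first by move=> <- c _; rewrite /= ffunE.
  by move=> h; apply/ffunP => c; rewrite ffunE; exact: h.
apply: fin_bigcap_measurable => // c _.
by rewrite -[X in measurable X]setTI; exact: measurable_funP.
Qed.

Lemma labels_eq_prob n (l : {ffun 'I_n * 'I_n -> U}) :
  P [set w | labels n w = l] = (\prod_c label_prob (l c))%:E.
Proof.
pose e (c : 'I_n * 'I_n) : nat * nat := (nat_of_ord c.1, nat_of_ord c.2).
have e_inj : injective e by move=> [a b] [a' b'] [] /val_inj /= -> /val_inj /= ->.
pose J : {fset nat * nat} := seq_fset tt (map e (enum {: 'I_n * 'I_n})).
(* Independence is indexed by pairs of naturals; quantifying over the preimages of ij avoids an
   inverse of e. *)
pose A (ij : nat * nat) := [set z | forall c, e c = ij -> lab z = l c].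
have Ae c : A (e c) = lab @^-1` [set l c].
  by apply/seteqP; split => z /=; [apply | move=> zl c' /e_inj ->].
have mA ij : ij \in J -> measurable (A ij).
  by rewrite seq_fsetE => /mapP[c _ ->]; rewrite Ae.
have := X_indep mA.
have -> : \bigcap_(ij in [set` J]) (X ij.1 ij.2 @^-1` A ij) = [set w | labels n w = l].
  apply/seteqP; split => w /=.
    move=> h; apply/ffunP => c; rewrite ffunE.
    have := h (e c); rewrite /= seq_fsetE Ae; apply.
    by apply: map_f; rewrite mem_enum.
  by move=> wl ij _ c <-; rewrite -wl ffunE.
move=> ->; rewrite (perm_big _ (seq_fset_perm tt _)) /= undup_id; last first.
  by rewrite map_inj_uniq // enum_uniq.
rewrite big_map big_enum -prodEFin; apply: eq_big => // c _; rewrite Ae same_law //.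
by rewrite /label_prob fineK // fin_num_measure // -[X in measurable X]setTI;
  exact: measurable_funP.
Qed.

Lemma labels_event (n : nat) (B : pred {ffun 'I_n * 'I_n -> U}) :
  [set w | B (labels n w)] = \big[setU/set0]_(l | B l) [set w | labels n w = l].
Proof.
apply/seteqP; split => w.
  move=> Bw.
  by rewrite (bigD1 (labels n w)) //=; left.
elim/big_ind: _ => [//|A1 A2 h1 h2 [/h1|/h2] //|l Bl /= wl]; by rewrite wl.
Qed.

Lemma labels_event_measurable n (B : pred {ffun 'I_n * 'I_n -> U}) :
  measurable [set w | B (labels n w)].
Proof.
rewrite labels_event; apply: bigsetU_measurable => l _.
exact: labels_eq_measurable.
Qed.

Lemma labels_event_prob_le n (B : pred {ffun 'I_n * 'I_n -> U}) :
  (P [set w | B (labels n w)] <= (\sum_(l | B l) \prod_c label_prob (l c))%:E)%E.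
Proof.
rewrite labels_event -sumEFin.
suff : (measurable (\big[setU/set0]_(l | B l) [set w | labels n w = l]) /\
  P (\big[setU/set0]_(l | B l) [set w | labels n w = l]) <=
  \sum_(l | B l) (\prod_c label_prob (l c))%:E)%E by case.
elim/big_rec2: _ => [|l S y Bl [mS PS]]; first by rewrite measure0.
split; first by apply: measurableU => //; exact: labels_eq_measurable.
apply: (le_trans (measureU2 _ _ _)) => //; first exact: labels_eq_measurable.
by apply: leeD => //; rewrite -[X in (_ <= X)%E]labels_eq_prob.
Qed.

End Labels.

Section RintegralSum.
Context d (T : measurableType d) (R : realType) (P : probability T R).

Lemma Rintegral_sum (I : Type) (s : seq I) (f : I -> T -> R) :
  (forall i, P.-integrable setT (EFin \o f i)) ->
  P.-integrable setT (EFin \o (fun w => \sum_(i <- s) f i w)) /\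
  \int[P]_w (\sum_(i <- s) f i w) = \sum_(i <- s) \int[P]_w f i w.
Proof.
move=> fi; elim: s => [|i s [IH1 IH2]].
  have -> : (fun w => \sum_(i <- [::]) f i w) = cst 0.
    by apply/funext => w; rewrite big_nil.
  rewrite big_nil Rintegral_cst // mul0r; split => //.
  by apply: (@bounded_integrable _ _ _ _ (cst 0) 0) => // x; rewrite normr0.
have -> : (fun w => \sum_(j <- i :: s) f j w) = fun w => f i w + \sum_(j <- s) f j w.
  by apply/funext => w; rewrite big_cons.
split; first exact: (integrableD _ (fi i) IH1).
by rewrite RintegralD // IH2 big_cons.
Qed.
End RintegralSum.

Section LabelMoments.
Context d (T : measurableType d) (R : realType) (P : probability T R).
Variable X : nat -> nat -> {RV P >-> R[i]}.
Hypothesis X_indep : independent P (fun ij : nat * nat => X ij.1 ij.2).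
Hypothesis X_iid : identically_distributed P (fun ij : nat * nat => X ij.1 ij.2).
Variables (U : finType) (lab : R[i] -> U).
Hypothesis mlab : forall u, measurable (lab @^-1` [set u]).
Local Notation p := (label_prob X lab).

Lemma Rintegral_label (F : U -> R) :
  \int[P]_w F (lab (X 0%N 0%N w)) = \sum_u p u * F u.
Proof.
pose E u := X 0%N 0%N @^-1` (lab @^-1` [set u]).
have mE u : measurable (E u).
  by rewrite -[X in measurable X]setTI; exact: measurable_funP.
have -> : (fun w => F (lab (X 0%N 0%N w))) = fun w => \sum_u F u * \1_(E u) w.
  apply/funext => w; rewrite (bigD1 (lab (X 0%N 0%N w))) //= big1 ?addr0.
    by rewrite indicE mem_set ?mulr1.
  move=> u ul; rewrite indicE memNset ?mulr0 // => /= e.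
  by rewrite -e eqxx in ul.
have ii u : P.-integrable setT (EFin \o (\1_(E u) : T -> R)).
  apply: (@bounded_integrable _ _ _ _ _ 1) => // w.
  by rewrite indicE ger0_norm // lern1 leq_b1.
have [|_ ->] := @Rintegral_sum _ _ _ P U (index_enum U) (fun u w => F u * \1_(E u) w).
  by move=> u; exact: (integrableZl _ _ (ii u)).
apply: eq_bigr => u _; rewrite RintegralZl // mulrC; congr (_ * _).
exact: Rintegral_indic.
Qed.

Lemma sum_label_prob : \sum_u p u = 1.
Proof.
have := Rintegral_label (fun=> 1); rewrite Rintegral_cst // [X in fine X](probability_setT P).
by move=> /esym; rewrite mulr1; under eq_bigr do rewrite mulr1.
Qed.

Variables (val : U -> R[i]) (s : nat).
Let r := s.+1.
Hypothesis val_mean : \sum_u (p u)%:C%C * val u = 0.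
Hypothesis val_var : \sum_u (p u)%:C%C * (val u * (val u)^*) = 1.

Let K : R[i] := 1 + \sum_u `|val u|.

Let K_ge1 : 1 <= K. Proof. by rewrite /K lerDl sumr_ge0. Qed.

Let val_le u : `|val u| <= K.
Proof.
rewrite /K (bigD1 u) //= addrCA lerDl addr_ge0 // sumr_ge0 //.
Qed.

Let pC_ge0 u : (0 : R[i]) <= (p u)%:C%C.
Proof. by rewrite ler0c label_prob_ge0. Qed.

Let pC_sum1 : \sum_u (p u)%:C%C = 1 :> R[i].
Proof. by rewrite -(rmorph_sum (real_complex R)) sum_label_prob. Qed.

Let y w i j : R[i] := val (lab (X i j w)).

Lemma stair_mx_labels N w : (0 < N)%N ->
  stair_mx val (labels X lab (r * N) w) = stairX s N (y w).
Proof.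
move=> N0; apply/matrixP => i j; rewrite !mxE in_staircase //.
by case: ifP => // _; rewrite ffunE.
Qed.

(** The empirical moment as a function of the label configuration alone, so that its deviation
    probability is a finite sum of the kind bounded by [expect_trace_deviation]. *)
Let lmoment N k (l : {ffun 'I_(r * N) * 'I_(r * N) -> U}) : R :=
  complex.Re (\tr (gram N%:R^-1 (stair_mx val l) ^+ k)) / (r * N)%:R.

Let lmomentE N w k : (0 < N)%N ->
  (\sum_j @stair_eig R s N (y w) j ^+ k) / (r * N)%:R =
  lmoment k (labels X lab (r * N) w).
Proof.
by move=> N0; rewrite /lmoment stair_mx_labels // -staircase_gramE trace_staircase_gram.
Qed.

Local Open Scope sesquilinear_scope.

Let trace_lmoment N k (l : {ffun 'I_(r * N) * 'I_(r * N) -> U}) : (0 < N)%N ->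
  \tr ((stair_mx val l *m (stair_mx val l)^t*) ^+ k) =
  (N%:R ^+ k * ((r * N)%:R * lmoment k l))%:C%C.
Proof.
move=> N0; have n0 : N%:R != 0 :> R[i] by rewrite pnatr_eq0 -lt0n.
have rn0 : (r * N)%:R != 0 :> R by rewrite pnatr_eq0 -lt0n muln_gt0.
rewrite /lmoment [(r * N)%:R * _]mulrC divfK // rmorphM rmorphXn rmorph_nat /=.
rewrite trace_gramX ?invr_ge0 //.
have -> : (complex.Re (\sum_j spectral_diag (gram N%:R^-1 (stair_mx val l)) 0 j ^+ k))%:C%C =
   \sum_j spectral_diag (gram N%:R^-1 (stair_mx val l)) 0 j ^+ k.
  rewrite RRe_real // ger0_real // sumr_ge0 // => j _.
  by rewrite exprn_ge0 // gram_spectral_ge0 // invr_ge0.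
rewrite -trace_gramX ?invr_ge0 // /gram.
have scaleX (c : R[i]) (M : 'M[R[i]]_(r * N)) : (c *: M) ^+ k = c ^+ k *: M ^+ k.
  elim: k => [|k' IH]; first by rewrite !expr0 scale1r.
  by rewrite !exprS IH -[GRing.mul]/mulmx -scalemxAl -scalemxAr scalerA.
by rewrite scaleX mxtraceZ mulrA -exprMn mulfV // expr1n mul1r.
Qed.

Let bound k : R := complex.Re (deviation_bound K r k).

Let boundE k : deviation_bound K r k = (bound k)%:C%C.
Proof.
have K0 : 0 <= K := le_trans ler01 K_ge1.
rewrite /bound RRe_real // ger0_real // /deviation_bound addr_ge0 //.
  by rewrite mulr_ge0 // mulr_ge0 // exprn_ge0.
by rewrite exprn_ge0 // mulr_ge0 // addr_ge0 // exprn_ge0.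
Qed.

Let bound_ge0 k : 0 <= bound k.
Proof.
have K0 : 0 <= K := le_trans ler01 K_ge1.
rewrite -ler0c -boundE /deviation_bound addr_ge0 //.
  by rewrite mulr_ge0 // mulr_ge0 // exprn_ge0.
by rewrite exprn_ge0 // mulr_ge0 // addr_ge0 // exprn_ge0.
Qed.

Local Close Scope sesquilinear_scope.

(** Passing from traces to empirical moments of W_N divides the squared deviation by (N^k rN)^2;
    against the bound of order N^(2k) this leaves 1 / N^2, which is summable. *)
Let lmoment_deviation N k : (0 < N)%N ->
  \sum_(l : {ffun 'I_(r * N) * 'I_(r * N) -> U}) (\prod_c p (l c)) * (@lmoment N k l - fuss_catalan R r k) ^+ 2 <=
  bound k / N%:R ^+ 2.
Proof.
move=> N0; have rN0 : (0 < r * N)%N by rewrite muln_gt0.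
have NR0 : (0 : R) < N%:R by rewrite ltr0n.
set S := (X in X <= _).
have := expect_trace_deviation pC_ge0 pC_sum1 val_mean val_var K_ge1 val_le rN0 k.
have -> : expect (fun u => (p u)%:C%C) (fun l => (\tr ((stair_mx (r := r) (N := N) val l *m
    (stair_mx val l)^t*%sesqui) ^+ k) - (N ^ k.+1 * \sum_(q < r) raney r k q.+1)%:R) ^+ 2) =
  ((N%:R ^+ k * (r * N)%:R) ^+ 2 * S : R)%:C%C.
  apply/esym; rewrite /S mulr_sumr rmorph_sum /expect; apply: eq_bigr => l _ /=.
  have h2 (a b : R) : a%:C%C * b%:C%C ^+ 2 = (a * b ^+ 2)%:C%C by rewrite rmorphM rmorphXn.
  rewrite trace_lmoment // -(rmorph_nat (real_complex R)) -(rmorphB (real_complex R)).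
  rewrite -(rmorph_prod (real_complex R)) h2; congr (_%:C)%C.
  have -> : (N ^ k.+1 * \sum_(q < r) raney r k q.+1)%:R =
     N%:R ^+ k * (r * N)%:R * fuss_catalan R r k :> R.
    rewrite natrM sum_raney_fuss_catalan // natrX exprSr natrM; ring.
  by rewrite [N%:R ^+ k * (_ * _)]mulrA -mulrBr [in RHS]exprMn [RHS]mulrCA.
rewrite boundE -(rmorph_nat (real_complex R)) -rmorphM normc_def /= expr0n addr0.
rewrite sqrtr_sqr lecR => /(le_trans (ler_norm _)) h.
have S0 : 0 <= S.
  apply: sumr_ge0 => l _; rewrite mulr_ge0 ?sqr_ge0 // prodr_ge0 // => c _.
  exact: label_prob_ge0.
rewrite ler_pdivlMr ?exprn_gt0 // -(ler_pM2l (_ : 0 < (N%:R ^+ k) ^+ 2)); last first.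
  by rewrite !exprn_gt0.
have e : (N ^ k.*2)%:R = (N%:R ^+ k) ^+ 2 :> R by rewrite natrX -exprM muln2.
rewrite [leRHS]mulrC -e; apply: le_trans h.
have -> : (N%:R ^+ k * (r * N)%:R) ^+ 2 * S =
    (N%:R ^+ k) ^+ 2 * ((r * N)%:R ^+ 2 * S) by rewrite [in LHS]exprMn mulrA.
rewrite e ler_wpM2l ?sqr_ge0 // [leLHS]mulrC ler_wpM2r //.
rewrite lerXn2r ?nnegrE ?ler0n // natrM ler_peMl ?ler0n ?ler1n //.
Qed.

Let bad N k (e : R) : set T :=
  [set w | ((0 < N)%N && (e <= `|@lmoment N k (labels X lab (r * N) w) - fuss_catalan R r k|))].

Let bad_measurable N k e : measurable (bad N k e).
Proof.
have := (@labels_event_measurable _ _ _ _ X _ _ mlab (r * N) (fun l => (0 < N)%N &&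
  (e <= `|@lmoment N k l - fuss_catalan R r k|))).
by [].
Qed.

Let bad_prob N k (e : R) : 0 < e -> (P (bad N k e) <=
  (if (0 < N)%N then bound k / e ^+ 2 / N%:R ^+ 2 else 0)%:E)%E.
Proof.
move=> e0; apply: (le_trans (labels_event_prob_le X_indep X_iid mlab (fun l => (0 < N)%N &&
  (e <= `|@lmoment N k l - fuss_catalan R r k|)))).
rewrite lee_fin; case: posnP => [N0|N0]; first by rewrite big_pred0 // => l; rewrite N0.
rewrite -mulrA [_^-1 * _]mulrC mulrA ler_pdivlMr ?exprn_gt0 //.
apply: le_trans (lmoment_deviation k N0); rewrite mulr_suml [leRHS](bigID (fun l =>
  e <= `|@lmoment N k l - fuss_catalan R r k|)) /=.
rewrite -[leLHS]addr0; apply: lerD; last first.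
  apply: sumr_ge0 => l _; rewrite mulr_ge0 ?sqr_ge0 // prodr_ge0 // => c _.
  exact: label_prob_ge0.
apply: ler_sum => l el; rewrite ler_wpM2l //.
  by rewrite prodr_ge0 // => c _; exact: label_prob_ge0.
by rewrite -[leRHS]real_normK ?num_real // lerXn2r // nnegrE ltW.
Qed.

Let sum_inv_sq n : \sum_(0 <= N < n) (if (0 < N)%N then (N%:R ^+ 2)^-1 else 0) <= 2 :> R.
Proof.
(* Strengthened for the induction: the slack 1 / (m + 1) absorbs the next term. *)
suff h m : \sum_(0 <= N < m.+2) (if (0 < N)%N then (N%:R ^+ 2)^-1 else 0 : R) <= 2 - m.+1%:R^-1.
  case: n => [|[|m]]; first by rewrite big_geq.
    by rewrite big_nat1.
  by apply: (le_trans (h m)); rewrite gerBl invr_ge0.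
elim: m => [|m IH].
  rewrite big_nat_recr //= big_nat1 /= expr1n invr1; lra.
rewrite big_nat_recr //=; apply: (le_trans (lerD IH (lexx _))).
have a0 : (0 : R) < m.+1%:R by rewrite ltr0n.
rewrite -[m.+2%:R]natr1; move: (m.+1%:R) a0 => a a0.
rewrite -subr_ge0.
have -> : 2 - (a + 1)^-1 - (2 - a^-1 + ((a + 1) ^+ 2)^-1) = a^-1 * ((a + 1) ^+ 2)^-1.
  by field; rewrite !gt_eqF //; lra.
by rewrite mulr_ge0 // invr_ge0 ?exprn_ge0 //; lra.
Qed.

Lemma label_moment_cvg : {ae P, forall w, forall k,
  (\sum_j @stair_eig R s N (y w) j ^+ k) / (r * N)%:R @[N --> \oo] --> fuss_catalan R r k}.
Proof.
apply: ae_foralln => k.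
have : {ae P, forall w, forall m : nat, \forall N \near \oo, ~ bad N k m.+1%:R^-1 w}.
  apply: ae_foralln => m; have e0 : (0 : R) < m.+1%:R^-1 by rewrite invr_gt0.
  apply: (@borel_cantelli_ae _ _ _ P _ (bound k / m.+1%:R^-1 ^+ 2 * 2)) => // n.
  apply: (@le_trans _ _ (\sum_(0 <= N < n)
     (if (0 < N)%N then bound k / m.+1%:R^-1 ^+ 2 / N%:R ^+ 2 else 0)%:E)%E).
    by apply: lee_sum => N _; exact: bad_prob.
  rewrite sumEFin lee_fin.
  rewrite (eq_bigr (fun N => bound k / m.+1%:R^-1 ^+ 2 *
     (if (0 < N)%N then (N%:R ^+ 2)^-1 else 0))) => [|N _]; last by case: ifP; rewrite ?mulr0.
  rewrite -mulr_sumr ler_wpM2l //.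
  by rewrite divr_ge0 // exprn_ge0 // ltW.
apply: filterS => w h; apply/cvgrPdist_lt => e e0.
have [m me] : exists m : nat, m.+1%:R^-1 < e.
  exists (Num.truncn e^-1); rewrite invf_plt ?posrE //.
  by rewrite real_truncnS_gt // num_real.
near=> N; have N0 : (0 < N)%N by near: N; exists 1%N.
have : ~ bad N k m.+1%:R^-1 w by near: N; exact: h.
rewrite /bad /= N0 /= => /negP; rewrite -ltNge lmomentE // distrC => /lt_trans; exact.
Unshelve. all: by end_near. Qed.

End LabelMoments.

(** * A law of large numbers for sums over square boxes *)

Section Product.
Context d d' (T : measurableType d) (T' : measurableType d') (R : realType).
Variables (P : probability T R) (U V : {RV P >-> T'}).
Hypothesis UV : forall A B, measurable A -> measurable B ->
  P (U @^-1` A `&` V @^-1` B) = (P (U @^-1` A) * P (V @^-1` B))%E.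

(** The joint law agrees with the product of the two laws on rectangles, hence everywhere, and
    Tonelli separates the integrals. *)
Lemma integral_mul_indep (g h : T' -> R) :
  measurable_fun setT g -> measurable_fun setT h ->
  (forall z, 0 <= g z) -> (forall z, 0 <= h z) ->
  (\int[P]_w (g (U w) * h (V w))%:E =
   \int[P]_w (g (U w))%:E * \int[P]_w (h (V w))%:E)%E.
Proof.
move=> mg mh g0 h0.
pose W w := (U w, V w).
have mW : measurable_fun setT W by apply/measurable_fun_pairP; split; exact: measurable_funP.
pose F (z : T' * T') : \bar R := (g z.1 * h z.2)%:E.
have mF : measurable_fun setT F.
  apply/measurable_EFinP; apply: measurable_funM.
    by apply: measurableT_comp => //; exact: measurable_fst.
  by apply: measurableT_comp => //; exact: measurable_snd.
have F0 z : (0 <= F z)%E by rewrite lee_fin mulr_ge0.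
transitivity (\int[pushforward P W]_z F z)%E.
  by rewrite ge0_integral_pushforward.
pose Wm : {RV P >-> (T' * T')%type} := HB.pack W (isMeasurableFun.Build _ _ _ _ _ mW).
transitivity (\int[(distribution P U \x distribution P V)%E]_z F z)%E.
  apply: eq_measure_integral => A mA _; apply/esym.
  by apply: (@product_measure_unique _ _ _ _ _ _ _ (distribution P Wm)).
have g0' x : (0 <= (g x)%:E)%E by rewrite lee_fin.
have h0' x : (0 <= (h x)%:E)%E by rewrite lee_fin.
have mg' : measurable_fun setT (EFin \o g) by apply/measurable_EFinP.
have mh' : measurable_fun setT (EFin \o h) by apply/measurable_EFinP.
have Ih0 : (0 <= \int[P]_w (h (V w))%:E)%E by apply: integral_ge0.
rewrite fubini_tonelli1 //.
transitivity (\int[distribution P U]_x ((g x)%:E * \int[P]_w (h (V w))%:E))%E.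
  apply: eq_integral => x _; rewrite /fubini_F /F /=.
  under eq_integral do rewrite EFinM.
  by rewrite ge0_integralZl // (ge0_integral_distribution V mh').
rewrite ge0_integralZr // (ge0_integral_distribution U mg') //.
Qed.

End Product.

Section Chebyshev.
Context d (T : measurableType d) (R : realType) (P : probability T R).
Variables (I : finType) (Z : I -> T -> R) (M m q : R).
Hypothesis mZ : forall c, measurable_fun setT (Z c).
Hypothesis ZM : forall c w, `|Z c w| <= M.
Hypothesis EZ : forall c, \int[P]_w Z c w = m.
Hypothesis EZZ : forall c c', c != c' -> \int[P]_w (Z c w * Z c' w) = m * m.
Hypothesis EZ2 : forall c, \int[P]_w (Z c w * Z c w) = q.

Let iZ c : P.-integrable setT (EFin \o Z c).
Proof. by apply: (@bounded_integrable _ _ _ _ _ M) => //; exact: ZM. Qed.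

Let iZZ c c' : P.-integrable setT (EFin \o (fun w => Z c w * Z c' w)).
Proof.
apply: (@bounded_integrable _ _ _ _ _ (M * M)); first exact: measurable_funM.
by move=> w; rewrite normrM ler_pM.
Qed.

Let iprod c c' : P.-integrable setT (EFin \o (fun w => (Z c w - m) * (Z c' w - m))).
Proof.
apply: (@bounded_integrable _ _ _ _ _ ((M + `|m|) * (M + `|m|))).
  by apply: measurable_funM; apply: measurable_funB.
move=> w; rewrite normrM ler_pM //;
  by apply: (le_trans (ler_normB _ _)); rewrite lerD2r.
Qed.

Let Eprod c c' : \int[P]_w ((Z c w - m) * (Z c' w - m)) =
  \int[P]_w (Z c w * Z c' w) - m * m.
Proof.
have ic (a : R) : P.-integrable setT (EFin \o (cst a : T -> R)).
  by apply: (@bounded_integrable _ _ _ _ (cst a) `|a|).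
have iz a c0 : P.-integrable setT (EFin \o (fun w => a * Z c0 w)).
  exact: (integrableZl _ _ (iZ c0)).
have -> : (fun w => (Z c w - m) * (Z c' w - m)) =
  fun w => Z c w * Z c' w + ((- m) * Z c w + ((- m) * Z c' w + m * m)).
  by apply/funext => w; ring.
have i2 : P.-integrable setT (EFin \o (fun w => (- m) * Z c' w + m * m)).
  exact: (integrableD measurableT (iz (- m) c') (ic (m * m))).
have i1 : P.-integrable setT (EFin \o (fun w => (- m) * Z c w + ((- m) * Z c' w + m * m))).
  exact: (integrableD measurableT (iz (- m) c) i2).
rewrite (RintegralD measurableT (iZZ c c') i1) (RintegralD measurableT (iz (- m) c) i2).
rewrite (RintegralD measurableT (iz (- m) c') (ic (m * m))).
rewrite (RintegralZl (- m) measurableT (iZ c)) (RintegralZl (- m) measurableT (iZ c')).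
rewrite !EZ Rintegral_cst // [X in fine X](probability_setT P) /=; ring.
Qed.

(** In the variance of the sum the off-diagonal terms vanish and each diagonal term is q - m^2 <= q.
    On the event the centred sum is at least [#|I|%:R * eta]. *)
Lemma chebyshev_sum (eta : R) : 0 < eta ->
  fine (P [set w | #|I|%:R * (m + eta) <= \sum_c Z c w]) * (#|I|%:R * eta) ^+ 2
  <= #|I|%:R * q.
Proof.
move=> eta0; set E := [set w | _].
have mS : measurable_fun setT (fun w => \sum_c Z c w) by exact: measurable_sum.
have mE : measurable E.
  rewrite -[E]setTI; have -> : E = (fun w => \sum_c Z c w) @^-1` `[#|I|%:R * (m + eta), +oo[.
    by apply/seteqP; split => w /=; rewrite in_itv /= andbT.
  exact: mS.
have SE w : (\sum_c Z c w - #|I|%:R * m) ^+ 2 =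
    \sum_(cc <- enum {: I * I}) (Z cc.1 w - m) * (Z cc.2 w - m).
  have -> : \sum_c Z c w - #|I|%:R * m = \sum_c (Z c w - m).
    by rewrite sumrB sumr_const mulr_natl cardT.
  rewrite expr2 mulr_suml big_enum /=.
  rewrite -(pair_bigA _ (fun c c' => (Z c w - m) * (Z c' w - m))) /=.
  by apply: eq_bigr => c _; rewrite mulr_sumr.
have [iS ES] := @Rintegral_sum _ _ _ P _ (enum {: I * I})
  (fun cc w => (Z cc.1 w - m) * (Z cc.2 w - m)) (fun cc => iprod cc.1 cc.2).
apply: (@le_trans _ _ (\int[P]_w (\sum_c Z c w - #|I|%:R * m) ^+ 2)); last first.
  under eq_Rintegral do rewrite SE.
  rewrite ES big_enum /= -(pair_bigA _ (fun c c' => \int[P]_w ((Z c w - m) * (Z c' w - m)))) /=.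
  rewrite [#|I|%:R * q]mulr_natl -sumr_const; apply: ler_sum => c _.
  rewrite (bigD1 c) //= big1 ?addr0 => [|c' cc']; last by rewrite Eprod EZZ ?subrr // eq_sym.
  by rewrite Eprod EZ2 gerBl -expr2 sqr_ge0.
rewrite -Rintegral_indic // mulrC -RintegralZl //; last first.
  apply: (@bounded_integrable _ _ _ _ _ 1) => // w.
  by rewrite indicE ger0_norm // lern1 leq_b1.
apply: le_Rintegral => //.
- apply: (@bounded_integrable _ _ _ _ _ ((#|I|%:R * eta) ^+ 2)) => //.
    by apply: measurable_funM.
  move=> w; rewrite normrM ger0_norm ?sqr_ge0 // ler_piMr ?sqr_ge0 //.
  by rewrite indicE ger0_norm // lern1 leq_b1.
- by under [X in _.-integrable _ X]funext do rewrite /= SE.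
move=> w _; rewrite indicE; case: (boolP (w \in E)) => [/set_mem|_]; last by rewrite mulr0 sqr_ge0.
rewrite /E /= mulr1 mulrDr => h; rewrite lerXn2r // ?nnegrE.
- by rewrite mulr_ge0 // ltW.
- by rewrite subr_ge0; apply: le_trans h; rewrite lerDl mulr_ge0 // ltW.
- by rewrite lerBrDl.
Qed.

End Chebyshev.

Section DyadicSums.
Variable R : realType.

Lemma dyadic_sum_below (z : R) K : 0 <= z ->
  \sum_(0 <= k < K) (if 4 ^+ k < z then 4 ^+ k else 0) <= 2 * z.
Proof.
move=> z0.
have geo L : \sum_(0 <= k < L) (if 4 ^+ k < z then 4 ^+ k else 0 : R) <= 4 ^+ L.
  elim: L => [|L IH]; first by rewrite big_geq // expr0 ler01.
  rewrite big_nat_recr //= exprS; have : (0 : R) <= 4 ^+ L by rewrite exprn_ge0.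
  by case: ifP => _ h; move: IH; lra.
elim: K => [|K IH]; first by rewrite big_geq // mulr_ge0.
rewrite big_nat_recr //=; case: ifP => [h|_]; last by rewrite addr0.
(* When 4^K < z, the earlier terms add up to at most 4^K < z and the last term is again below z. *)
have := geo K; lra.
Qed.

Lemma dyadic_sum_above (z : R) K : 0 <= z ->
  \sum_(0 <= k < K) (if z <= 4 ^+ k then z * z / 4 ^+ k else 0) <= 2 * z.
Proof.
move=> z0; pose S L := \sum_(0 <= k < L) (if z <= 4 ^+ k then (4 ^+ k)^-1 else 0 : R).
(* The exact geometric sum from the first k with z <= 4^k on, kept with its remainder so that the
   induction closes. *)
have h L : z * S L <= if z <= 4 ^+ L then 4 / 3 * (1 - z / 4 ^+ L) else 0.
  elim: L => [|L IH].
    rewrite /S big_geq // mulr0 expr0 divr1; case: ifP => // z1.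
    by rewrite mulr_ge0 // subr_ge0.
  have p0 : (0 : R) < 4 ^+ L by rewrite exprn_gt0.
  have pi0 : 0 < (4 ^+ L : R)^-1 by rewrite invr_gt0.
  rewrite /S big_nat_recr //= -/(S L) mulrDr exprS invfM.
  move: IH; case: (leP z (4 ^+ L)) => hz IH.
    have -> : z <= 4 * 4 ^+ L by lra.
    by lra.
  rewrite mulr0 addr0; apply: (le_trans IH); case: ifP => // hz'.
  rewrite mulr_ge0 // subr_ge0 mulrA ler_pdivrMr // mul1r; lra.
have -> : \sum_(0 <= k < K) (if z <= 4 ^+ k then z * z / 4 ^+ k else 0) = z * (z * S K).
  rewrite !mulr_sumr; apply: eq_bigr => k _.
  by case: ifP => _; rewrite ?mulr0 // mulrA.
rewrite mulrC ler_wpM2r //; apply: (le_trans (h K)); case: ifP => // _.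
have : 0 <= z / 4 ^+ K by rewrite divr_ge0 // exprn_ge0.
lra.
Qed.

End DyadicSums.

Section Pairs.
Context d (T : measurableType d) (R : realType) (P : probability T R).
Variable X : nat -> nat -> {RV P >-> R[i]}.
Hypothesis X_indep : independent P (fun ij : nat * nat => X ij.1 ij.2).
Hypothesis X_iid : identically_distributed P (fun ij : nat * nat => X ij.1 ij.2).

Lemma pair_indep (a b : nat * nat) : a != b -> forall A B, measurable A -> measurable B ->
  P (X a.1 a.2 @^-1` A `&` X b.1 b.2 @^-1` B) =
  (P (X a.1 a.2 @^-1` A) * P (X b.1 b.2 @^-1` B))%E.
Proof.
move=> ab A B mA mB; pose E c := if c == a then A else B.
have Eb : E b = B by rewrite /E eq_sym (negbTE ab).
have Ea : E a = A by rewrite /E eqxx.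
have := @X_indep [fset a; b]%fset E; rewrite big_fsetU1 ?inE //= big_seq_fset1 Ea Eb.
move=> <-; last by move=> c _; rewrite /E; case: ifP.
congr (P _); apply/seteqP; split => w /=.
  by move=> [wA wB] c; rewrite /= !inE => /orP[] /eqP ->; rewrite ?Ea ?Eb.
by move=> h; split; [rewrite -Ea | rewrite -Eb]; apply: h; rewrite /= !inE eqxx ?orbT.
Qed.

Lemma same_Rintegral (g : R[i] -> R) i j : measurable_fun setT g -> (forall z, 0 <= g z) ->
  \int[P]_w g (X i j w) = \int[P]_w g (X 0%N 0%N w).
Proof.
move=> mg g0; rewrite /Rintegral; congr fine.
have mg' : measurable_fun setT (EFin \o g) by apply/measurable_EFinP.
have g0' z : (0 <= (g z)%:E)%E by rewrite lee_fin.
rewrite -[LHS](ge0_integral_distribution (X i j) mg') //.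
rewrite -[RHS](ge0_integral_distribution (X 0%N 0%N) mg') //.
by apply: eq_measure_integral => A mA _; exact: (X_iid (i, j) (0, 0)%N mA).
Qed.

Lemma pair_Rintegral (g : R[i] -> R) (a b : nat * nat) : a != b ->
  measurable_fun setT g -> (forall z, 0 <= g z) ->
  P.-integrable setT (EFin \o (fun w => g (X 0%N 0%N w))) ->
  \int[P]_w (g (X a.1 a.2 w) * g (X b.1 b.2 w)) =
  (\int[P]_w g (X 0%N 0%N w)) * (\int[P]_w g (X 0%N 0%N w)).
Proof.
move=> ab mg g0 ig; rewrite {1}/Rintegral.
rewrite (integral_mul_indep (pair_indep ab) mg mg g0 g0).
have e c : (\int[P]_w (g (X c.1 c.2 w))%:E = \int[P]_w (g (X 0%N 0%N w))%:E)%E.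
  have mg' : measurable_fun setT (EFin \o g) by apply/measurable_EFinP.
  have g0' z : (0 <= (g z)%:E)%E by rewrite lee_fin.
  rewrite -[LHS](ge0_integral_distribution (X c.1 c.2) mg') //.
  rewrite -[RHS](ge0_integral_distribution (X 0%N 0%N) mg') //.
  by apply: eq_measure_integral => A mA _; exact: (X_iid (c.1, c.2) (0, 0)%N mA).
by rewrite !e fineM // (integrable_fin_num measurableT ig).
Qed.

End Pairs.

Lemma box_sum_le (R : realType) s N M (f : nat -> nat -> R) : (N <= M)%N ->
  (forall i j, 0 <= f i j) -> box_sum s N f <= box_sum s M f.
Proof.
move=> NM f0; have NM' : (s.+1 * N <= s.+1 * M)%N by rewrite leq_mul2l NM orbT.
have le_ord (g : nat -> R) : (forall i, 0 <= g i) ->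
    \sum_(i < s.+1 * N) g i <= \sum_(i < s.+1 * M) g i.
  move=> g0; rewrite -!(big_mkord xpredT g) (big_cat_nat (leq0n _) NM') //= lerDl.
  by rewrite sumr_ge0.
rewrite /box_sum; apply: le_trans (le_ord (fun i => \sum_(j < s.+1 * M) f i j) _).
  by apply: ler_sum => i _; exact: (le_ord (f i)).
by move=> i; rewrite sumr_ge0.
Qed.

Lemma finite_union_bound d (T : measurableType d) (R : realType) (P : probability T R)
  (I : finType) (E : I -> set T) (c : R) : (forall i, measurable (E i)) ->
  (forall i, P (E i) <= c%:E)%E -> (P (\bigcup_(i in setT) E i) <= (#|I|%:R * c)%:E)%E.
Proof.
move=> mE Ec; have -> : \bigcup_(i in setT) E i = \big[setU/set0]_i E i.
  apply/seteqP; split => w; first by move=> [i _ Ei]; rewrite (bigD1 i) //=; left.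
  elim/big_ind: _ => [//|A1 A2 h1 h2 [/h1|/h2] //|i _ Ei]; by exists i.
rewrite mulr_natl -sumr_const -sumEFin.
suff : measurable (\big[setU/set0]_i E i) /\ (P (\big[setU/set0]_i E i) <= \sum_(i in I) c%:E)%E by case.
rewrite [X in (_ <= X)%E]big_mkcond.
elim/big_rec2: _ => [|i S y _ [mS PS]]; first by rewrite measure0.
rewrite /=; split; first exact: measurableU.
apply: (le_trans (measureU2 _ _ _)) => //; apply: leeD => //.
exact: Ec.
Qed.

Section BoxSums.
Context d (T : measurableType d) (R : realType) (P : probability T R).
Variable X : nat -> nat -> {RV P >-> R[i]}.
Hypothesis X_indep : independent P (fun ij : nat * nat => X ij.1 ij.2).
Hypothesis X_iid : identically_distributed P (fun ij : nat * nat => X ij.1 ij.2).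
Variables (f : R[i] -> R) (eta : R) (s : nat).
Hypothesis mf : measurable_fun setT f.
Hypothesis f0 : forall z, 0 <= f z.
Hypothesis fi : P.-integrable setT (EFin \o (fun w => f (X 0%N 0%N w))).
Hypothesis eta0 : 0 < eta.
Hypothesis f_mean : \int[P]_w f (X 0%N 0%N w) <= eta.
Let r := s.+1.

(** A box of side r 2^k has r^2 4^k cells. At this truncation level the union bound for large
    entries costs r^2 4^k P(f > 4^k), and Chebyshev costs a multiple of E(f^2; f <= 4^k) / 4^k. The
    two dyadic sums bound both series by multiples of the mean. *)
Let tr k z := if f z <= 4 ^+ k then f z else 0.

Let mtr k : measurable_fun setT (tr k).
Proof.
apply: measurable_fun_ifT => //.
by apply: measurable_fun_ler.
Qed.

Let tr_ge0 k z : 0 <= tr k z. Proof. by rewrite /tr; case: ifP. Qed.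

Let tr_le k z : tr k z <= 4 ^+ k.
Proof. by rewrite /tr; case: ifP => // _; rewrite exprn_ge0. Qed.

Let tr_le_f k z : tr k z <= f z.
Proof. by rewrite /tr; case: ifP. Qed.

Let mX i j : measurable_fun setT (X i j). Proof. exact: measurable_funP. Qed.

Let tr_norm k z : `|tr k z| <= 4 ^+ k.
Proof. by rewrite ger0_norm. Qed.

Let big_set k : set T := [set w | exists i j, [/\ (i < r * 2 ^ k)%N, (j < r * 2 ^ k)%N &
  4 ^+ k < f (X i j w)]].

Let sum_set k : set T := [set w |
  #|{: 'I_(r * 2 ^ k) * 'I_(r * 2 ^ k)}|%:R * (\int[P]_w tr k (X 0%N 0%N w) + eta) <=
  \sum_(c : 'I_(r * 2 ^ k) * 'I_(r * 2 ^ k)) tr k (X c.1 c.2 w)].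

Let big1 k : set T := [set w | 4 ^+ k < f (X 0%N 0%N w)].

Let mgt k : measurable [set z | 4 ^+ k < f z].
Proof.
rewrite -[X in measurable X]setTI.
have -> : [set z | 4 ^+ k < f z] = f @^-1` `]4 ^+ k, +oo[.
  by apply/seteqP; split => w /=; rewrite in_itv /= andbT.
exact: mf.
Qed.

Let mbig1 k : measurable (big1 k).
Proof.
have -> : big1 k = setT `&` X 0%N 0%N @^-1` [set z | 4 ^+ k < f z] by rewrite setTI.
exact: mX.
Qed.

Let big_setE k : big_set k = \bigcup_(c in [set: 'I_(r * 2 ^ k) * 'I_(r * 2 ^ k)])
   (X c.1 c.2 @^-1` [set z | 4 ^+ k < f z]).
Proof.
apply/seteqP; split => w /=.
  by move=> [i [j [hi hj h]]]; exists (Ordinal hi, Ordinal hj).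
by move=> [c _ h]; exists c.1, c.2; split.
Qed.

Let mcell k (c : nat * nat) : measurable (X c.1 c.2 @^-1` [set z | 4 ^+ k < f z]).
Proof. by rewrite -[X in measurable X]setTI; exact: mX. Qed.

Let mbig_set k : measurable (big_set k).
Proof.
rewrite big_setE; apply: fin_bigcup_measurable => // c _.
exact: (mcell k (nat_of_ord c.1, nat_of_ord c.2)).
Qed.

Let card_cells k : #|{: 'I_(r * 2 ^ k) * 'I_(r * 2 ^ k)}|%:R = r%:R ^+ 2 * 4 ^+ k :> R.
Proof.
have -> : (4 : R) = 2 ^+ 2 by rewrite -natrX.
rewrite card_prod card_ord !natrM natrX -exprM mulnC exprM; ring.
Qed.

Let big_set_prob k : (P (big_set k) <= (r%:R ^+ 2 * (4 ^+ k * fine (P (big1 k))))%:E)%E.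
Proof.
rewrite mulrA -card_cells big_setE; apply: finite_union_bound => c.
  exact: (mcell k (nat_of_ord c.1, nat_of_ord c.2)).
rewrite fineK ?fin_num_measure //.
by rewrite [leLHS](same_law X_iid).
Qed.

Let mtrX k i j : measurable_fun setT (fun w => tr k (X i j w)).
Proof. exact: measurableT_comp. Qed.

Let itr k : P.-integrable setT (EFin \o (fun w => tr k (X 0%N 0%N w))).
Proof. by apply: (@bounded_integrable _ _ _ _ _ (4 ^+ k)). Qed.

Let second k := \int[P]_w (tr k (X 0%N 0%N w) * tr k (X 0%N 0%N w)).

Let msum_set k : measurable (sum_set k).
Proof.
rewrite -[sum_set k]setTI.
set a := #|{: 'I_(r * 2 ^ k) * 'I_(r * 2 ^ k)}|%:R * (\int[P]_w tr k (X 0%N 0%N w) + eta).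
have -> : sum_set k = (fun w => \sum_(c : 'I_(r * 2 ^ k) * 'I_(r * 2 ^ k)) tr k (X c.1 c.2 w))
   @^-1` `[a, +oo[.
  by apply/seteqP; split => w /=; rewrite in_itv /= andbT.
by have /(_ measurableT) : measurable_fun setT (fun w =>
   \sum_(c : 'I_(r * 2 ^ k) * 'I_(r * 2 ^ k)) tr k (X c.1 c.2 w));
   [exact: measurable_sum | apply].
Qed.

Let sum_set_prob k : (P (sum_set k) <= ((r%:R ^+ 2 * eta ^+ 2)^-1 * (second k / 4 ^+ k))%:E)%E.
Proof.
have p4 : (0 : R) < 4 ^+ k by rewrite exprn_gt0.
have r0 : (0 : R) < r%:R ^+ 2 by rewrite exprn_gt0.
have e2 : 0 < eta ^+ 2 by rewrite exprn_gt0.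
rewrite -[leLHS]fineK ?fin_num_measure // lee_fin.
have := @chebyshev_sum _ _ _ P ('I_(r * 2 ^ k) * 'I_(r * 2 ^ k))%type
   (fun c w => tr k (X c.1 c.2 w)) (4 ^+ k) (\int[P]_w tr k (X 0%N 0%N w)) (second k).
have inj (c c' : 'I_(r * 2 ^ k) * 'I_(r * 2 ^ k)) : c != c' ->
    (nat_of_ord c.1, nat_of_ord c.2) != (nat_of_ord c'.1, nat_of_ord c'.2).
  by apply: contra_neq; case: c c' => [a b] [a' b'] [] /val_inj /= -> /val_inj /= ->.
move=> /(_ (fun c => mtrX k c.1 c.2) (fun c w => tr_norm k _)
   (fun c => same_Rintegral X_iid c.1 c.2 (mtr k) (tr_ge0 k))
   (fun c c' cc' => pair_Rintegral X_indep X_iid (inj c c' cc') (mtr k) (tr_ge0 k) (itr k))).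
have mtr2 : measurable_fun setT (fun z => tr k z * tr k z) by exact: measurable_funM.
have tr20 z : 0 <= tr k z * tr k z by rewrite mulr_ge0.
move=> /(_ (fun c => same_Rintegral X_iid c.1 c.2 mtr2 tr20) eta eta0).
rewrite -/(sum_set k) card_cells; move: (fine _) (second k) => p q h.
have a0 : 0 < r%:R ^+ 2 * 4 ^+ k :> R by rewrite mulr_gt0.
rewrite mulrC -mulrA -invfM ler_pdivlMr; last by rewrite !mulr_gt0.
rewrite -(ler_pM2l a0); apply: le_trans h.
by rewrite exprMn le_eqVlt; apply/orP; left; apply/eqP; ring.
Qed.

Let E k := big_set k `|` sum_set k.

Let E_prob k : (P (E k) <= (r%:R ^+ 2 * (4 ^+ k * fine (P (big1 k))) +
  (r%:R ^+ 2 * eta ^+ 2)^-1 * (second k / 4 ^+ k))%:E)%E.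
Proof.
apply: (le_trans (measureU2 _ (mbig_set k) (msum_set k))).
by rewrite EFinD; apply: leeD; [exact: big_set_prob|exact: sum_set_prob].
Qed.

Let sum_big K : \sum_(0 <= k < K) 4 ^+ k * fine (P (big1 k)) <= 2 * eta.
Proof.
have ii k : P.-integrable setT (EFin \o (fun w => 4 ^+ k * \1_(big1 k) w)).
  apply: (@bounded_integrable _ _ _ _ _ (4 ^+ k)).
    by apply: measurable_funM.
  move=> w; rewrite normrM ger0_norm ?exprn_ge0 // ler_piMr ?exprn_ge0 //.
  by rewrite indicE ger0_norm // lern1 leq_b1.
have [iS ES] := @Rintegral_sum _ _ _ P _ (index_iota 0 K)
  (fun k w => 4 ^+ k * \1_(big1 k) w) ii.
have -> : \sum_(0 <= k < K) 4 ^+ k * fine (P (big1 k)) =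
    \sum_(0 <= k < K) \int[P]_w (4 ^+ k * \1_(big1 k) w).
  apply: eq_bigr => k _; rewrite RintegralZl ?Rintegral_indic //.
  apply: (@bounded_integrable _ _ _ _ _ 1) => // w.
  by rewrite indicE ger0_norm // lern1 leq_b1.
rewrite -ES; apply: (@le_trans _ _ (2 * \int[P]_w f (X 0%N 0%N w))); last by rewrite ler_pM2l.
rewrite -RintegralZl //; apply: le_Rintegral => //; first exact: (integrableZl _ _ fi).
move=> w _; apply: le_trans (dyadic_sum_below K (f0 (X 0%N 0%N w))).
apply: ler_sum => k _; rewrite indicE; case: (boolP (w \in big1 k)) => [/set_mem|_].
  by rewrite /big1 /= => ->; rewrite mulr1.
by rewrite mulr0; case: ifP => // _; rewrite exprn_ge0.
Qed.

Let sum_second K : \sum_(0 <= k < K) second k / 4 ^+ k <= 2 * eta.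
Proof.
have i2 k : P.-integrable setT (EFin \o (fun w => tr k (X 0%N 0%N w) * tr k (X 0%N 0%N w))).
  apply: (@bounded_integrable _ _ _ _ _ (4 ^+ k * 4 ^+ k)).
    exact: measurable_funM.
  by move=> w; rewrite normrM ler_pM.
have [iS ES] := @Rintegral_sum _ _ _ P _ (index_iota 0 K)
  (fun k w => (4 ^+ k)^-1 * (tr k (X 0%N 0%N w) * tr k (X 0%N 0%N w)))
  (fun k => integrableZl measurableT _ (i2 k)).
have -> : \sum_(0 <= k < K) second k / 4 ^+ k =
    \sum_(0 <= k < K) \int[P]_w ((4 ^+ k)^-1 * (tr k (X 0%N 0%N w) * tr k (X 0%N 0%N w))).
  by apply: eq_bigr => k _; rewrite RintegralZl // mulrC.
rewrite -ES; apply: (@le_trans _ _ (2 * \int[P]_w f (X 0%N 0%N w))); last by rewrite ler_pM2l.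
rewrite -RintegralZl //; apply: le_Rintegral => //; first exact: (integrableZl _ _ fi).
move=> w _; apply: le_trans (dyadic_sum_above K (f0 (X 0%N 0%N w))).
apply: ler_sum => k _; rewrite /tr; case: ifP => _; last by rewrite !mulr0.
by rewrite mulrC.
Qed.

(** For 2^(k-1) <= N < 2^k the box of N lies in that of 2^k, whose sum is eventually at most r^2 4^k
    times 2 eta (truncated mean plus deviation). Since 4^k <= 4 N^2, the constant is 8. *)
Lemma box_sum_eventually : {ae P, forall w, \forall N \near \oo,
  box_sum s N (fun i j => f (X i j w)) <= 8 * r%:R ^+ 2 * eta * N%:R ^+ 2}.
Proof.
have : {ae P, forall w, \forall k \near \oo, ~ E k w}.
  apply: (@borel_cantelli_ae _ _ _ P E
    (r%:R ^+ 2 * (2 * eta) + (r%:R ^+ 2 * eta ^+ 2)^-1 * (2 * eta))).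
    by move=> k; exact: measurableU.
  move=> K; apply: (@le_trans _ _ (\sum_(0 <= k < K)
    (r%:R ^+ 2 * (4 ^+ k * fine (P (big1 k))) +
     (r%:R ^+ 2 * eta ^+ 2)^-1 * (second k / 4 ^+ k))%:E)%E).
    by apply: lee_sum => k _; exact: E_prob.
  rewrite sumEFin lee_fin big_split /= -!mulr_sumr; apply: lerD.
    by rewrite ler_wpM2l // exprn_ge0.
  by rewrite ler_wpM2l // invr_ge0 mulr_ge0 // exprn_ge0 // ltW.
apply: filterS => w [k0 _ h]; exists (2 ^ k0)%N => // N /= kN.
have N0 : (0 < N)%N by apply: leq_trans kN; rewrite expn_gt0.
pose k := (trunc_log 2 N).+1.
have Nk : (N <= 2 ^ k)%N by rewrite ltnW // trunc_log_ltn.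
have kN2 : (2 ^ k <= 2 * N)%N by rewrite expnS leq_mul2l /= trunc_logP.
have k0k : (k0 <= k)%N.
  by rewrite leqW // trunc_log_max.
have := h k k0k; rewrite /E /= => /not_orP[nb ns].
apply: (le_trans (box_sum_le s Nk (fun i j => f0 (X i j w)))).
have e : box_sum s (2 ^ k) (fun i j => f (X i j w)) =
    \sum_(c : 'I_(r * 2 ^ k) * 'I_(r * 2 ^ k)) tr k (X c.1 c.2 w).
  rewrite -(pair_bigA _ (fun i j : 'I_(r * 2 ^ k) => tr k (X i j w))) /=.
  apply: eq_bigr => i _; apply: eq_bigr => j _; rewrite /tr; case: leP => // hij.
  by exfalso; apply: nb; exists i, j; split.
have m_le : \int[P]_w tr k (X 0%N 0%N w) <= eta.
  apply: le_trans f_mean; apply: (le_Rintegral measurableT (itr k) fi) => x _.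
  exact: tr_le_f.
rewrite e; move/negP: ns; rewrite /sum_set /= -ltNge => /ltW /le_trans; apply.
rewrite card_cells; apply: (@le_trans _ _ (r%:R ^+ 2 * 4 ^+ k * (2 * eta))).
  by rewrite ler_wpM2l ?mulr_ge0 ?exprn_ge0 // mulr_natl mulr2n lerD2r.
have -> : 8 * r%:R ^+ 2 * eta * N%:R ^+ 2 = r%:R ^+ 2 * (2 * N%:R) ^+ 2 * (2 * eta) by ring.
rewrite ler_wpM2r ?mulr_ge0 ?(ltW eta0) // ler_wpM2l ?exprn_ge0 //.
have -> : (4 : R) ^+ k = (2 ^ k)%:R ^+ 2.
  by rewrite natrX -exprM mulnC exprM; congr (_ ^+ _); rewrite -natrX.
by rewrite lerXn2r ?nnegrE ?mulr_ge0 // -natrM ler_nat.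
Qed.

End BoxSums.

Import HBNNSimple.

(** * Approximation by normalised finitely valued variables *)

Section SimpleApproximation.
Context d d' (T : measurableType d) (T' : measurableType d') (R : realType).

Lemma nonneg_simple_approx (g : T' -> R) : measurable_fun setT g -> (forall z, 0 <= g z) ->
  exists u : nat -> T' -> R, [/\ forall n, finite_set (range (u n)),
    forall n, measurable_fun setT (u n), forall n z, 0 <= u n z <= g z &
    forall z, u n z @[n --> \oo] --> g z].
Proof.
move=> mg g0; have mg' : measurable_fun setT (EFin \o g) by apply/measurable_EFinP.
exists (fun n z => nnsfun_approx measurableT mg' n z).
have cv z : nnsfun_approx measurableT mg' n z @[n --> \oo] --> g z.
  apply: (@fine_cvg _ _ _ _ (fun n => (nnsfun_approx measurableT mg' n z)%:E)).
  by apply: (cvg_nnsfun_approx measurableT mg') => // x _; rewrite lee_fin.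
split => // n z; apply/andP; split; first by [].
have := @nondecreasing_cvgn_le _ (fun n => nnsfun_approx measurableT mg' n z).
have /cvg_lim -> // := cv z.
apply; last exact: cv.
by move=> a b ab; exact/lefP/nd_nnsfun_approx.
Qed.

Variables (P : probability T R) (xi : {RV P >-> T'}).

(** Positive and negative parts are approximated from below separately; the squared error is
    dominated by 4 g^2, so dominated convergence applies. *)
Lemma simple_approx_L2 (g : T' -> R) (dl : R) : measurable_fun setT g -> 0 < dl ->
  P.-integrable setT (EFin \o (fun w => g (xi w) ^+ 2)) ->
  exists u : T' -> R, [/\ finite_set (range u), measurable_fun setT u &
    \int[P]_w (g (xi w) - u (xi w)) ^+ 2 <= dl].
Proof.
move=> mg dl0 ig.
have [p [pf pm pb pc]] := @nonneg_simple_approx (fun z => Num.max (g z) 0)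
  (measurable_maxr mg (measurable_cst _)) (fun z => ltac:(by rewrite le_max lexx orbT)).
have mNg : measurable_fun setT (fun z => - g z) by exact: measurableT_comp.
have [q [qf qm qb qc]] := @nonneg_simple_approx (fun z => Num.max (- g z) 0)
  (measurable_maxr mNg (measurable_cst _))
  (fun z => ltac:(by rewrite le_max lexx orbT)).
pose u n z := p n z - q n z.
have mu n : measurable_fun setT (u n) by exact: measurable_funB.
have mxi : measurable_fun setT xi by exact: measurable_funP.
have mD n : measurable_fun setT (fun w => (g (xi w) - u n (xi w)) ^+ 2).
  apply: measurable_funX; apply: measurable_funB; apply: measurableT_comp => //.
have ub n z : (g z - u n z) ^+ 2 <= 4 * g z ^+ 2.
  have /andP[] := pb n z; have /andP[] := qb n z; rewrite /u.
  move: (p n z) (q n z) (g z) => a b c.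
  case: (leP 0 c) => c0.
    rewrite max_r ?oppr_le0 // => b0 b1 a0 a1.
    have -> : b = 0 by lra.
    have := mulr_ge0 a0 c0; have := mulr_ge0 a0 (_ : 0 <= c - a); rewrite subr_ge0 => /(_ a1).
    have := mulr_ge0 c0 c0; lra.
  rewrite max_l ?oppr_ge0 ?(ltW c0) // => b0 b1 a0 a1.
  have -> : a = 0 by lra.
  have c0' : 0 <= - c by lra. have bc : 0 <= - c - b by lra.
  have := mulr_ge0 b0 c0'; have := mulr_ge0 b0 bc.
  have := mulr_ge0 c0' c0'; lra.
have uc z : (g z - u n z) ^+ 2 @[n --> \oo] --> (0 : R).
  have : u n z @[n --> \oo] --> Num.max (g z) 0 - Num.max (- g z) 0 by exact: cvgB.
  have -> : Num.max (g z) 0 - Num.max (- g z) 0 = g z.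
    case: (leP 0 (g z)) => c0; first by rewrite max_r ?oppr_le0 // subr0.
    by rewrite max_l ?oppr_ge0 ?(ltW c0) // sub0r opprK.
  move=> h; have : g z - u n z @[n --> \oo] --> g z - g z by apply: cvgB => //; exact: cvg_cst.
  rewrite subrr => h2; have := cvgM h2 h2; rewrite mulr0; exact.
have [_ _ cI] := @dominated_convergence _ _ _ P setT measurableT
  (fun n w => ((g (xi w) - u n (xi w)) ^+ 2)%:E) (cst 0%E) (fun w => (4 * g (xi w) ^+ 2)%:E)
  (fun n => ltac:(apply/measurable_EFinP; exact: mD)) (measurable_cst _)
  (ltac:(apply: aeW => w _; apply: cvg_EFin; [exact: nearW | exact: uc]))
  (integrableZl measurableT 4 ig)
  (ltac:(by apply: aeW => w n _; rewrite gee0_abs ?lee_fin ?sqr_ge0 // ub)).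
rewrite integral0 in cI.
have h : \int[P]_w ((g (xi w) - u n (xi w)) ^+ 2) @[n --> \oo] --> (0 : R).
  exact: (fine_cvg cI).
move/cvgrPdist_le: h => /(_ _ dl0) [N _ /(_ N (leqnn N))] /=.
rewrite sub0r normrN => h; exists (u N); split; last exact: le_trans (ler_norm _) h.
  exact: (finite_image11 (fun a b : R => a - b) (pf N) (qf N)).
exact: mu.
Qed.

End SimpleApproximation.

Section Normalise.
Context d (T : measurableType d) (R : realType) (P : probability T R).

Lemma Rintegral_lin3 (f g h : T -> R) a b :
  P.-integrable setT (EFin \o f) -> P.-integrable setT (EFin \o g) ->
  P.-integrable setT (EFin \o h) ->
  P.-integrable setT (EFin \o (fun w => f w + (a * g w + b * h w))) /\
  \int[P]_w (f w + (a * g w + b * h w)) =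
  \int[P]_w f w + (a * \int[P]_w g w + b * \int[P]_w h w).
Proof.
move=> jf jg jh.
have jg' : P.-integrable setT (EFin \o (fun w => a * g w)) by exact: (integrableZl _ _ jg).
have jh' : P.-integrable setT (EFin \o (fun w => b * h w)) by exact: (integrableZl _ _ jh).
have jgh : P.-integrable setT (EFin \o (fun w => a * g w + b * h w)).
  exact: (integrableD _ jg' jh').
split; first exact: (integrableD _ jf jgh).
by rewrite RintegralD // RintegralD // !RintegralZl.
Qed.

Lemma integrable_cst_probability (a : R) : P.-integrable setT (EFin \o (cst a : T -> R)).
Proof. by apply: (@bounded_integrable _ _ _ _ (cst a) `|a|). Qed.

Lemma integrable_mul_sqr (f g : T -> R) : measurable_fun setT f -> measurable_fun setT g ->
  P.-integrable setT (EFin \o (fun w => f w ^+ 2)) ->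
  P.-integrable setT (EFin \o (fun w => g w ^+ 2)) ->
  P.-integrable setT (EFin \o (fun w => f w * g w)).
Proof.
move=> mf mg jf jg.
have j : P.-integrable setT (EFin \o (fun w => f w ^+ 2 + g w ^+ 2)).
  exact: (integrableD _ jf jg).
apply: (le_integrable measurableT _ _ j).
  by apply/measurable_EFinP; exact: measurable_funM.
move=> w _ /=; rewrite lee_fin [leRHS]ger0_norm ?addr_ge0 ?sqr_ge0 //.
have := sqr_ge0 (f w + g w); have := sqr_ge0 (f w - g w).
have := sqr_ge0 (f w); have := sqr_ge0 (g w).
by move=> *; rewrite ler_norml; apply/andP; split; lra.
Qed.

Lemma integrable_sqrB (f g : T -> R) : measurable_fun setT f -> measurable_fun setT g ->
  P.-integrable setT (EFin \o (fun w => f w ^+ 2)) ->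
  P.-integrable setT (EFin \o (fun w => g w ^+ 2)) ->
  P.-integrable setT (EFin \o (fun w => (f w - g w) ^+ 2)).
Proof.
move=> mf mg jf jg.
have [j _] := Rintegral_lin3 (- 2) 1 jf (integrable_mul_sqr mf mg jf jg) jg.
have -> // : (fun w => (f w - g w) ^+ 2) = fun w => f w ^+ 2 + (- 2 * (f w * g w) + 1 * g w ^+ 2).
by apply/funext => w; ring.
Qed.

Lemma integrable_of_sqr (f : T -> R) : measurable_fun setT f ->
  P.-integrable setT (EFin \o (fun w => f w ^+ 2)) -> P.-integrable setT (EFin \o f).
Proof.
move=> mf jf; have := @integrable_mul_sqr f (cst 1) mf (measurable_cst _) jf.
have -> : (fun w => f w * cst 1 w) = f by apply/funext => w; rewrite mulr1.
by apply; rewrite /= expr1n; exact: integrable_cst_probability.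
Qed.

Lemma Rintegral_cst_probability (a : R) : \int[P]_w cst a w = a.
Proof. by rewrite Rintegral_cst // [X in fine X](probability_setT P) mulr1. Qed.

Variables x y u v : T -> R.
Hypotheses (mx : measurable_fun setT x) (my : measurable_fun setT y)
  (mu : measurable_fun setT u) (mv : measurable_fun setT v).
Hypotheses (jx : P.-integrable setT (EFin \o (fun w => x w ^+ 2)))
  (jy : P.-integrable setT (EFin \o (fun w => y w ^+ 2)))
  (ju : P.-integrable setT (EFin \o (fun w => u w ^+ 2)))
  (jv : P.-integrable setT (EFin \o (fun w => v w ^+ 2))).
Hypotheses (Ex : \int[P]_w x w = 0) (Ey : \int[P]_w y w = 0)
  (Exy : \int[P]_w (x w ^+ 2 + y w ^+ 2) = 1).
Variable D : R.
Hypothesis D_le : \int[P]_w ((x w - u w) ^+ 2 + (y w - v w) ^+ 2) <= D.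
Hypothesis D4 : D <= 4^-1.

(** With X = x + iy and psi = u' + iv' the centred approximation, s2 is the variance of psi and c
    the real inner product of X and psi. The mean of |X - t psi|^2 is then the quadratic 1 - 2tc +
    t^2 s2. *)
Let b1 := \int[P]_w u w.
Let b2 := \int[P]_w v w.
Let u' w := u w - b1.
Let v' w := v w - b2.
Let s2 := \int[P]_w (u' w ^+ 2 + v' w ^+ 2).
Let c := \int[P]_w (x w * u' w + y w * v' w).

Let jcst := integrable_cst_probability.

Let mu' : measurable_fun setT u'. Proof. exact: measurable_funB. Qed.
Let mv' : measurable_fun setT v'. Proof. exact: measurable_funB. Qed.

Let ju' : P.-integrable setT (EFin \o (fun w => u' w ^+ 2)).
Proof.
have [j _] := Rintegral_lin3 (- 2 * b1) (b1 ^+ 2) ju (integrable_of_sqr mu ju) (jcst 1).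
have -> // : (fun w => u' w ^+ 2) = fun w => u w ^+ 2 + (- 2 * b1 * u w + b1 ^+ 2 * cst 1 w).
by apply/funext => w; rewrite /u' /=; ring.
Qed.

Let jv' : P.-integrable setT (EFin \o (fun w => v' w ^+ 2)).
Proof.
have [j _] := Rintegral_lin3 (- 2 * b2) (b2 ^+ 2) jv (integrable_of_sqr mv jv) (jcst 1).
have -> // : (fun w => v' w ^+ 2) = fun w => v w ^+ 2 + (- 2 * b2 * v w + b2 ^+ 2 * cst 1 w).
by apply/funext => w; rewrite /v' /=; ring.
Qed.

Let jA : P.-integrable setT (EFin \o (fun w => x w ^+ 2 + y w ^+ 2)).
Proof. exact: (integrableD _ jx jy). Qed.

Let jB : P.-integrable setT (EFin \o (fun w => u' w ^+ 2 + v' w ^+ 2)).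
Proof. exact: (integrableD _ ju' jv'). Qed.

Let jC : P.-integrable setT (EFin \o (fun w => x w * u' w + y w * v' w)).
Proof.
exact: (integrableD _ (integrable_mul_sqr mx mu' jx ju') (integrable_mul_sqr my mv' jy jv')).
Qed.

Let Q t : P.-integrable setT
    (EFin \o (fun w => (x w - t * u' w) ^+ 2 + (y w - t * v' w) ^+ 2)) /\
  \int[P]_w ((x w - t * u' w) ^+ 2 + (y w - t * v' w) ^+ 2) = 1 - 2 * t * c + t ^+ 2 * s2.
Proof.
have [j E] := Rintegral_lin3 (- 2 * t) (t ^+ 2) jA jC jB.
have -> : (fun w => (x w - t * u' w) ^+ 2 + (y w - t * v' w) ^+ 2) = fun w =>
  (x w ^+ 2 + y w ^+ 2) + (- 2 * t * (x w * u' w + y w * v' w) +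
   t ^+ 2 * (u' w ^+ 2 + v' w ^+ 2)) by apply/funext => w; ring.
by split=> //; rewrite E Exy -/c -/s2; ring.
Qed.

Let Q_ge0 t : 0 <= 1 - 2 * t * c + t ^+ 2 * s2.
Proof.
have [_ <-] := Q t; apply: Rintegral_ge0 => // w _.
by rewrite addr_ge0 ?sqr_ge0.
Qed.

(** Centring does not spoil the approximation: as x and y have mean 0, it lowers the mean squared
    distance by b1^2 + b2^2. *)
Let Q1_le : 1 - 2 * c + s2 <= D.
Proof.
have -> : 1 - 2 * c + s2 = 1 - 2 * 1 * c + 1 ^+ 2 * s2 by ring.
have [_ <-] := Q 1.
have jxu := integrable_of_sqr mx jx; have jyv := integrable_of_sqr my jy.
have juu := integrable_of_sqr mu ju; have jvv := integrable_of_sqr mv jv.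
have jxu' : P.-integrable setT (EFin \o (fun w => x w - u w)) by exact: (integrableB _ jxu juu).
have jyv' : P.-integrable setT (EFin \o (fun w => y w - v w)) by exact: (integrableB _ jyv jvv).
have jF : P.-integrable setT (EFin \o (fun w => (x w - u w) ^+ 2 + (y w - v w) ^+ 2)).
  exact: (integrableD _ (integrable_sqrB mx mu jx ju) (integrable_sqrB my mv jy jv)).
have [j E] := Rintegral_lin3 (2 * b1) (2 * b2) jF jxu' jyv'.
have [_ E2] := Rintegral_lin3 (b1 ^+ 2) (b2 ^+ 2) j (jcst 1) (jcst 1).
have -> : (fun w => (x w - 1 * u' w) ^+ 2 + (y w - 1 * v' w) ^+ 2) = fun w =>
    (x w - u w) ^+ 2 + (y w - v w) ^+ 2 + (2 * b1 * (x w - u w) + 2 * b2 * (y w - v w)) +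
    (b1 ^+ 2 * cst 1 w + b2 ^+ 2 * cst 1 w).
  by apply/funext => w; rewrite /u' /v' /=; ring.
rewrite E2 E !RintegralB // Ex Ey -/b1 -/b2 !Rintegral_cst_probability.
have := sqr_ge0 b1; have := sqr_ge0 b2; move: D_le; lra.
Qed.

Lemma normalise_variance_ge : 4^-1 <= s2.
(* Eliminating c between nonnegativity at t = 2 and the bound at t = 1 gives 2 s2 >= 1 - 2D. *)
Proof. by have := Q_ge0 2; move: Q1_le D4; lra. Qed.

(* If D' = 1 - 2c + s2 is E|X - psi|^2, then at t = 1 / sqrt s2 the quadratic
   1 - 2tc + t^2 s2 equals t (D' - (1 - sqrt s2)^2). *)
Lemma normalise_L2 (t := (Num.sqrt s2)^-1) :
  [/\ \int[P]_w (t * u' w) = 0, \int[P]_w (t * v' w) = 0,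
   \int[P]_w ((t * u' w) ^+ 2 + (t * v' w) ^+ 2) = 1 &
   \int[P]_w ((x w - t * u' w) ^+ 2 + (y w - t * v' w) ^+ 2) <= 2 * D].
Proof.
have s0 : 0 < s2 by apply: lt_le_trans normalise_variance_ge; lra.
have jU := integrable_of_sqr mu ju; have jV := integrable_of_sqr mv jv.
have E0 f : P.-integrable setT (EFin \o f) -> \int[P]_w (f w - \int[P]_w f w) = 0.
  by move=> jf; rewrite (RintegralB measurableT jf (jcst _)) Rintegral_cst_probability subrr.
have t2 : t ^+ 2 = s2^-1 by rewrite /t exprVn sqr_sqrtr // ltW.
split.
- by rewrite RintegralZl ?E0 ?mulr0 //; exact: (integrable_of_sqr mu' ju').
- by rewrite RintegralZl ?E0 ?mulr0 //; exact: (integrable_of_sqr mv' jv').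
- have -> : (fun w => (t * u' w) ^+ 2 + (t * v' w) ^+ 2) =
    fun w => t ^+ 2 * (u' w ^+ 2 + v' w ^+ 2) by apply/funext => w; ring.
  by rewrite RintegralZl // t2 mulVf // gt_eqF.
have [_ ->] := Q t; rewrite t2 mulVf ?gt_eqF //.
have sg : 2^-1 <= Num.sqrt s2.
  rewrite -[2^-1](@ger0_norm R) // -sqrtr_sqr ler_sqrt ?(ltW s0) //.
  by move: normalise_variance_ge; rewrite exprVn -natrX.
have sg2 : Num.sqrt s2 ^+ 2 = s2 by rewrite sqr_sqrtr // ltW.
have t0 : 0 < t by rewrite invr_gt0; apply: lt_le_trans sg.
have -> : 1 - 2 * t * c + 1 = t * (2 * Num.sqrt s2 - 2 * c).
  rewrite /t; field; rewrite gt_eqF //; exact: lt_le_trans sg.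
have tl : t <= 2 by rewrite /t -[2]invrK lef_pV2 // posrE //; exact: lt_le_trans sg.
have h : 2 * Num.sqrt s2 - 2 * c <= D.
  by apply: le_trans Q1_le; have := sqr_ge0 (Num.sqrt s2 - 1); lra.
have D0 : 0 <= D by apply: le_trans Q1_le; have := Q_ge0 1; lra.
by apply: (le_trans (ler_wpM2l (ltW t0) h)); rewrite ler_wpM2r.
Qed.

End Normalise.

Section ComplexMeasurable.
Variable R : realType.

Lemma measurable_ReIm (B : set (R * R)) : measurable B ->
  measurable (@ReIm R @^-1` B).
Proof. by move=> mB; exists B => //; rewrite setTI. Qed.

Lemma measurable_Re : measurable_fun setT (@complex.Re R : R[i] -> R).
Proof.
move=> _ B mB; rewrite setTI; have -> : (@complex.Re R : R[i] -> R) @^-1` B = @ReIm R @^-1` (B `*` setT).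
  by apply/seteqP; split => z /=; [| case].
by apply: measurable_ReIm; exact: measurableX.
Qed.

Lemma measurable_Im : measurable_fun setT (@complex.Im R : R[i] -> R).
Proof.
move=> _ B mB; rewrite setTI; have -> : (@complex.Im R : R[i] -> R) @^-1` B = @ReIm R @^-1` (setT `*` B).
  by apply/seteqP; split => z /=; [| case].
by apply: measurable_ReIm; exact: measurableX.
Qed.

Lemma sum_complex (I : finType) (a b : I -> R) :
  \sum_i (a i +i* b i)%C = ((\sum_i a i) +i* (\sum_i b i))%C.
Proof.
by elim/big_rec3: _ => // i x y z _ ->.
Qed.

End ComplexMeasurable.

Section Approximation.
Context d (T : measurableType d) (R : realType) (P : probability T R).
Variable X : nat -> nat -> {RV P >-> R[i]}.
Let xi := X 0%N 0%N.
Hypothesis jRe : P.-integrable setT (EFin \o (fun w => complex.Re (xi w) ^+ 2)).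
Hypothesis jIm : P.-integrable setT (EFin \o (fun w => complex.Im (xi w) ^+ 2)).
Hypothesis ERe : \int[P]_w complex.Re (xi w) = 0.
Hypothesis EIm : \int[P]_w complex.Im (xi w) = 0.
Hypothesis Esq : \int[P]_w (complex.Re (xi w) ^+ 2 + complex.Im (xi w) ^+ 2) = 1.

Lemma finite_label_approx (eps : R) : 0 < eps ->
  exists (U : finType) (lab : R[i] -> U) (val : U -> R[i]),
  [/\ forall u, measurable (lab @^-1` [set u]),
      \sum_u (label_prob X lab u)%:C%C * val u = 0,
      \sum_u (label_prob X lab u)%:C%C * (val u * (val u)^*) = 1,
      measurable_fun setT (fun z : R[i] => sqmod (z - val (lab z))) &
      P.-integrable setT (EFin \o (fun w => sqmod (xi w - val (lab (xi w))))) /\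
      \int[P]_w sqmod (xi w - val (lab (xi w))) <= eps].
Proof.
(* The bound 1/4 keeps the variance away from 0, and eps / 2 compensates the factor 2 lost in the
   normalisation. *)
move=> eps0; pose D : R := Num.min 4^-1 (eps / 2).
have D0 : 0 < D by rewrite /D lt_min invr_gt0 divr_gt0 // ltr0n.
have D2 : 0 < D / 2 by rewrite divr_gt0.
have D4 : D <= 4^-1 by rewrite /D ge_min lexx.
have De : 2 * D <= eps by rewrite mulrC -ler_pdivlMr // /D ge_min lexx orbT.
have [u [uf um uD]] := simple_approx_L2 (@measurable_Re R) D2 jRe.
have [v [vf vm vD]] := simple_approx_L2 (@measurable_Im R) D2 jIm.
have mxi : measurable_fun setT xi by exact: measurable_funP.
have [s Es] : exists s : seq (R * R), range (fun z : R[i] => (u z, v z)) = [set` s].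
  by apply/finite_seqP; exact: (finite_image11 (fun a b : R => (a, b)) uf vf).
have ins z : (u z, v z) \in s.
  have : [set` s] (u z, v z) by rewrite -Es; exists z.
  by [].
(* The label is the pair of simple values itself; [val] decodes it with the affine normalisation, so
   the law of the label alone carries mean 0 and variance 1. *)
pose lab z : seq_sub s := SeqSub (ins z).
have mlab c : measurable (lab @^-1` [set c]).
  have -> : lab @^-1` [set c] = (u @^-1` [set (ssval c).1]) `&` (v @^-1` [set (ssval c).2]).
    apply/seteqP; split => z /=; first by move=> <-.
    by move=> [e1 e2]; apply/val_inj => /=; rewrite e1 e2; case: (ssval c).
  by apply: measurableI; rewrite -[X in measurable X]setTI; [exact: um | exact: vm].
have bounded (g : R * R -> R) : exists B, forall z, `|g (u z, v z)| <= B.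
  exists (\sum_(c : seq_sub s) `|g (ssval c)|) => z.
  by rewrite (bigD1 (lab z)) //= lerDl sumr_ge0.
have mU : measurable_fun setT (fun w => u (xi w)) by exact: measurableT_comp.
have mV : measurable_fun setT (fun w => v (xi w)) by exact: measurableT_comp.
have mx : measurable_fun setT (fun w => complex.Re (xi w)).
  by apply: measurableT_comp => //; exact: measurable_Re.
have my : measurable_fun setT (fun w => complex.Im (xi w)).
  by apply: measurableT_comp => //; exact: measurable_Im.
have ju : P.-integrable setT (EFin \o (fun w => u (xi w) ^+ 2)).
  have [B hB] := bounded (fun c => c.1 ^+ 2).
  apply: (@bounded_integrable _ _ _ _ _ B); first exact: measurable_funX.
  by move=> w; exact: hB.
have jv : P.-integrable setT (EFin \o (fun w => v (xi w) ^+ 2)).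
  have [B hB] := bounded (fun c => c.2 ^+ 2).
  apply: (@bounded_integrable _ _ _ _ _ B); first exact: measurable_funX.
  by move=> w; exact: hB.
have DD : \int[P]_w ((complex.Re (xi w) - u (xi w)) ^+ 2 + (complex.Im (xi w) - v (xi w)) ^+ 2) <= D.
  by rewrite RintegralD ?integrable_sqrB // [leRHS]splitr lerD.
have [E1 E2 E3 E4] := normalise_L2 mx my mU mV jRe jIm ju jv ERe EIm Esq DD D4.
set b1 := \int[P]_w u (xi w) in E1 E2 E3 E4 *.
set b2 := \int[P]_w v (xi w) in E1 E2 E3 E4 *.
set t := (Num.sqrt _)^-1 in E1 E2 E3 E4 *.
pose val (c : seq_sub s) : R[i] := ((t * ((ssval c).1 - b1)) +i* (t * ((ssval c).2 - b2)))%C.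
have valE z : val (lab z) = ((t * (u z - b1)) +i* (t * (v z - b2)))%C by [].
have [m1 m2] : measurable_fun setT (fun z : R[i] => t * (u z - b1)) /\
    measurable_fun setT (fun z : R[i] => t * (v z - b2)).
  by split; apply: measurable_funM => //; exact: measurable_funB.
have jbd (f : T -> R) (g : R * R -> R) : measurable_fun setT f ->
    (forall w, f w = g (u (xi w), v (xi w))) -> P.-integrable setT (EFin \o f).
  move=> mf fg; have [B hB] := bounded g.
  by apply: (@bounded_integrable _ _ _ _ _ B) => // w; rewrite fg.
have sqE z : sqmod (z - val (lab z)) =
    (complex.Re z - t * (u z - b1)) ^+ 2 + (complex.Im z - t * (v z - b2)) ^+ 2.
  by rewrite valE; case: z.
exists (seq_sub s), lab, val; split => //.
- have e c : (label_prob X lab c)%:C%C * val c =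
      ((label_prob X lab c * complex.Re (val c)) +i* (label_prob X lab c * complex.Im (val c)))%C.
    by rewrite /val; simpc.
  under eq_bigr do rewrite e.
  rewrite sum_complex -(Rintegral_label X mlab (fun c => complex.Re (val c))).
  by rewrite -(Rintegral_label X mlab (fun c => complex.Im (val c))) /= E1 E2.
- have e c : (label_prob X lab c)%:C%C * (val c * (val c)^*) =
      (label_prob X lab c * sqmod (val c))%:C%C.
    by rewrite -normCK -sqmodE rmorphM.
  under eq_bigr do rewrite e.
  rewrite -(rmorph_sum (real_complex R)) /= -(Rintegral_label X mlab (fun c => sqmod (val c))).
  by rewrite /sqmod /= E3.
- under eq_fun do rewrite sqE.
  apply: measurable_funD; apply: measurable_funX; apply: measurable_funB => //.
    exact: measurable_Re.
  exact: measurable_Im.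
split.
  under eq_fun do rewrite /= sqE.
  have m1' : measurable_fun setT (fun w => t * (u (xi w) - b1)).
    by apply: measurable_funM => //; exact: measurable_funB.
  have m2' : measurable_fun setT (fun w => t * (v (xi w) - b2)).
    by apply: measurable_funM => //; exact: measurable_funB.
  apply: (integrableD _ (integrable_sqrB mx m1' jRe _) (integrable_sqrB my m2' jIm _)) => //.
    apply: (jbd _ (fun c => (t * (c.1 - b1)) ^+ 2)) => //; exact: measurable_funX.
  by apply: (jbd _ (fun c => (t * (c.2 - b2)) ^+ 2)) => //; exact: measurable_funX.
under eq_Rintegral do rewrite sqE.
exact: le_trans E4 De.
Qed.

End Approximation.

Lemma normc_sqr (R : realType) (z : R[i]) : Normc.normc z ^+ 2 = sqmod z.
Proof. by case: z => a b; rewrite /= sqr_sqrtr // addr_ge0 ?sqr_ge0. Qed.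

(** * Passage to general entries *)

Section AlmostSure.
Context d (T : measurableType d) (R : realType) (P : probability T R).
Variable X : nat -> nat -> {RV P >-> R[i]}.
Hypothesis X_indep : independent P (fun ij : nat * nat => X ij.1 ij.2).
Hypothesis X_iid : identically_distributed P (fun ij : nat * nat => X ij.1 ij.2).
Hypothesis ERe : ('E_P[fun w => complex.Re (X 0%N 0%N w)] = 0)%E.
Hypothesis EIm : ('E_P[fun w => complex.Im (X 0%N 0%N w)] = 0)%E.
Hypothesis Esq : ('E_P[fun w => (Normc.normc (X 0%N 0%N w) ^+ 2)%R] = 1)%E.
Let xi := X 0%N 0%N.

Let mxi : measurable_fun setT xi. Proof. exact: measurable_funP. Qed.

Let msqmod : measurable_fun setT (@sqmod R).
Proof.
apply: measurable_funD; apply: measurable_funX; [exact: measurable_Re|exact: measurable_Im].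
Qed.

Let Isq : (\int[P]_w (sqmod (xi w))%:E = 1)%E.
Proof. by rewrite -Esq unlock; apply: eq_integral => w _; rewrite normc_sqr. Qed.

Let jsq : P.-integrable setT (EFin \o (fun w => sqmod (xi w))).
Proof.
apply/integrableP; split; first by apply/measurable_EFinP; exact: measurableT_comp.
rewrite (eq_integral (fun w => (sqmod (xi w))%:E)) ?Isq ?ltry // => w _.
by rewrite gee0_abs // lee_fin sqmod_ge0.
Qed.

Let jRe : P.-integrable setT (EFin \o (fun w => complex.Re (xi w) ^+ 2)).
Proof.
apply: (le_integrable measurableT _ _ jsq).
  apply/measurable_EFinP; apply: measurable_funX.
  by apply: measurableT_comp => //; exact: measurable_Re.
move=> w _ /=; rewrite lee_fin !ger0_norm ?sqr_ge0 ?sqmod_ge0 //.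
by rewrite /sqmod lerDl sqr_ge0.
Qed.

Let jIm : P.-integrable setT (EFin \o (fun w => complex.Im (xi w) ^+ 2)).
Proof.
apply: (le_integrable measurableT _ _ jsq).
  apply/measurable_EFinP; apply: measurable_funX.
  by apply: measurableT_comp => //; exact: measurable_Im.
move=> w _ /=; rewrite lee_fin !ger0_norm ?sqr_ge0 ?sqmod_ge0 //.
by rewrite /sqmod lerDr sqr_ge0.
Qed.

Let ERe' : \int[P]_w complex.Re (xi w) = 0.
Proof. by move: ERe; rewrite unlock /Rintegral => ->. Qed.

Let EIm' : \int[P]_w complex.Im (xi w) = 0.
Proof. by move: EIm; rewrite unlock /Rintegral => ->. Qed.

Let Esq' : \int[P]_w sqmod (xi w) = 1.
Proof. by rewrite /Rintegral Isq. Qed.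

Variable s : nat.
Let r := s.+1.

(** The m-th approximation applies one function Y to every entry, so all approximations live on the
    given probability space and countably many almost sure events, one for each accuracy 1 / (m +
    1), can be intersected. *)
Lemma staircase_cvg_ae : {ae P, forall w, cvg_in_distribution
  (fun N => empirical_df (staircase_gram r N (fun i j => X i j w)))
  (distribution_function (fuss_catalan_law R s))}.
Proof.
have approx m : exists Y : R[i] -> R[i],
   {ae P, forall w, (\forall N \near \oo,
      box_sum s N (fun i j => sqmod (X i j w - Y (X i j w))) <=
      8 * r%:R ^+ 2 * m.+1%:R^-1 * N%:R ^+ 2) /\
     (forall k, (\sum_j @stair_eig R s N (fun i j => Y (X i j w)) j ^+ k) / (r * N)%:R
        @[N --> \oo] --> fuss_catalan R r k)}.
  have e0 : (0 : R) < m.+1%:R^-1 by rewrite invr_gt0.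
  have [U [lab [val [mlab v1 v2 mf [jf fe]]]]] :=
    finite_label_approx jRe jIm ERe' EIm' Esq' e0.
  exists (fun z => val (lab z)).
  apply: filterS2 (box_sum_eventually X_indep X_iid s mf (fun z => sqmod_ge0 _) jf e0 fe)
    (label_moment_cvg X_indep X_iid mlab s v1 v2).
  by move=> w h1 h2; split.
have [Y hY] := choice approx.
have one : \int[P]_w sqmod (xi w) <= 1 by rewrite Esq'.
have hX := box_sum_eventually X_indep X_iid s msqmod (@sqmod_ge0 R) jsq ltr01 one.
have hY' : {ae P, forall w, forall m, (\forall N \near \oo,
      box_sum s N (fun i j => sqmod (X i j w - Y m (X i j w))) <=
      8 * r%:R ^+ 2 * m.+1%:R^-1 * N%:R ^+ 2) /\
     (forall k, (\sum_j @stair_eig R s N (fun i j => Y m (X i j w)) j ^+ k) / (r * N)%:R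
        @[N --> \oo] --> fuss_catalan R r k)} by apply: ae_foralln.
apply: filterS2 hX hY' => w h1 h2.
apply: (@staircase_cvg_in_distribution R s (fuss_catalan_law R s)
  (fuss_catalan_law_moments R s) (@fuss_catalan_law_neg R s) (fun i j => X i j w)
  (fun m i j => Y m (X i j w)) (8 * r%:R ^+ 2 * 1) (fun m => 8 * r%:R ^+ 2 * m.+1%:R^-1)).
- by rewrite mulr1 mulr_ge0 // exprn_ge0.
- rewrite -[X in _ --> X](mulr0 (8 * r%:R ^+ 2)); apply: cvgMr; exact: cvg_harmonic.
- exact: h1.
- by move=> m; exact: (h2 m).1.
- by move=> m k; exact: (h2 m).2.
Qed.

End AlmostSure.

Unset Implicit Arguments.

Theorem theorem1 (R : realType) (r : nat) (hr : (1 <= r)%N) :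
  exists mu : probability (measurableTypeR R) R,
    [/\ fuss_catalan_moments r mu,
        (forall nu : probability (measurableTypeR R) R,
          fuss_catalan_moments r nu ->
          forall A : set (measurableTypeR R), measurable A -> nu A = mu A)
      & forall (d : measure_display) (T : measurableType d)
          (P : probability T R) (X : nat -> nat -> {RV P >-> R[i]}),
          independent P (fun ij : nat * nat => X ij.1 ij.2) ->
          identically_distributed P (fun ij : nat * nat => X ij.1 ij.2) ->
          (forall i j, ('E_P[fun w => complex.Re (X i j w)] = 0)%E) ->
          (forall i j, ('E_P[fun w => complex.Im (X i j w)] = 0)%E) ->
          (forall i j, ('E_P[fun w => (Normc.normc (X i j w) ^+ 2)%R] = 1)%E) ->
          {ae P, forall w, cvg_in_distribution
            (fun N => empirical_df (staircase_gram r N (fun i j => X i j w)))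
            (distribution_function mu)}].
Proof.
(* The law is built from U_r and U_(r-1), hence the parameter s = r - 1. *)
case: r hr => [//|s] _; exists (fuss_catalan_law R s).
have mom := fuss_catalan_law_moments R s.
split => //.
  move=> nu nu_mom A mA.
  apply: (@moment_determinate R nu (fuss_catalan_law R s) (fuss_catalan R s.+1) (2 ^+ s.+2)) => //.
  - exact: fuss_catalan_le.
  - by move=> k; exact: (nu_mom k).1.
  - by move=> k; exact: (nu_mom k).2.
  - by move=> k; exact: (mom k).1.
  - by move=> k; exact: (mom k).2.
move=> d T P X ind iid E1 E2 E3.
exact: staircase_cvg_ae ind iid (E1 _ _) (E2 _ _) (E3 _ _) s.
Qed.
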